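(* Given $v^0,v^1\in V_h^E$, let $v^{n+1}\in V_h^E$, $n=1,\dots,N-1$, be defined by $$(\partial_t^2v^n,w)_L+a_h(v^n,w)=r^n(w)\qquad\text{for all } w\in V_h^E,$$ where $r^n=r_1^n+r_2^n$ with $r_1^n,r_2^n:V_h\to\mathbb{R}$ linear functionals, and assume that $$\Big|\sum_{n=1}^{N-1}2k\,r^n(\delta_tv^n)\Big|\lesssim|||r_1|||_{a_h,\bigstar}\max_{0\le n\le N}\|v^n\|_{a_h}+|||r_2|||_{L,\bigstar}\max_{0\le n\le N-1}\|\partial_tv^n\|_L .$$ If $k/h\le c$ with $c$ sufficiently small, then the following stability estimate holds, with constant independent of $h$ and $k$: $$\max_{2\le n\le N}\Big(\|\partial_tv^{n-1}\|_L^2+\|v^n\|_{a_h}^2+\|v^{n-1}\|_{a_h}^2\Big)\lesssim\|\partial_tv^0\|_L^2+\|v^1\|_{a_h}^2+\|v^0\|_{a_h}^2+|||r_1|||_{a_h,\bigstar}^2+|||r_2|||_{L,\bigstar}^2 .$$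
   Context: $\Omega\subset\mathbb{R}^d$, $d\ge 2$, is an open connected (bounded) domain with smooth boundary $\Gamma=\partial\Omega$. $\Omega_0\supset\Omega$ is a polygonal domain, and $\mathcal{T}_{0,h}$, $h\in(0,h_0]$, is a family of quasi-uniform (shape regular) triangulations of $\Omega_0$ into simplices with mesh parameter $h$. The active mesh is $\mathcal{T}_h=\{T\in\mathcal{T}_{0,h}: T\cap\Omega\ne\emptyset\}$, with vertex set $\mathcal{X}_h$; $\Omega_h=\cup_{T\in\mathcal{T}_h}T$. Let $\mathcal{T}_{h,I}=\{T\in\mathcal{T}_h: T\subset\Omega\}$ and $\mathcal{T}_{h,B}=\mathcal{T}_h\setminus\mathcal{T}_{h,I}$. $W_h$ is the space of discontinuous piecewise linear functions on $\mathcal{T}_h$, $V_h=W_h\cap C^0(\Omega_h)$, $W_{h,I}=W_h|_{\mathcal{T}_{h,I}}$, $V_{h,I}=V_h|_{\mathcal{T}_{h,I}}$. Discrete extension: $S_h:\mathcal{T}_h\to\mathcal{T}_{h,I}$ is a mapping with $S_h(T)=T$ for $T\in\mathcal{T}_{h,I}$ and $\operatorname{diam}(T\cup S_h(T))\lesssim h$ for all $T\in\mathcal{T}_{h,B}$, uniformly in $T$ and $h\in(0,h_0]$; $h_0$ is assumed small enough that such a mapping exists. For $v\in\mathbb{P}_1(T)$ let $v^e\in\mathbb{P}_1(\mathbb{R}^d)$ be its canonical polynomial extension. $F_h:W_{h,I}\to W_h$ is defined by $(F_hv)|_T=(v|_{S_h(T)})^e|_T$. The averaging operator $A_h:W_h\to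 V_h$ is $A_hw=\sum_{x\in\mathcal{X}_h}\langle w\rangle_x\varphi_x$, where $\varphi_x$ is the nodal basis function of $V_h$ at $x$, $\langle w\rangle_x=\sum_{T\in\mathcal{T}_h(x)}\kappa_{T,x}\,w|_T(x)$, $\mathcal{T}_h(x)=\{T\in\mathcal{T}_h:x\in T\}$, $\kappa_{T,x}\ge0$, $\sum_{T\in\mathcal{T}_h(x)}\kappa_{T,x}=1$. Set $E_h=A_h\circ F_h:V_{h,I}\to V_h$ and $V_h^E=E_hV_{h,I}$. Lumping: $(\cdot,\cdot)$ is the $L^2(\Omega)$ inner product. Let $\{\varphi_i\}_{i\in\mathcal{I}_{h,I}}$ be the nodal basis of $V_{h,I}$; $\{E_h\varphi_i\}_{i\in\mathcal{I}_{h,I}}$ is used as basis of $V_h^E$, and $\widehat v$ denotes the coefficient vector of $v\in V_h^E$ in this basis. The mass matrix has entries $\widehat m_{ij}=(E_h\varphi_i,E_h\varphi_j)$, the lumped mass matrix $\widehat M_L$ is diagonal with entries $\widehat M_{L,ii}=\sum_{l\in\mathcal{I}_{h,I}}\widehat m_{il}$, and $(v,w)_L=(\widehat M_L\widehat v,\widehat w)_{\mathcal{I}_{h,I}}$, $\|v\|_L^2=(v,v)_L$ for $v,w\in V_h^E$. Nitsche form: with $\nabla_n=n\cdot\nabla$, $n$ the exterior unit normal, $$a_h(u,v)=(\nabla u,\nabla v)-(\nabla_nu,v)_{\partial\Omega}-(u,\nabla_nv)_{\partial\Omega}+\gamma h^{-1}(u,v)_{\partial\Omega},$$ with $\gamma$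 fixed large enough (independently of $h$) that $a_h$ is coercive on $V_h^E$ with respect to $|||v|||_h^2=\|\nabla v\|^2+h\|\nabla_nv\|^2_{\partial\Omega}+h^{-1}\|v\|^2_{\partial\Omega}$, uniformly in $h$; $\|v\|_{a_h}^2=a_h(v,v)$ for $v\in V_h^E$. Time differences: $[0,T]$ is divided into $N$ intervals of length $k=T/N$, $t_n=nk$. $\partial_tv^n=(v^{n+1}-v^n)/k$, $\partial_t^2v^n=(v^{n+1}-2v^n+v^{n-1})/k^2$, $\delta_tv^n=\tfrac12(\partial_tv^n+\partial_tv^{n-1})$; the same notation is used for sequences of functionals. Dual norms: for a linear functional $l:V_h\to\mathbb{R}$, $\|l\|_{a_h,\bigstar}=\sup_{v\in V_h^E\setminus\{0\}}l(v)/\|v\|_{a_h}$ and $\|l\|_{L,\bigstar}=\sup_{v\in V_h^E\setminus\{0\}}l(v)/\|v\|_L$. For sequences $r_1=\{r_1^n\}_{n=0}^N$ and $r_2=\{r_2^n\}$, $$|||r_1|||_{a_h,\bigstar}=\|r_1^N\|_{a_h,\bigstar}+\|r_1^{N-1}\|_{a_h,\bigstar}+\|r_1^1\|_{a_h,\bigstar}+\|r_1^0\|_{a_h,\bigstar}+\sum_{n=0}^{N-1}k\|\partial_tr_1^n\|_{a_h,\bigstar},$$ $$|||r_2|||_{L,\bigstar}=\sum_{n=1}^{N-1}2k\|r_2^n\|_{L,\bigstar}.$$ $a\lesssim b$ means $a\le Cb$ with $C$ independent of $h$, $k$ and the functions and functionals involved.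
   Formalization: Added assumption: the lumped masses satisfy M_{L,ii} ≥ m h^d with m > 0 independent of h; the standing assumptions on S_h and the averaging weights allow negative or o(h^d) lumped masses, for which the L-norm is undefined or no uniform CFL constant exists. *)

(* Defs.v *)
From HB Require Import structures.
From mathcomp Require Import all_boot all_order all_algebra.
From mathcomp Require Import all_classical all_reals all_analysis.

Set Implicit Arguments.
Unset Strict Implicit.
Unset Printing Implicit Defensive.

Import Order.TTheory GRing.Theory Num.Theory numFieldNormedType.Exports.
Local Open Scope classical_set_scope.
Local Open Scope ring_scope.

(* The norm that the library puts on row vectors is the sup norm; lengths,
   balls and diameters below are Euclidean, and the topology is the same. *)
Section Euclidean.
Context {R : realType} {d : nat}.
Implicit Types (x y : 'rV[R]_d) (A : set 'rV[R]_d).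

Definition dot x y : R := \sum_(i < d) x 0 i * y 0 i.
Definition enorm x : R := Num.sqrt (dot x x).
Definition diam A : R := sup [set enorm (p.1 - p.2) | p in A `*` A].
Definition frontier A : set 'rV[R]_d := closure A `\` interior A.

End Euclidean.

(* T with every subset declared measurable, so that mu_ext g is the outer
   measure generated by coverings with arbitrary sets U of weight g U. *)
Definition powersets (T : Type) : Type := T.

Section Powersets.
Variable T : pointedType.
HB.instance Definition _ := Pointed.on (powersets T).
HB.instance Definition _ := @isMeasurable.Build default_measure_display
  (powersets T) discrete_measurable discrete_measurable0
  discrete_measurableC discrete_measurableU.
End Powersets.

Section LebesgueOuter.
Context (R : realType) (n : nat).
Local Open Scope ereal_scope.

(* Infimum of the volumes of the closed boxes [a, b] that contain A: covering
   by sets of finite weight amounts to covering by boxes. *)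
Definition box_gauge (A : set (powersets 'rV[R]_n)) : \bar R :=
  if `[< A = set0 >] then 0 else
  ereal_inf [set (\prod_(i < n) (p.2 0%R i - p.1 0%R i))%:E
            | p in [set p : 'rV[R]_n * 'rV[R]_n |
                     (forall i, p.1 0 i <= p.2 0 i)%R /\
                     (forall x : 'rV[R]_n, A x ->
                       forall i, p.1 0 i <= x 0 i <= p.2 0 i)%R]].

Lemma box_gauge0 : box_gauge set0 = 0.
Proof. by rewrite /box_gauge; case: asboolP. Qed.

Lemma box_gauge_ge0 A : 0 <= box_gauge A.
Proof.
rewrite /box_gauge; case: asboolP => // _.
apply: le_ereal_inf_tmp => _ [p [ab _] <-].
by rewrite lee_fin prodr_ge0// => i _; rewrite subr_ge0.
Qed.

Definition lebesgue_outer : set 'rV[R]_n -> \bar R := mu_ext box_gauge.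

HB.instance Definition _ := isOuterMeasure.Build R 'rV[R]_n lebesgue_outer
  (mu_ext0 box_gauge0 box_gauge_ge0) (mu_ext_ge0 box_gauge_ge0)
  (le_mu_ext box_gauge) (mu_ext_sigma_subadditive box_gauge_ge0).

End LebesgueOuter.

(* s-dimensional Hausdorff measure in R^n, normalised by
   |unit ball of R^s| / 2^s so as to be the s-dimensional surface area. *)
Section HausdorffOuter.
Context (R : realType) (n s : nat).
Local Open Scope ereal_scope.

Definition hausdorff_const : R :=
  (fine (lebesgue_outer [set x : 'rV[R]_s | enorm x <= 1]) / 2 ^+ s)%R.

Definition hausdorff_gauge (delta : R) (A : set (powersets 'rV[R]_n))
    : \bar R :=
  if `[< A = set0 >] then 0 else
  if `[< forall x y : 'rV[R]_n, A x -> A y -> (enorm (x - y) <= delta)%R >]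
  then (hausdorff_const * diam (A : set 'rV[R]_n) ^+ s)%:E else +oo.

Lemma hausdorff_gauge0 delta : hausdorff_gauge delta set0 = 0.
Proof. by rewrite /hausdorff_gauge; case: asboolP. Qed.

Lemma diam_ge0 (A : set 'rV[R]_n) : (0 <= diam A)%R.
Proof.
rewrite /diam; set E := (X in sup X).
have [->|/set0P[e Ee]] := eqVneq E set0; first by rewrite sup0.
have [supE|/sup_out -> //] := pselect (has_sup E).
apply: (le_trans _ (ub_le_sup supE.2 Ee)).
by case: Ee => p _ <-; exact: sqrtr_ge0.
Qed.

Lemma hausdorff_gauge_ge0 delta A : 0 <= hausdorff_gauge delta A.
Proof.
rewrite /hausdorff_gauge; case: asboolP => // _; case: asboolP => // _.
rewrite lee_fin mulr_ge0 ?exprn_ge0 ?diam_ge0// divr_ge0 ?exprn_ge0//.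
exact/fine_ge0/outer_measure_ge0.
Qed.

Definition hausdorff_outer (A : set 'rV[R]_n) : \bar R :=
  ereal_sup [set mu_ext (hausdorff_gauge delta) A
            | delta in [set delta : R | (0 < delta)%R]].

Lemma hausdorff_outer0 : hausdorff_outer set0 = 0.
Proof.
rewrite /hausdorff_outer; set E := (X in ereal_sup X).
suff -> : E = [set 0] by rewrite ereal_sup1.
apply/seteqP; split => [_ [delta _ <-]|_ ->] /=.
  exact: mu_ext0 (hausdorff_gauge0 delta) (hausdorff_gauge_ge0 delta).
by exists 1%R => //=; apply: mu_ext0 (hausdorff_gauge0 1) (hausdorff_gauge_ge0 1).
Qed.

Lemma hausdorff_outer_ge0 A : 0 <= hausdorff_outer A.
Proof.
apply: (@le_trans _ _ (mu_ext (hausdorff_gauge 1) A)).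
  exact: mu_ext_ge0 (hausdorff_gauge_ge0 1) A.
by apply: ereal_sup_ubound; exists 1%R => //=.
Qed.

Lemma le_hausdorff_outer :
  {homo hausdorff_outer : A B / A `<=` B >-> A <= B}.
Proof.
move=> A B AB; apply: ge_ereal_sup => _ [delta d0 <-].
apply: (@le_trans _ _ (mu_ext (hausdorff_gauge delta) B)).
  exact: le_mu_ext.
by apply: ereal_sup_ubound; exists delta.
Qed.

Lemma hausdorff_outer_sigma_subadditive : sigma_subadditive hausdorff_outer.
Proof.
move=> F; apply: ge_ereal_sup => _ [delta d0 <-].
apply: le_trans.
  exact: (mu_ext_sigma_subadditive (hausdorff_gauge_ge0 delta)).
apply: lee_nneseries => [i _ _|i _].
  exact: mu_ext_ge0 (hausdorff_gauge_ge0 delta) _.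
by apply: ereal_sup_ubound; exists delta.
Qed.

HB.instance Definition _ := isOuterMeasure.Build R 'rV[R]_n hausdorff_outer
  hausdorff_outer0 hausdorff_outer_ge0 le_hausdorff_outer
  hausdorff_outer_sigma_subadditive.

End HausdorffOuter.

(* Lebesgue integral with respect to the measure that an outer measure induces
   on its Caratheodory sigma-algebra. *)
Definition ointegral (R : realType) (T : pointedType)
    (mu : {outer_measure set T -> \bar R}) (A : set T) (f : T -> R) : R :=
  fine (\int[(mu : {measure set (caratheodory_type mu) -> \bar R})]_(x in A)
          (f x)%:E)%E.

Section Smoothness.
Context {R : realType} {m : nat}.

Fixpoint Ck (k : nat) (f : 'rV[R]_m -> R) : Prop :=
  continuous f /\
  if k is k'.+1 then
    forall i : 'I_m, (forall x, derivable f x (delta_mx 0 i)) /\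
                     Ck k' (fun x => 'D_(delta_mx 0 i) f x)
  else True.

Definition smooth (f : 'rV[R]_m -> R) : Prop := forall k, Ck k f.

End Smoothness.

Section Domains.
Context {R : realType} {d : nat}.
Implicit Types (Omega : set 'rV[R]_d) (x : 'rV[R]_d).

(* col' i y is y without its i-th coordinate; graph_fun b i g is a defining
   function of one of the two sides of the graph y_i = g y'. *)
Definition graph_fun (b : bool) (i : 'I_d) (g : 'rV[R]_d.-1 -> R)
    (y : 'rV[R]_d) : R :=
  (-1) ^+ b * (g (col' i y) - y 0 i).

Definition local_graph Omega x0 (b : bool) (i : 'I_d) (g : 'rV[R]_d.-1 -> R)
    : Prop :=
  smooth g /\
  exists2 r : R, 0 < r & forall y, enorm (y - x0) < r ->
    (Omega y <-> graph_fun b i g y < 0).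

Definition smooth_domain Omega : Prop :=
  [/\ open Omega, connected Omega, bounded_set Omega, Omega !=set0
    & forall x0, frontier Omega x0 -> exists b i g, local_graph Omega x0 b i g].

Definition grad (f : 'rV[R]_d -> R) x : 'rV[R]_d :=
  \row_(j < d) 'D_(delta_mx 0 j) f x.

Definition exterior_unit_normal Omega x : 'rV[R]_d :=
  xget 0 [set nu | exists b i g, local_graph Omega x b i g /\
    nu = (enorm (grad (graph_fun b i g) x))^-1 *: grad (graph_fun b i g) x].

Definition polygonal_domain (Omega0 : set 'rV[R]_d) : Prop :=
  [/\ open Omega0, connected Omega0, bounded_set Omega0, Omega0 !=set0
    & exists s : seq ('rV[R]_d * R), all (fun p => p.1 != 0) s /\
        forall x, frontier Omega0 x -> exists2 p, p \in s & dot p.1 x = p.2].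

End Domains.

(* Elements are sets of d + 1 vertex indices; simplex A is the convex hull of
   the vertices in A, and is empty if A is. *)
Record mesh (R : realType) (d : nat) := Mesh {
  nvert : nat;
  vert : 'I_nvert -> 'rV[R]_d;
  elts : {set {set 'I_nvert}} }.

Section Mesh.
Context {R : realType} {d : nat}.
Variable M : mesh R d.

Definition elt := {set 'I_(nvert M)}.

Definition simplex (A : elt) : set 'rV[R]_d :=
  [set x | exists c : 'I_(nvert M) -> R,
    [/\ forall i, 0 <= c i, forall i, i \notin A -> c i = 0,
        \sum_i c i = 1 & x = \sum_i c i *: vert i]].

Definition affinely_independent (A : elt) : Prop :=
  forall c : 'I_(nvert M) -> R, (forall i, i \notin A -> c i = 0) ->
    \sum_i c i = 0 -> \sum_i c i *: vert i = 0 -> forall i, c i = 0.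

Definition triangulation (Omega0 : set 'rV[R]_d) : Prop :=
  [/\ injective (@vert _ _ M),
      forall A, A \in elts M -> #|A| = d.+1 /\ affinely_independent A,
      forall A B, A \in elts M -> B \in elts M ->
        simplex A `&` simplex B = simplex (A :&: B)
    & closure Omega0 = \bigcup_(A in [set A | A \in elts M]) simplex A].

End Mesh.

(* sigma bounds all ratios diam T / h and h / (inradius of T): this is shape
   regularity together with quasi-uniformity. *)
Definition quasi_uniform (R : realType) (d : nat) (h0 : R)
    (M : R -> mesh R d) : Prop :=
  exists2 sigma : R, 0 < sigma & forall h, 0 < h <= h0 ->
    forall A, A \in elts (M h) ->
      diam (simplex A) <= sigma * h /\
      exists x, forall y, enorm (y - x) <= sigma^-1 * h -> simplex A y.

(* A background mesh with the element map S_h and the averaging weights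
   kappa_{T,x}, the vertex x being given by its index. *)
Record cutmesh (R : realType) (d : nat) := CutMesh {
  bgmesh :> mesh R d;
  smap : elt bgmesh -> elt bgmesh;
  kappa : elt bgmesh -> 'I_(nvert bgmesh) -> R }.

Section Spaces.
Context {R : realType} {d : nat}.
Variables (Omega : set 'rV[R]_d) (D : cutmesh R d).

Local Notation elt := (elt D).
Local Notation vtx := 'I_(nvert D).

Definition active : {set elt} :=
  [set A in elts D | `[< simplex A `&` Omega !=set0 >]].
Definition interior_elts : {set elt} :=
  [set A in active | `[< simplex A `<=` Omega >]].
Definition cut_elts : {set elt} := active :\: interior_elts.

Definition verts (S : {set elt}) : {set vtx} := \bigcup_(A in S) A.

(* (a, b) stands for the polynomial a + b . x on all of R^d; in this encoding
   the canonical extension v^e is the same pair. *)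
Definition peval (p : R * 'rV[R]_d) (x : 'rV[R]_d) : R := p.1 + dot p.2 x.

(* A piecewise linear function is the family of its pieces, set to 0 outside
   the submesh on which it lives. *)
Definition pwlin := {ffun elt -> R * 'rV[R]_d}.

Definition on_submesh (S : {set elt}) : set pwlin :=
  [set w | forall A, A \notin S -> w A = 0].
Definition restr (S : {set elt}) (w : pwlin) : pwlin :=
  [ffun A => if A \in S then w A else 0].

Definition Wh : set pwlin := on_submesh active.
Definition Vh : set pwlin :=
  Wh `&` [set w | forall A B, A \in active -> B \in active ->
    forall x, simplex A x -> simplex B x -> peval (w A) x = peval (w B) x].
Definition VhI : set pwlin := restr interior_elts @` Vh.

Definition nodal (V : set pwlin) (S : {set elt}) (i : vtx) : pwlin :=
  xget 0 (V `&` [set w | forall A, A \in S ->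
    forall j, j \in A -> peval (w A) (vert j) = (i == j)%:R]).

Definition Fh (v : pwlin) : pwlin :=
  [ffun A => if A \in active then v (smap A) else 0].

Definition nodal_average (w : pwlin) (i : vtx) : R :=
  \sum_(A in active | i \in A) kappa A i * peval (w A) (vert i).
Definition Ah (w : pwlin) : pwlin :=
  \sum_(i in verts active) nodal_average w i *: nodal Vh active i.

Definition Eh (v : pwlin) : pwlin := Ah (Fh v).
Definition VhE : set pwlin := Eh @` VhI.

Definition element_map (C h : R) : Prop :=
  [/\ forall A, A \in active -> smap A \in interior_elts,
      forall A, A \in interior_elts -> smap A = A
    & forall A, A \in cut_elts ->
        diam (simplex A `|` simplex (smap A)) <= C * h].

Definition averaging_weights : Prop :=
  forall i, i \in verts active ->
    (forall A, A \in active -> i \in A -> 0 <= kappa A i) /\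
    \sum_(A in active | i \in A) kappa A i = 1.

(* Pointwise values on Omega_h. On the overlap of two elements any choice gives
   the same value for elements of V_h, and for the gradient the overlap is
   Lebesgue-null. *)
Definition val_at (v : pwlin) (x : 'rV[R]_d) : R :=
  if [pick A in active | x \in simplex A] is Some A then peval (v A) x else 0.
Definition grad_at (v : pwlin) (x : 'rV[R]_d) : 'rV[R]_d :=
  if [pick A in active | x \in simplex A] is Some A then (v A).2 else 0.

(* The trace on the boundary of the gradient, taken from inside Omega along the
   normal: the boundary may run along element faces. *)
Definition normal_derivative (v : pwlin) (x : 'rV[R]_d) : R :=
  let n := exterior_unit_normal Omega x in
  if [pick A in active |
        `[< \forall t \near (0 : R)^'+, simplex A (x - t *: n) >]]
  is Some A then dot n (v A).2 else 0.

Definition int_dom (f : 'rV[R]_d -> R) : R :=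
  ointegral (@lebesgue_outer R d) Omega f.
Definition int_bd (f : 'rV[R]_d -> R) : R :=
  ointegral (@hausdorff_outer R d d.-1) (frontier Omega) f.

Definition ip_dom (v w : pwlin) : R :=
  int_dom (fun x => val_at v x * val_at w x).

Definition dofs : {set vtx} := verts interior_elts.
Definition ebasis (i : vtx) : pwlin := Eh (nodal VhI interior_elts i).

Definition ebasis_free : Prop :=
  forall c : vtx -> R, \sum_(i in dofs) c i *: ebasis i = 0 ->
    forall i, i \in dofs -> c i = 0.

Definition ecoef (v : pwlin) : {ffun vtx -> R} :=
  xget 0 [set c : {ffun vtx -> R} | (forall i, i \notin dofs -> c i = 0) /\
                     v = \sum_(i in dofs) c i *: ebasis i].

Definition mass (i j : vtx) : R := ip_dom (ebasis i) (ebasis j).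
Definition lumped_mass (i : vtx) : R := \sum_(l in dofs) mass i l.

Definition ip_lumped (v w : pwlin) : R :=
  \sum_(i in dofs) lumped_mass i * ecoef v i * ecoef w i.
Definition norm_lumped (v : pwlin) : R := Num.sqrt (ip_lumped v v).

Definition nitsche (gamma h : R) (u v : pwlin) : R :=
  int_dom (fun x => dot (grad_at u x) (grad_at v x))
  - int_bd (fun x => normal_derivative u x * val_at v x)
  - int_bd (fun x => val_at u x * normal_derivative v x)
  + gamma * h^-1 * int_bd (fun x => val_at u x * val_at v x).
Definition norm_nitsche (gamma h : R) (v : pwlin) : R :=
  Num.sqrt (nitsche gamma h v v).

Definition energy_sq (h : R) (v : pwlin) : R :=
  int_dom (fun x => enorm (grad_at v x) ^+ 2)
  + h * int_bd (fun x => normal_derivative v x ^+ 2)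
  + h^-1 * int_bd (fun x => val_at v x ^+ 2).

Definition linear_functional (l : pwlin -> R) : Prop :=
  forall (a : R) (u v : pwlin), Vh u -> Vh v -> l (a *: u + v) = a * l u + l v.

Definition dual_norm (nrm l : pwlin -> R) : R :=
  sup [set l v / nrm v | v in VhE `\ 0].

End Spaces.

Arguments Vh {R d} Omega D w.
Arguments VhI {R d} Omega D w.
Arguments VhE {R d} Omega D w.
Arguments lumped_mass {R d} Omega D i.
Arguments norm_lumped {R d} Omega D v.
Arguments ip_lumped {R d} Omega D v w.
Arguments nitsche {R d} Omega D gamma h u v.
Arguments norm_nitsche {R d} Omega D gamma h v.
Arguments energy_sq {R d} Omega D h v.
Arguments linear_functional {R d} Omega D l.
Arguments dual_norm {R d} Omega D nrm l.
Arguments ebasis_free {R d} Omega D.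
Arguments element_map {R d} Omega D C h.

Section TimeDifferences.
Context {R : realType} {V : lmodType R}.
Variable k : R.
Implicit Type v : nat -> V.

Definition dt v (n : nat) : V := k^-1 *: (v n.+1 - v n).
Definition dtt v (n : nat) : V := k^-2 *: (v n.+1 - 2 *: v n + v n.-1).
Definition deltat v (n : nat) : V := 2^-1 *: (dt v n + dt v n.-1).

End TimeDifferences.

Section DualTimeNorms.
Context {R : realType} {V : Type}.
Variables (dnorm : (V -> R^o) -> R) (k : R) (N : nat).
Implicit Type r : nat -> V -> R^o.

Definition tnorm_nitsche r : R :=
  dnorm (r N) + dnorm (r N.-1) + dnorm (r 1%N) + dnorm (r 0%N)
  + \sum_(0 <= n < N) k * dnorm (dt k r n).

Definition tnorm_lumped r : R := \sum_(1 <= n < N) 2 * k * dnorm (r n).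

End DualTimeNorms.

(* Main.v *)
Require Import Defs.
From mathcomp Require Import all_boot all_order all_algebra.
From mathcomp Require Import all_classical all_reals all_analysis.
From mathcomp Require Import measurable_realfun.
From mathcomp Require Import ring lra.

Set Implicit Arguments.
Unset Strict Implicit.
Unset Printing Implicit Defensive.

Import Order.TTheory GRing.Theory Num.Theory numFieldNormedType.Exports.
Local Open Scope classical_set_scope.
Local Open Scope ring_scope.

(** With p^n = (v^{n+1} - v^n)/k, the energy (p^n, p^n)_L + a_h(v^{n+1}, v^n)
    changes in step n by r^n(v^{n+1} - v^{n-1}). Polarisation gives
    a_h(v^{n+1}, v^n) = (|v^{n+1}|^2 + |v^n|^2)/2 - k^2 |p^n|^2/2 in the norm of
    a_h, so under k^2 a_h(w, w) <= (w, w)_L the energy is equivalent to the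
    left-hand side of the estimate; the r_1-part is summed by parts, and both
    parts are bounded by the maximal square root of the energy, which is then
    absorbed.

    The inequality k^2 a_h(w, w) <= (w, w)_L is an inverse estimate. On each
    element w in V_h^E is controlled by the finitely many coefficients of the
    basis functions at distance O(h), whose supports overlap boundedly often
    because the elements contain disjoint balls of radius comparable to h.
    Integration needs only that T has volume O(h^d) and meets the boundary in a
    set of surface measure O(h^{d-1}); the latter holds because the boundary is
    locally a Lipschitz graph. Together with the lower bound of the lumped masses this gives a_h(w, w) = O(h^-2) (w, w)_L.

    a_h is definite on V_h^E because a piecewise affine function with zero
    gradient is constant on the connected set Omega, and the boundary has
    positive surface measure. *)

(** * Time stepping in an inner product space *)

(** The energy at time m contains the residual summed up to m, so the residual is bounded for every
    partial sum, from the dual norms alone. A dual norm is a real supremum and bounds its functional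
    only when the set of quotients is bounded; on the finite-dimensional V_h^E this comes from a
    Riesz representation by the Gram matrix, hence the need for definiteness of both forms.
    Integrals are taken with respect to Caratheodory measures of outer measures, so linearity of a_h
    rests on the measurability of every integrand. Half-spaces are measurable for both measures,
    hence so are open sets; on the boundary the normal is shown to be independent of the chart and
    continuous, and the one-sided condition that selects an element is rewritten with countably many
    inequalities. The constants are fixed before h: those of the boundary by compactness, the
    overlap count by a packing bound in which h cancels. With B the constant of the inverse estimate
    and m h^d the lower bound of the lumped masses, the step restriction is c = (1 + |B|/m)^-1. *)

Section InnerProduct.
Context {R : realType} {V : lmodType R}.
Implicit Types (W : set V) (b : V -> V -> R) (l : V -> R).

(** Subspaces are sets because V_h^E is a set of families of affine pieces, and definiteness of the
    two forms is available only there. *)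
Definition subspace W : Prop :=
  W 0 /\ forall (a : R) u v, W u -> W v -> W (a *: u + v).

Definition linear_on W l : Prop :=
  forall (a : R) u v, W u -> W v -> l (a *: u + v) = a * l u + l v.

(** Linearity is asked in the first argument; symmetry transfers it to the second
    ([ip_linear_r]). *)
Definition inner_product_on W b : Prop :=
  [/\ forall w, W w -> linear_on W (b^~ w),
      forall u v, W u -> W v -> b u v = b v u,
      forall u, W u -> 0 <= b u u
    & forall u, W u -> b u u = 0 -> u = 0].

Section Subspace.
Variable W : set V.
Hypothesis subW : subspace W.

Lemma subspace0 : W 0. Proof. by case: subW. Qed.

Lemma subspaceZ (a : R) u : W u -> W (a *: u).
Proof. by move=> Wu; rewrite -[_ *: _]addr0; apply: subW.2 => //; exact: subspace0. Qed.

Lemma subspaceD u v : W u -> W v -> W (u + v).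
Proof. by move=> Wu Wv; rewrite -[u]scale1r; exact: subW.2. Qed.

Lemma subspaceB u v : W u -> W v -> W (u - v).
Proof. by move=> Wu Wv; rewrite -scaleN1r addrC; exact: subW.2. Qed.

Lemma subspace_sum (I : Type) (s : seq I) (P : pred I) (F : I -> V) :
  (forall i, P i -> W (F i)) -> W (\sum_(i <- s | P i) F i).
Proof. by move=> WF; elim/big_ind: _ => //; [exact: subspace0|exact: subspaceD]. Qed.

Variable l : V -> R.
Hypothesis ll : linear_on W l.

Lemma linear_on0 : l 0 = 0.
Proof.
have := ll 1 subspace0 subspace0; rewrite scale1r addr0 mul1r => h.
by have := subrr (l 0); rewrite {1}h addrK.
Qed.

Lemma linear_onZ a u : W u -> l (a *: u) = a * l u.
Proof. by move=> Wu; rewrite -[_ *: _]addr0 ll ?linear_on0 ?addr0//; exact: subspace0. Qed.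

Lemma linear_onD u v : W u -> W v -> l (u + v) = l u + l v.
Proof. by move=> Wu Wv; rewrite -{1}[u]scale1r ll// mul1r. Qed.

Lemma linear_onB u v : W u -> W v -> l (u - v) = l u - l v.
Proof. by move=> Wu Wv; rewrite -scaleN1r addrC ll// mulN1r addrC. Qed.

Lemma linear_on_sum (I : Type) (s : seq I) (P : pred I) (c : I -> R) (F : I -> V) :
  (forall i, P i -> W (F i)) ->
  l (\sum_(i <- s | P i) c i *: F i) = \sum_(i <- s | P i) c i * l (F i).
Proof.
move=> WF; elim: s => [|i s ih]; first by rewrite !big_nil linear_on0.
rewrite !big_cons; case: ifP => // Pi; rewrite ll ?ih//; first exact: WF.
by apply: subspace_sum => j Pj; apply: subspaceZ; exact: WF.
Qed.

End Subspace.

Section Duality.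
Variables (W : set V) (b : V -> V -> R).
Hypotheses (subW : subspace W) (ipb : inner_product_on W b).
Let nrm u := Num.sqrt (b u u).

Lemma ip_linear_r u : W u -> linear_on W (b u).
Proof.
case: ipb => bl bs _ _ Wu a v w Wv Ww.
by rewrite bs// ?(bl _ Wu)// 1?(bs v)// 1?(bs w)//; exact: subW.2.
Qed.

Lemma ip_normE u : W u -> nrm u ^+ 2 = b u u.
Proof. by case: ipb => _ _ b0 _ Wu; rewrite sqr_sqrtr// b0. Qed.

Lemma ip_norm_gt0 u : W u -> u != 0 -> 0 < nrm u.
Proof.
case: ipb => _ _ b0 bd Wu u0; rewrite lt_neqAle sqrtr_ge0 andbT eq_sym.
apply: contra u0 => /eqP nu; apply/eqP/bd => //.
by rewrite -ip_normE// nu expr0n.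
Qed.

Lemma ip_lin2 (s t : R) u v : W u -> W v ->
  b (s *: u + t *: v) (s *: u + t *: v) =
  s ^+ 2 * b u u + 2 * s * t * b u v + t ^+ 2 * b v v.
Proof.
case: ipb => bl bs _ _ Wu Wv.
have Wtv := subspaceZ subW t Wv; have Wx : W (s *: u + t *: v) by exact: subW.2.
rewrite bl// (linear_onZ subW (bl _ Wx))//.
rewrite !(ip_linear_r _)// !(linear_onZ subW (ip_linear_r _))// (bs v u)//; ring.
Qed.

Lemma ip_cauchy_schwarz u v : W u -> W v -> `|b u v| <= nrm u * nrm v.
Proof.
case: (ipb) => bl bs b0 bd Wu Wv.
have [->|u0] := eqVneq u 0.
  by rewrite (linear_on0 subW (bl _ Wv)) normr0 mulr_ge0 ?sqrtr_ge0.
have [->|v0] := eqVneq v 0.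
  by rewrite (linear_on0 subW (ip_linear_r Wu)) normr0 mulr_ge0 ?sqrtr_ge0.
have x0 := ip_norm_gt0 Wu u0; have y0 := ip_norm_gt0 Wv v0.
have W2 (t : R) : W (nrm v *: u + (t * nrm u) *: v).
  by apply: subW.2 => //; exact: subspaceZ.
(* For t = 1 and t = -1 the square of |v| u + t |u| v equals 2 |u| |v| (|u| |v| + t b(u, v)), which
   yields both signs of the bound. *)
have key (t : R) : t ^+ 2 = 1 -> 0 <= nrm u * nrm v + t * b u v.
  move=> t2; have := b0 _ (W2 t); rewrite ip_lin2// -!ip_normE// exprMn t2.
  have -> : nrm v ^+ 2 * nrm u ^+ 2 + 2 * nrm v * (t * nrm u) * b u v +
    1 * nrm u ^+ 2 * nrm v ^+ 2 =
    (2 * (nrm u * nrm v)) * (nrm u * nrm v + t * b u v) by ring.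
  by rewrite pmulr_rge0// !mulr_gt0.
by rewrite ler_norml; have := key 1; have := key (-1); rewrite sqrrN expr1n;
   move=> /(_ erefl) + /(_ erefl); lra.
Qed.

Lemma ip_riesz n (e : 'I_n -> V) l : (forall i, W (e i)) ->
    (forall c : 'I_n -> R, \sum_i c i *: e i = 0 -> forall i, c i = 0) ->
    (forall v, W v -> exists c : 'I_n -> R, v = \sum_i c i *: e i) ->
    linear_on W l -> exists2 w, W w & forall v, W v -> l v = b w v.
Proof.
case: (ipb) => bl bs b0 bd We free span ll.
pose G : 'M[R]_n := \matrix_(i, j) b (e i) (e j).
have Wsum (c : 'I_n -> R) : W (\sum_i c i *: e i).
  by apply: subspace_sum => // i _; exact: subspaceZ.
have GE (c : 'rV[R]_n) j : (c *m G) 0 j = b (\sum_i c 0 i *: e i) (e j).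
  rewrite !mxE (linear_on_sum subW (bl _ (We j)))//.
  by apply: eq_bigr => i _; rewrite mxE.
(* A row c with c G = 0 gives x = sum c_i e_i with b(x, x) = 0, so definiteness and then freeness
   force c = 0. *)
have fG : row_free G.
  rewrite -kermx_eq0; apply/eqP/row_matrixP => i.
  rewrite row0; set c := row i _.
  have cG : c *m G = 0 by rewrite -row_mul mulmx_ker row0.
  have /free c0 : \sum_i c 0 i *: e i = 0.
    apply: bd => //; rewrite (linear_on_sum subW (ip_linear_r _))//.
    have z j : (c *m G) 0 j = 0 by rewrite cG mxE.
    by rewrite big1// => j _; rewrite -GE z mulr0.
  by apply/rowP => j; rewrite c0 mxE.
have Gu : G \in unitmx by rewrite -row_free_unit.
pose lv : 'rV[R]_n := \row_j l (e j).
pose c := lv *m invmx G.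
exists (\sum_i c 0 i *: e i) => // v /span[s ->].
rewrite (linear_on_sum subW ll)// (linear_on_sum subW (ip_linear_r _))//.
by apply: eq_bigr => j _; rewrite -GE mulmxKV// mxE.
Qed.

Lemma ip_dual_bound n (e : 'I_n -> V) l : (forall i, W (e i)) ->
    (forall c : 'I_n -> R, \sum_i c i *: e i = 0 -> forall i, c i = 0) ->
    (forall v, W v -> exists c : 'I_n -> R, v = \sum_i c i *: e i) ->
    linear_on W l -> forall v, W v ->
    `|l v| <= sup [set l v / nrm v | v in W `\ 0] * nrm v.
Proof.
move=> We free span ll v Wv.
have [->|v0] := eqVneq v 0.
  case: (ipb) => bl _ _ _; rewrite (linear_on0 subW ll) normr0.
  by rewrite /nrm (linear_on0 subW (bl _ (subspace0 subW))) sqrtr0 mulr0.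
have [w Ww lE] := ip_riesz We free span ll.
(* Without this bound [sup] would return its default value; the norm of the Riesz representative
   bounds all quotients. *)
have lb : has_ubound [set l v / nrm v | v in W `\ 0].
  exists (nrm w) => _ [u [Wu /eqP u0] <-].
  rewrite ler_pdivrMr ?ip_norm_gt0// lE//.
  by rewrite (le_trans (ler_norm _))// ip_cauchy_schwarz.
have key u : W u -> u != 0 -> l u <= sup [set l v / nrm v | v in W `\ 0] * nrm u.
  move=> Wu u0; rewrite -ler_pdivrMr ?ip_norm_gt0//.
  by apply: ub_le_sup => //; exists u => //; split => //; exact/eqP.
rewrite ler_norml key// andbT lerNl.
have WNv : W (- v) by rewrite -scaleN1r; exact: subspaceZ.
have := key _ WNv; rewrite oppr_eq0 => /(_ v0).
rewrite -[- v]scaleN1r (linear_onZ subW ll)// mulN1r; congr (_ <= _ * Num.sqrt _).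
have := @ip_lin2 (-1) 0 v v Wv Wv; rewrite scale0r addr0 => ->; ring.
Qed.

Lemma ip_dual_ge0 n (e : 'I_n -> V) l : (forall i, W (e i)) ->
    (forall c : 'I_n -> R, \sum_i c i *: e i = 0 -> forall i, c i = 0) ->
    (forall v, W v -> exists c : 'I_n -> R, v = \sum_i c i *: e i) ->
    linear_on W l -> 0 <= sup [set l v / nrm v | v in W `\ 0].
Proof.
(* For W = {0} the set of quotients is empty and its [sup] is 0. *)
move=> We free span ll; have [/set0P[u [Wu /eqP u0]]|/negPn/eqP ->] :=
  boolP (W `\ 0 != set0); last by rewrite image_set0 sup0.
rewrite -(pmulr_lge0 _ (ip_norm_gt0 Wu u0)).
exact: le_trans (ip_dual_bound We free span ll Wu).
Qed.

End Duality.

End InnerProduct.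

(** * Energy estimate for the explicit two-step scheme *)

Section TimeStepping.
Context {R : realType} {V : lmodType R}.
Variables (W : set V) (L a : V -> V -> R) (k : R) (N : nat).
Variables (DL Da : (V -> R^o) -> R) (v : nat -> V) (r1 r2 : nat -> V -> R^o).
Let nL u := Num.sqrt (L u u).
Let na u := Num.sqrt (a u u).
Hypotheses (subW : subspace W) (ipL : inner_product_on W L)
  (ipa : inner_product_on W a) (k0 : 0 < k) (N0 : (0 < N)%N).
Hypothesis inverse : forall u, W u -> k ^+ 2 * a u u <= L u u.
Hypothesis dualL : forall l : V -> R^o, linear_on W l ->
  0 <= DL l /\ forall u, W u -> `|l u| <= DL l * nL u.
Hypothesis duala : forall l : V -> R^o, linear_on W l ->
  0 <= Da l /\ forall u, W u -> `|l u| <= Da l * na u.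
Hypotheses (Wv : forall n, (n <= N)%N -> W (v n))
  (lr1 : forall n, (n <= N)%N -> linear_on W (r1 n))
  (lr2 : forall n, (1 <= n < N)%N -> linear_on W (r2 n)).
Hypothesis scheme : forall n, (1 <= n < N)%N -> forall w, W w ->
  L (dtt k v n) w + a (v n) w = r1 n w + r2 n w.

Let p n : V := dt k v n.
Let Wp n : (n < N)%N -> W (p n).
Proof.
move=> nN; rewrite /p /dt; apply: subspaceZ => //.
by apply: subspaceB => //; apply: Wv => //; exact: ltnW.
Qed.

Let vE n : v n.+1 = v n + k *: p n.
Proof. by rewrite /p /dt scalerA divff ?gt_eqF// scale1r addrC subrK. Qed.

Definition energy n := L (p n) (p n) + a (v n.+1) (v n).

(** The scheme is tested with v^{n+1} - v^{n-1} = k (p^n + p^{n-1}): the mass term becomes (p^n -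
    p^{n-1}, p^n + p^{n-1})_L, a difference of squares, and by symmetry the other term is a(v^{n+1},
    v^n) - a(v^n, v^{n-1}). *)
Lemma energy_step n : (1 <= n < N)%N ->
  energy n - energy n.-1 =
  r1 n (v n.+1 - v n.-1) + r2 n (v n.+1 - v n.-1).
Proof.
case: n => // n /andP[_ nN] /=; rewrite /energy.
have [WS W0] : W (v n.+1) /\ W (v n) by split; apply: Wv; [exact: ltnW|exact/ltnW/ltnW].
have WSS : W (v n.+2) by exact: Wv.
rewrite -scheme ?nN//; last exact: subspaceB.
have -> : dtt k v n.+1 = k^-1 *: (p n.+1 - p n).
  rewrite /dtt /p /dt -scalerBr scalerA -invfM -expr2 /=; congr (_ *: _).
  by rewrite opprB scaler_nat mulr2n opprD !addrA addrAC.
have -> : v n.+2 - v n = k *: (p n.+1 + p n).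
  by rewrite vE vE scalerDr addrC !addrA addrAC addNr add0r addrC.
case: (ipa) => al as_ _ _; case: (ipL) => Ll Ls _ _.
have Wp1 : W (p n.+1) by exact: Wp.
have Wp0 : W (p n) by exact/Wp/ltnW.
have Wd : W (p n.+1 + p n) by apply: subspaceD.
have -> : a (v n.+1) (k *: (p n.+1 + p n)) = a (v n.+1) (v n.+2) - a (v n.+1) (v n).
  rewrite -(linear_onB (ip_linear_r subW ipa WS))//; congr (a _ _).
  by rewrite (vE n.+1) (vE n) scalerDr addrC [in RHS]addrC !addrA addNr add0r.
have Wb : W (p n.+1 - p n) by apply: subspaceB.
rewrite (linear_onZ subW (ip_linear_r subW ipL (subspaceZ subW _ Wb)))//.
rewrite (linear_onZ subW (Ll _ Wd))//.
rewrite (linear_onB (Ll _ Wd))// !(linear_onD (ip_linear_r subW ipL _))//.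
rewrite (as_ (v n.+2))// (Ls (p n.+1) (p n))// mulrA divff ?gt_eqF//; ring.
Qed.

Lemma energy_sum m : (m < N)%N ->
  energy m = energy 0 + \sum_(1 <= n < m.+1) r1 n (v n.+1 - v n.-1)
    + \sum_(1 <= n < m.+1) r2 n (v n.+1 - v n.-1).
Proof.
elim: m => [_|m ih mN]; first by rewrite !big_geq// !addr0.
rewrite !(big_nat_recr m.+1)//=; have := ih (ltnW mN).
have /= := @energy_step m.+1; rewrite mN => /(_ isT); lra.
Qed.

Let Q n := nL (p n) ^+ 2 + na (v n.+1) ^+ 2 + na (v n) ^+ 2.

Lemma energy_equiv n : (n < N)%N -> Q n <= 2 * energy n /\ energy n <= Q n.
Proof.
move=> nN; rewrite /Q /energy.
have W1 : W (v n.+1) by exact: Wv. have W0 : W (v n) by exact/Wv/ltnW.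
have Wpn := Wp nN.
rewrite /na /nL !(ip_normE ipa)// !(ip_normE ipL)//.
have eq2 := ip_lin2 subW ipa 1 (-1) W1 W0.
(* The expansion for the difference is the polarisation identity. The one for the sum supplies only
   |v^{n+1}|^2 + |v^n|^2 >= 0, needed for the upper bound. *)
have eq3 := ip_lin2 subW ipa 1 1 W1 W0.
have d : 1 *: v n.+1 + -1 *: v n = k *: p n.
  by rewrite scale1r scaleN1r vE addrC addKr.
rewrite d in eq2.
have kp : a (k *: p n) (k *: p n) = k ^+ 2 * a (p n) (p n).
  by rewrite -[_ *: _]addr0 -[X in _ + X](scale0r (p n)) (ip_lin2 subW ipa)//; ring.
have := inverse Wpn; rewrite -kp.
have : 0 <= a (1 *: v n.+1 + 1 *: v n) (1 *: v n.+1 + 1 *: v n).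
  by case: ipa => _ _ + _; apply; rewrite !scale1r; exact: subspaceD.
have : 0 <= a (k *: p n) (k *: p n).
  by case: ipa => _ _ + _; apply; exact: subspaceZ.
have : 0 <= L (p n) (p n) by case: ipL => _ _ + _; exact.
lra.
Qed.

Let dtE n w : dt k r1 n w = k^-1 * (r1 n.+1 w - r1 n w).
Proof. by []. Qed.

Let lin_dt n : (n < N)%N -> linear_on W (dt k r1 n).
Proof.
move=> nN c u w Wu Ww; rewrite !dtE (lr1 nN)// (lr1 (ltnW nN))//; ring.
Qed.

Let r1_dt n w : r1 n.+1 w = r1 n w + k * dt k r1 n w.
Proof.
rewrite dtE mulrA divff ?gt_eqF// mul1r.
by rewrite addrC subrK.
Qed.

Let Da_dt m := Da (r1 0%N) + \sum_(0 <= n < m) k * Da (dt k r1 n).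

(** The norm of the sequence contains r_1 itself only near the ends of the time interval; at time m
    it is recovered as r_1^0 plus its increments. *)
Lemma functional_bound m w : (m <= N)%N -> W w -> `|r1 m w| <= Da_dt m * na w.
Proof.
move=> mN Ww; elim: m mN => [_|m ih mN].
  by rewrite /Da_dt big_geq// addr0; apply: (duala (lr1 _)).2.
rewrite r1_dt /Da_dt big_nat_recr//= addrA mulrDl (le_trans (ler_normD _ _))//.
apply: lerD; first exact/ih/ltnW.
rewrite normrM gtr0_norm// -mulrA ler_pM2l//.
exact: (duala (lin_dt mN)).2.
Qed.

(** With s_n = v^{n+1} + v^n the argument is s_n - s_{n-1}, so the sum equals r_1^m(s_m) -
    r_1^0(s_0) minus the sum over n < m of k (dt r_1^n)(s_n). Each s_n has norm at most 2 M; the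
    boundary term at m and the rest contribute 2 M [Da_dt m] each. *)
Lemma partial_sum_r1 (M : R) m : (m < N)%N ->
  (forall n, (n <= N)%N -> na (v n) <= M) ->
  `|\sum_(1 <= n < m.+1) r1 n (v n.+1 - v n.-1)| <=
  4 * M * Da_dt m.
Proof.
move=> mN vM; have M0 : 0 <= M by exact: le_trans (sqrtr_ge0 _) (vM 0%N _).
have W1 n : (n < N)%N -> W (v n.+1) by exact: Wv.
have W0 n : (n < N)%N -> W (v n) by move=> nN; exact/Wv/ltnW.
have two n : (n < N)%N -> (forall (l : V -> R^o) (X : R), linear_on W l ->
    0 <= X -> (forall w, W w -> `|l w| <= X * na w) ->
    `|l (v n.+1 + v n)| <= 2 * M * X).
  move=> nN l X ll X0 lX; rewrite (linear_onD ll (W1 _ nN) (W0 _ nN)).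
  apply: le_trans (ler_normD _ _) _.
  have := lX _ (W1 _ nN); have := lX _ (W0 _ nN).
  have := vM _ nN; have := vM _ (ltnW nN); nra.
have Da0 j : (j <= N)%N -> 0 <= Da_dt j.
  move=> jN; apply: addr_ge0; first exact: (duala (lr1 (leq0n N))).1.
  rewrite big_nat; apply: sumr_ge0 => i /andP[_ iN].
  by rewrite mulr_ge0 ?(ltW k0)//; exact: (duala (lin_dt (leq_trans iN jN))).1.
(* summation by parts *)
have parts : `|\sum_(1 <= n < m.+1) r1 n (v n.+1 - v n.-1)
    - r1 m (v m.+1 + v m)| <= 2 * M * Da_dt m.
  elim: m mN => [_|m ih mN].
    rewrite big_geq// sub0r normrN; apply: two => //; first exact: lr1.
      exact: Da0.
    by move=> w Ww; exact: functional_bound.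
  have mN' := ltnW mN.
  have -> : Da_dt m.+1 = Da_dt m + k * Da (dt k r1 m).
    by rewrite /Da_dt big_nat_recr//= addrA.
  rewrite big_nat_recr//= mulrDr.
  have -> : \sum_(1 <= n < m.+1) r1 n (v n.+1 - v n.-1)
      + r1 m.+1 (v m.+2 - v m) - r1 m.+1 (v m.+2 + v m.+1) =
    (\sum_(1 <= n < m.+1) r1 n (v n.+1 - v n.-1) - r1 m (v m.+1 + v m))
    - k * dt k r1 m (v m.+1 + v m).
    have := r1_dt m (v m.+1 + v m); have lr := lr1 mN'.
    rewrite (linear_onB lr (W1 _ mN) (W0 _ mN')) (linear_onD lr (W1 _ mN) (W0 _ mN)).
    rewrite (linear_onD lr (W1 _ mN') (W0 _ mN')); lra.
  rewrite (le_trans (ler_normB _ _))// lerD ?ih//.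
  rewrite normrM gtr0_norm// mulrCA ler_pM2l//; apply: two => //.
  - exact: lin_dt.
  - exact: (duala (lin_dt _)).1.
  - exact: (duala (lin_dt _)).2.
have := two _ mN _ _ (lr1 (ltnW mN)) (Da0 _ (ltnW mN))
  (fun w => functional_bound (ltnW mN)).
move: parts; rewrite !ler_norml; lra.
Qed.

(** No summation by parts here: v^{n+1} - v^{n-1} = k (p^n + p^{n-1}) has L-norm at most 2 k M,
    which is the weight 2 k in the norm of r_2. *)
Lemma partial_sum_r2 (M : R) m : (m < N)%N ->
  (forall n, (n < N)%N -> nL (p n) <= M) ->
  `|\sum_(1 <= n < m.+1) r2 n (v n.+1 - v n.-1)| <= M * tnorm_lumped DL k N r2.
Proof.
move=> mN pM; have M0 : 0 <= M by exact: le_trans (sqrtr_ge0 _) (pM 0%N _).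
have D0 n : (1 <= n < N)%N -> 0 <= DL (r2 n) by move=> nN; exact: (dualL (lr2 nN)).1.
rewrite /tnorm_lumped mulr_sumr (@big_cat_nat _ _ _ m.+1 1 N)//=.
rewrite -[leLHS]addr0 lerD//; last first.
  rewrite big_nat; apply: sumr_ge0 => i /andP[mi iN].
  rewrite !mulr_ge0// ?(ltW k0)// D0// iN andbT.
  exact: leq_trans mi.
apply: (le_trans (ler_norm_sum _ _ _)).
apply: ler_sum_nat => -[//|n] /andP[_ nm] /=.
have nN : (n.+1 < N)%N by exact: leq_trans mN.
have -> : v n.+2 - v n = k *: (p n.+1 + p n).
  by rewrite vE vE scalerDr addrC !addrA addrAC addNr add0r addrC.
have nN1 : (0 < n.+1 < N)%N by [].
have lr := lr2 nN1; have [Wp1 Wp0] : W (p n.+1) /\ W (p n).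
  by split; apply: Wp => //; exact: ltnW.
rewrite (linear_onZ subW lr); last exact: subspaceD.
rewrite (linear_onD lr)// normrM gtr0_norm//.
have -> : M * (2 * k * DL (r2 n.+1)) = k * (2 * M * DL (r2 n.+1)) by ring.
rewrite ler_pM2l// (le_trans (ler_normD _ _))//.
have := (dualL lr).2 _ Wp1; have := (dualL lr).2 _ Wp0.
have := D0 _ nN1; have := pM _ nN; have := pM _ (ltnW nN); nra.
Qed.

Lemma stability m : (m < N)%N ->
  nL (p m) ^+ 2 + na (v m.+1) ^+ 2 + na (v m) ^+ 2 <=
  128 * (nL (p 0%N) ^+ 2 + na (v 1%N) ^+ 2 + na (v 0%N) ^+ 2
    + tnorm_nitsche Da k N r1 ^+ 2 + tnorm_lumped DL k N r2 ^+ 2).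
Proof.
move: m; set ta := tnorm_nitsche _ _ _ _; set tL := tnorm_lumped _ _ _ _.
pose Qm := \big[Num.max/0]_(n < N) Q n.
have QQm n : (n < N)%N -> Q n <= Qm by move=> nN; exact: (le_bigmax _ _ (Ordinal nN)).
have Qm0 : 0 <= Qm by apply: bigmax_ge_id.
pose q := Num.sqrt Qm; have q0 : 0 <= q := sqrtr_ge0 _.
have qE : q ^+ 2 = Qm by rewrite sqr_sqrtr.
have le_q (x : R) n : (n < N)%N -> 0 <= x -> x ^+ 2 <= Q n -> x <= q.
  by move=> nN x0 xQ; rewrite -(ler_pXn2r (ltn0Sn 1))// ?nnegrE// qE (le_trans xQ)// QQm.
have vq n : (n <= N)%N -> na (v n) <= q.
  case: n => [|n] nN.
    apply: (@le_q _ 0%N) => //; first exact: sqrtr_ge0.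
    by rewrite /Q lerDr addr_ge0 ?sqr_ge0.
  apply: (@le_q _ n) => //; first exact: sqrtr_ge0.
  by rewrite /Q; have := sqr_ge0 (nL (p n)); have := sqr_ge0 (na (v n)); lra.
have pq n : (n < N)%N -> nL (p n) <= q.
  move=> nN; apply: (@le_q _ n) => //; first exact: sqrtr_ge0.
  by rewrite /Q -addrA lerDl addr_ge0 ?sqr_ge0.
have Da0 n : (n <= N)%N -> 0 <= Da (r1 n) by move=> nN; exact: (duala (lr1 nN)).1.
have Dt0 n : (n < N)%N -> 0 <= k * Da (dt k r1 n).
  by move=> nN; rewrite mulr_ge0 ?(ltW k0)//; exact: (duala (lin_dt nN)).1.
have tam m : (m < N)%N -> Da_dt m <= ta.
  move=> mN; rewrite /Da_dt /ta /tnorm_nitsche (@big_cat_nat _ _ _ m 0 N)//=; last exact: ltnW.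
  have : 0 <= \sum_(m <= n < N) k * Da (dt k r1 n).
    by rewrite big_nat; apply: sumr_ge0 => i /andP[_ iN]; exact: Dt0.
  have := Da0 _ (leqnn N); have := Da0 _ (leq_pred N); have := Da0 _ N0; lra.
have tL0 : 0 <= tL.
  rewrite /tL /tnorm_lumped big_nat; apply: sumr_ge0 => i iN.
  by rewrite !mulr_ge0 ?(ltW k0)//; exact: (dualL (lr2 iN)).1.
have ta0 : 0 <= ta.
  by apply: le_trans (tam 0%N N0); rewrite /Da_dt big_geq// addr0 Da0.
have main m : (m < N)%N -> Q m <= 2 * Q 0%N + (8 * ta + 2 * tL) * q.
  move=> mN; have [h _] := energy_equiv mN; have [_ h0] := energy_equiv N0.
  have := partial_sum_r1 mN vq; have := partial_sum_r2 mN pq.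
  have := energy_sum mN; rewrite !ler_norml.
  have := ler_wpM2l q0 (tam _ mN); rewrite -/tL; nra.
have mainm : Qm <= 2 * Q 0%N + (8 * ta + 2 * tL) * q.
  apply: bigmax_le => [|i _]; last exact: main.
  have Q0 : 0 <= Q 0%N by rewrite !addr_ge0 ?sqr_ge0.
  have := mulr_ge0 ta0 q0; have := mulr_ge0 tL0 q0; lra.
move=> m mN; rewrite -/(Q m) -/(Q 0%N); apply: (le_trans (QQm _ mN)).
(* With b = 8 ta + 2 tL, the inequality q^2 <= 2 Q_0 + b q and 2 b q <= q^2 + b^2 give q^2 <= 4 Q_0
   + b^2, where b^2 <= 128 ta^2 + 8 tL^2. This is the origin of 128. *)
move: mainm; rewrite -qE.
have := sqr_ge0 (8 * ta - 2 * tL); have := sqr_ge0 (q - (8 * ta + 2 * tL)).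
have : 0 <= Q 0%N by rewrite !addr_ge0 ?sqr_ge0.
by have := sqr_ge0 ta; have := sqr_ge0 tL; have := sqr_ge0 q; rewrite !expr2; lra.
Qed.

End TimeStepping.

(** * Caratheodory measurability for Lebesgue and Hausdorff measure *)

Section OuterMeasures.
Context {R : realType} {n : nat}.
Implicit Types (A B U X : set 'rV[R]_n) (g : set (powersets 'rV[R]_n) -> \bar R).
Local Open Scope ereal_scope.

Lemma mu_ext_le_cover g A (F : (set 'rV[R]_n)^nat) :
  A `<=` \bigcup_k F k -> mu_ext g A <= \sum_(k <oo) g (F k).
Proof. by move=> AF; apply: ereal_inf_lbound; exists F. Qed.

Lemma le_mu_ext_cover g A (m : \bar R) :
  (forall F : (set 'rV[R]_n)^nat, A `<=` \bigcup_k F k -> m <= \sum_(k <oo) g (F k)) ->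
  m <= mu_ext g A.
Proof. by move=> h; apply: le_ereal_inf_tmp => _ [F [_ AF] <-]; exact: h. Qed.

(** A covering of X, cut with A and with B, covers both pieces, so superadditivity has to be checked
    only on a single covering set. *)
Lemma mu_ext_add g A B : (forall U, 0 <= g U) ->
  (forall U, g (U `&` A) + g (U `&` B) <= g U) ->
  forall X, mu_ext g (X `&` A) + mu_ext g (X `&` B) <= mu_ext g X.
Proof.
move=> g0 gAB X; apply: le_mu_ext_cover => F XF.
have cov C : X `&` C `<=` \bigcup_k (F k `&` C).
  by move=> x [/XF[k _ Fkx] Cx]; exists k.
apply: le_trans (leeD (mu_ext_le_cover g (cov A)) (mu_ext_le_cover g (cov B))) _.
by rewrite -nneseriesD//; apply: lee_nneseries => *; rewrite ?adde_ge0.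
Qed.

Lemma mu_ext_single g A : g set0 = 0 -> (forall U, 0 <= g U) -> mu_ext g A <= g A.
Proof.
move=> g00 g0; pose F : (set 'rV[R]_n)^nat := fun k => if k is 0%N then A else set0.
have AF : A `<=` \bigcup_k F k by move=> x Ax; exists 0%N.
apply: le_trans (mu_ext_le_cover g AF) _.
rewrite nneseries_recl//= eseries_cond eseries0 ?adde0// => -[|k]//.
Qed.

(* Caratheodory's criterion: for the rings [1/(j+3) < f <= 1/(j+2)], those of
   even index are mutually separated, and so are those of odd index, so that
   their measures are summable. *)
Lemma separated_caratheodory (mu : {outer_measure set 'rV[R]_n -> \bar R})
    (f : 'rV[R]_n -> R) :
  (forall A B (s t : R), (s < t)%R -> (forall x, A x -> f x <= s)%R ->
     (forall x, B x -> t < f x)%R -> mu A + mu B <= mu (A `|` B)) ->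
  mu.-caratheodory [set x | f x <= 0]%R.
Proof.
move=> sep; apply: le_caratheodory_measurable => X.
have [->|Xoo] := eqVneq (mu X) +oo; first by rewrite leey.
have mu0 C : 0 <= mu C by exact: outer_measure_ge0.
have Xfin : mu X \is a fin_num by rewrite ge0_fin_numE// ltey.
pose th (j : nat) : R := (j%:R)^-1%R.
have thlt j : (th j.+2 < th j.+1)%R by rewrite ltf_pV2 ?posrE// ltr_nat.
pose S j := X `&` [set x | th j.+3 < f x <= th j.+2]%R.
pose P j := X `&` [set x | th j < f x]%R.
(* Induction within one parity: the rings already summed lie where f exceeds [th (2 * m + e).+1],
   the next one where f is at most [th (2 * m + e).+2], so there is a gap between them. *)
have par e m : \sum_(j < m) mu (S (2 * j + e)%N) <= mu (P (2 * m + e).+1).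
  elim: m => [|m ih]; first by rewrite big_ord0.
  rewrite big_ord_recr/= addeC.
  apply: (le_trans (leeD2l _ ih)).
  have SP : mu (S (2 * m + e)%N) + mu (P (2 * m + e).+1) <=
      mu (S (2 * m + e)%N `|` P (2 * m + e).+1).
    by apply: (sep _ _ _ _ (thlt (2 * m + e)%N)) => x [_ /=] // /andP[].
  apply: le_trans SP _.
  rewrite mulnS !addSn add0n; apply: le_outer_measure => x [[Xx /= /andP[h _]]|[Xx /= h]].
    by split.
  by split => //=; rewrite (lt_trans _ h)// (lt_trans (thlt _))// thlt.
have parX e m : \sum_(j < m) mu (S (2 * j + e)%N) <= mu X.
  by apply: le_trans (par e m) _; apply: le_outer_measure => x [].
have tot m : \sum_(j < (2 * m)%N) mu (S j) =
    \sum_(j < m) mu (S (2 * j + 0)%N) + \sum_(j < m) mu (S (2 * j + 1)%N).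
  elim: m => [|m ih]; first by rewrite muln0 !big_ord0 adde0.
  by rewrite mulnS !addSn add0n !big_ord_recr/= ih addn0 addn1 addeACA addeA.
have sumS : \sum_(0 <= j <oo) mu (S j) < +oo.
  apply: (@le_lt_trans _ _ (mu X + mu X)); last by rewrite lte_add_pinfty// ltey.
  apply: lime_le; first exact: is_cvg_nneseries.
  apply: nearW => m; rewrite big_mkord.
  apply: (@le_trans _ _ (\sum_(j < (2 * m)%N) mu (S j))).
    rewrite -!(big_mkord xpredT (fun j => mu (S j))).
    rewrite [leRHS](@big_cat_nat _ _ _ m)//=; last by rewrite leq_pmull.
    by rewrite leeDl// sume_ge0.
  by rewrite tot leeD.
have cvg0 := nneseries_tail_cvg sumS (fun j _ => mu0 (S j)).
(* The part of X with f > 0 is split into [P m.+2], separated from the set f <= 0, and the rings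
   from m on, whose total measure tends to 0. *)
have bound m : mu (X `&` [set x | f x <= 0]%R) + mu (X `&` ~` [set x | f x <= 0]%R)
    <= mu X + \sum_(m <= j <oo) mu (S j).
  apply: (@le_trans _ _ (mu (X `&` [set x | f x <= 0]%R) +
      (mu (P m.+2) + mu (\bigcup_(j in ~` `I_m) S j)))).
    apply: leeD2l; apply: le_trans (outer_measureU2 _ _ _); apply: le_outer_measure.
    move=> x [Xx /= /negP]; rewrite -ltNge => fx0.
    have [h|h] := ltP (th m.+2) (f x); [by left|right].
    have ex : exists j, (th j.+3 < f x)%R.
      have [j hj] := ltr_add_invr fx0; exists j; rewrite add0r in hj.
      rewrite (le_lt_trans _ hj)// lef_pV2 ?posrE// ler_nat.
      by rewrite ltnW.
    case: (ex_minnP ex) => p hp minp; exists p => //=.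
      move=> pm; move: hp; rewrite ltNge => /negP; apply.
      apply: (le_trans h); rewrite lef_pV2 ?posrE// ler_nat; exact: pm.
    split => //=; rewrite hp/=.
    case: p hp minp => [|p] hp minp.
      by rewrite (le_trans h)// lef_pV2 ?posrE// ler_nat.
    by rewrite leNgt; apply/negP => /minp; rewrite ltnn.
  rewrite addeA leeD//; last exact: outer_measure_sigma_subadditive_tail.
  have m0 : (0 < th m.+2)%R by rewrite invr_gt0.
  apply: (@le_trans _ _ (mu (X `&` [set x | f x <= 0]%R `|` P m.+2))).
    by apply: (sep _ _ _ _ m0) => x [].
  by apply: le_outer_measure => x [|] [].
rewrite -[leRHS]adde0.
have cvgX : (mu X + \sum_(m <= j <oo) mu (S j)) @[m --> \oo] --> mu X + 0.
  by apply: cvgeD => //; [exact: fin_num_adde_defr|exact: cvg_cst].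
rewrite -(cvg_lim _ cvgX)//; apply: lime_ge; last exact: nearW.
by apply/cvg_ex; exists (mu X + 0).
Qed.

End OuterMeasures.

Section BoxVolume.
Context {R : realType} {n : nat}.
Implicit Types (A U : set 'rV[R]_n) (a b : 'rV[R]_n).

Definition in_box a b : set 'rV[R]_n := [set x | forall i, a 0 i <= x 0 i <= b 0 i].
Definition volume a b : R := \prod_(i < n) (b 0 i - a 0 i).

Lemma box_gauge_le_volume a b A : (forall i, a 0 i <= b 0 i) ->
  A `<=` in_box a b -> (box_gauge A <= (volume a b)%:E)%E.
Proof.
move=> ab Aab; rewrite /box_gauge; case: asboolP => _.
  by rewrite lee_fin prodr_ge0// => i _; rewrite subr_ge0.
by apply: ereal_inf_lbound; exists (a, b).
Qed.

Lemma lebesgue_outer_le_volume a b A : (forall i, a 0 i <= b 0 i) ->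
  A `<=` in_box a b -> (lebesgue_outer A <= (volume a b)%:E)%E.
Proof.
move=> ab Aab; apply: le_trans (box_gauge_le_volume ab Aab).
by apply: mu_ext_single; [exact: box_gauge0|exact: box_gauge_ge0].
Qed.

Definition set_coord a (i : 'I_n) (t : R) : 'rV[R]_n :=
  \row_j (if j == i then t else a 0 j).

Lemma volume_split a b i t :
  volume a b = volume a (set_coord b i t) + volume (set_coord a i t) b.
Proof.
have E c d : volume c d = (d 0 i - c 0 i) * \prod_(j | j != i) (d 0 j - c 0 j).
  by rewrite /volume (bigD1 i).
rewrite !E !mxE eqxx.
rewrite [X in _ = _ * X + _](eq_bigr (fun j => b 0 j - a 0 j)); last first.
  by move=> j /negPf ji; rewrite !mxE ji.
rewrite [X in _ = _ + _ * X](eq_bigr (fun j => b 0 j - a 0 j)); last first.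
  by move=> j /negPf ji; rewrite !mxE ji.
by rewrite -mulrDl; congr (_ * _); ring.
Qed.

(** A hyperplane orthogonal to an axis cuts a box into two boxes whose volumes add up. *)
Lemma lebesgue_halfspace (i : 'I_n) (t : R) :
  (@lebesgue_outer R n).-caratheodory [set x | x 0 i <= t].
Proof.
apply: le_caratheodory_measurable => X; apply: mu_ext_add => U.
  exact: box_gauge_ge0.
rewrite {3}/box_gauge; case: asboolP => [->|_]; first by rewrite !set0I !box_gauge0 adde0.
apply: le_ereal_inf_tmp => _ [[a b] /= [ab Uab] <-]; rewrite -/(volume a b).
(* If t lies outside the i-th side, one of the two boxes would have reversed bounds; that piece of U
   is empty and has gauge 0. *)
have [ta|at_] := ltP t (a 0 i).
  rewrite (_ : U `&` _ = set0); last first.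
    rewrite -subset0 => x [/Uab /(_ i)/andP[ax _] /= xt].
    by move: (lt_le_trans ta ax); rewrite ltNge xt.
  by rewrite box_gauge0 add0e box_gauge_le_volume// => x [/Uab].
have [bt|tb] := leP (b 0 i) t.
  rewrite (_ : U `&` ~` _ = set0); last first.
    rewrite -subset0 => x [/Uab /(_ i)/andP[_ xb] /=]; apply.
    exact: le_trans bt.
  by rewrite box_gauge0 adde0 box_gauge_le_volume// => x [/Uab].
rewrite (volume_split a b i t) EFinD; apply: leeD; apply: box_gauge_le_volume.
- by move=> j; rewrite mxE; case: eqP => [->|].
- move=> x [/Uab xab /= xt] j; rewrite mxE; case: eqP => [->|]//.
  by rewrite xt andbT; case/andP: (xab i).
- by move=> j; rewrite mxE; case: eqP => [->|]//; rewrite ltW.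
- move=> x [/Uab xab /= /negP]; rewrite -ltNge => tx j.
  rewrite mxE; case: eqP => [->|]//.
  by rewrite ltW//=; case/andP: (xab i).
Qed.

End BoxVolume.

(** * Euclidean norm, sup norm and diameters *)

Section EuclideanNorm.
Context {R : realType} {n : nat}.
Implicit Types (x y z : 'rV[R]_n) (A B : set 'rV[R]_n).

Lemma dotC x y : dot x y = dot y x.
Proof. by apply: eq_bigr => i _; rewrite mulrC. Qed.

Lemma dotDl x y z : dot (x + y) z = dot x z + dot y z.
Proof. by rewrite /dot -big_split/=; apply: eq_bigr => i _; rewrite mxE mulrDl. Qed.

Lemma dotZl (a : R) x y : dot (a *: x) y = a * dot x y.
Proof. by rewrite /dot mulr_sumr; apply: eq_bigr => i _; rewrite mxE mulrA. Qed.

Lemma dotZr (a : R) x y : dot x (a *: y) = a * dot x y.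
Proof. by rewrite dotC dotZl dotC. Qed.

Lemma dotDr x y z : dot x (y + z) = dot x y + dot x z.
Proof. by rewrite dotC dotDl !(dotC x). Qed.

Lemma dotNl x y : dot (- x) y = - dot x y.
Proof. by rewrite -scaleN1r dotZl mulN1r. Qed.

Lemma dotNr x y : dot x (- y) = - dot x y.
Proof. by rewrite dotC dotNl dotC. Qed.

Lemma dot0l x : dot 0 x = 0.
Proof. by rewrite -(scale0r (0 : 'rV[R]_n)) dotZl mul0r. Qed.

Lemma dot0r x : dot x 0 = 0. Proof. by rewrite dotC dot0l. Qed.

Lemma dot_ge0 x : 0 <= dot x x.
Proof. by apply: sumr_ge0 => i _; rewrite -expr2 sqr_ge0. Qed.

Lemma dot_eq0 x : dot x x = 0 -> x = 0.
Proof.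
move=> /eqP; rewrite psumr_eq0; last by move=> i _; rewrite -expr2 sqr_ge0.
move=> /allP h; apply/rowP => i; rewrite mxE; apply/eqP.
by have := h i (mem_index_enum i); rewrite mulf_eq0 orbb.
Qed.

Lemma enorm_ge0 x : 0 <= enorm x. Proof. exact: sqrtr_ge0. Qed.

Lemma sqr_enorm x : enorm x ^+ 2 = dot x x.
Proof. by rewrite sqr_sqrtr// dot_ge0. Qed.

Lemma enorm0 : enorm (0 : 'rV[R]_n) = 0.
Proof. by rewrite /enorm dot0l sqrtr0. Qed.

Lemma enormN x : enorm (- x) = enorm x.
Proof. by rewrite /enorm dotNl dotNr opprK. Qed.

Lemma enormB x y : enorm (x - y) = enorm (y - x).
Proof. by rewrite -enormN opprB. Qed.

Lemma enormZ (a : R) x : enorm (a *: x) = `|a| * enorm x.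
Proof. by rewrite /enorm dotZl dotZr mulrA -expr2 sqrtrM ?sqr_ge0// sqrtr_sqr. Qed.

Lemma enorm_eq0 x : enorm x = 0 -> x = 0.
Proof. by move=> x0; apply: dot_eq0; rewrite -sqr_enorm x0 expr0n. Qed.

Lemma dot_le_enorm x y : `|dot x y| <= enorm x * enorm y.
Proof.
apply: (@ip_cauchy_schwarz R 'rV[R]_n setT dot) => //.
split=> [w _ a u v _ _|u v _ _|u _|u _].
- by rewrite dotDl dotZl.
- exact: dotC.
- exact: dot_ge0.
- exact: dot_eq0.
Qed.

Lemma enorm_triangle x y : enorm (x + y) <= enorm x + enorm y.
Proof.
rewrite -(ler_pXn2r (ltn0Sn 1)) ?nnegrE ?addr_ge0 ?enorm_ge0//.
rewrite sqr_enorm sqrrD !sqr_enorm dotDl !dotDr (dotC y x).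
have := dot_le_enorm x y; rewrite ler_norml => /andP[_]; rewrite mulr2n; lra.
Qed.

Lemma coord_le_enorm x i : `|x 0 i| <= enorm x.
Proof.
rewrite -(ler_pXn2r (ltn0Sn 1)) ?nnegrE ?enorm_ge0// sqr_enorm real_normK ?num_real//.
rewrite /dot (bigD1 i)//= expr2 lerDl; apply: sumr_ge0 => j _.
by rewrite -expr2 sqr_ge0.
Qed.

Lemma norm_le_enorm x : `|x| <= enorm x.
Proof.
rewrite [`|x|]mx_normrE; apply/bigmax_leP; split=> [|[i j] _ /=].
  exact: enorm_ge0.
by rewrite ord1; exact: coord_le_enorm.
Qed.

Lemma coord_le_norm x i : `|x 0 i| <= `|x|.
Proof.
rewrite [leRHS]mx_normrE.
by apply: (@le_bigmax _ _ _ 0 (fun ij : 'I_1 * 'I_n => `|x ij.1 ij.2|) (0, i)).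
Qed.

Lemma enorm_le_norm x : enorm x <= Num.sqrt n%:R * `|x|.
Proof.
rewrite -(ler_pXn2r (ltn0Sn 1)) ?nnegrE ?mulr_ge0 ?enorm_ge0 ?sqrtr_ge0//.
rewrite sqr_enorm exprMn sqr_sqrtr ?ler0n// /dot.
rewrite (le_trans (ler_sum _ (G := fun=> `|x| ^+ 2) _))//.
  move=> i _; rewrite -expr2 -real_normK ?num_real//.
  by rewrite lerXn2r ?nnegrE// coord_le_norm.
by rewrite sumr_const card_ord mulr_natl.
Qed.

Lemma enorm_le_diam A x y : bounded_set A -> A x -> A y -> enorm (x - y) <= diam A.
Proof.
move=> bA Ax Ay; apply: ub_le_sup; last by exists (x, y).
have [M [Mr bM]] := bA; pose K := Num.max (M + 1) 0.
have AK z : A z -> `|z| <= M + 1 by apply: bM; rewrite ltrDl.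
exists (Num.sqrt n%:R * (M + 1 + (M + 1))) => _ [[u v] /= [Au Av] <-].
apply: le_trans (enorm_le_norm _) _; rewrite ler_wpM2l ?sqrtr_ge0//.
by apply: le_trans (ler_normB _ _) _; rewrite lerD// AK.
Qed.

Lemma diam_le (A : set 'rV[R]_n) (M : R) : 0 <= M ->
  (forall x y, A x -> A y -> enorm (x - y) <= M) -> diam A <= M.
Proof.
move=> M0 AM; have [->|/set0P[x Ax]] := eqVneq A set0.
  by rewrite /diam set0X image_set0 sup0.
apply: ge_sup; first by exists (enorm (x - x)), (x, x).
by move=> _ [[u v] /= [Au Av] <-]; exact: AM.
Qed.

End EuclideanNorm.

Section HausdorffHalfspace.
Context {R : realType} {n s : nat}.
Implicit Types (A B U : set 'rV[R]_n).

Lemma hausdorff_const_ge0 : 0 <= @hausdorff_const R s.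
Proof. by rewrite divr_ge0 ?exprn_ge0//; exact/fine_ge0/outer_measure_ge0. Qed.

Lemma le_hausdorff_gauge (delta : R) A B : A `<=` B ->
  (hausdorff_gauge s delta A <= hausdorff_gauge s delta B)%E.
Proof.
move=> AB; rewrite {1}/hausdorff_gauge; case: asboolP => [_|A0].
  exact: hausdorff_gauge_ge0.
have B0 : B <> set0 by move=> B0; apply: A0; rewrite -subset0 -B0.
rewrite /hausdorff_gauge (asboolF B0).
case: (asboolP (forall x y, B x -> B y -> enorm (x - y) <= delta)) => [Bd|_]; last exact: leey.
rewrite asboolT; last by move=> x y /AB Bx /AB By; exact: Bd.
rewrite lee_fin ler_wpM2l ?hausdorff_const_ge0// lerXn2r ?nnegrE ?diam_ge0//.
apply: diam_le => [|x y Ax Ay]; first exact: diam_ge0.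
apply: ub_le_sup; last by exists (x, y) => //; split; exact: AB.
by exists delta => _ [[u v] /= [Bu Bv] <-]; exact: Bd.
Qed.

Lemma hausdorff_gauge_antitone (d1 d2 : R) A : d1 <= d2 ->
  (hausdorff_gauge s d2 A <= hausdorff_gauge s d1 A)%E.
Proof.
move=> d12; rewrite /hausdorff_gauge; case: asboolP => // _.
case: (asboolP (forall x y, A x -> A y -> enorm (x - y) <= d1)) => [h|_]; last exact: leey.
by rewrite asboolT// => x y Ax Ay; exact: le_trans (h _ _ Ax Ay) d12.
Qed.

Lemma mu_ext_gauge_antitone (d1 d2 : R) A : d1 <= d2 ->
  (mu_ext (hausdorff_gauge s d2) A <= mu_ext (hausdorff_gauge s d1) A)%E.
Proof.
move=> d12; apply: le_mu_ext_cover => F AF.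
apply: (le_trans (mu_ext_le_cover _ AF)); apply: lee_nneseries => [i _ _|i _].
  exact: hausdorff_gauge_ge0.
exact: hausdorff_gauge_antitone.
Qed.

(** At scales delta <= r an admissible covering set cannot meet both A and B, so the gauge is
    superadditive on it. *)
Lemma hausdorff_separated A B (r : R) : 0 < r ->
  (forall x y, A x -> B y -> r < enorm (x - y)) ->
  (hausdorff_outer s A + hausdorff_outer s B <= hausdorff_outer s (A `|` B))%E.
Proof.
move=> r0 ABr; set M := hausdorff_outer s (A `|` B).
(* The two suprema over delta are taken independently; lowering both scales to a common e <= r only
   increases the measures. *)
have step d1 d2 : (0 < d1) -> (0 < d2) ->
    (mu_ext (hausdorff_gauge s d1) A + mu_ext (hausdorff_gauge s d2) B <= M)%E.
  move=> d10 d20; pose e := Num.min r (Num.min d1 d2).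
  have e0 : 0 < e by rewrite !lt_min r0 d10.
  have [er e1 e2] : [/\ e <= r, e <= d1 & e <= d2].
    by rewrite !ge_min !lexx !orbT.
  apply: (@le_trans _ _ (mu_ext (hausdorff_gauge s e) A + mu_ext (hausdorff_gauge s e) B)%E).
    by apply: leeD; exact: mu_ext_gauge_antitone.
  apply: (@le_trans _ _ (mu_ext (hausdorff_gauge s e) (A `|` B))); last first.
    by apply: ereal_sup_ubound; exists e.
  have := @mu_ext_add _ _ (hausdorff_gauge s e) A B _ _ (A `|` B).
  rewrite (setIidr (@subsetUl _ A B)) (setIidr (@subsetUr _ A B)); apply; first exact: hausdorff_gauge_ge0.
  move=> U; have [UA|/set0P[x [Ux Ax]]] := eqVneq (U `&` A) set0.
    by rewrite UA hausdorff_gauge0 add0e le_hausdorff_gauge// => z [].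
  have [UB|/set0P[y [Uy By]]] := eqVneq (U `&` B) set0.
    by rewrite UB hausdorff_gauge0 adde0 le_hausdorff_gauge// => z [].
  rewrite [leRHS]/hausdorff_gauge; case: asboolP => [U0|_]; first by rewrite U0 in Ux.
  case: asboolP => [/(_ x y Ux Uy)|_]; last exact: leey.
  by move/(lt_le_trans (ABr _ _ Ax By)); rewrite ltNge er.
have [->|Moo] := eqVneq M +oo%E; first by rewrite leey.
have Mfin : M \is a fin_num by rewrite ge0_fin_numE ?ltey// outer_measure_ge0.
have Bfin d : 0 < d -> mu_ext (hausdorff_gauge s d) B \is a fin_num.
  move=> d0; rewrite ge0_fin_numE; last exact: mu_ext_ge0 (hausdorff_gauge_ge0 _ _) _.
  apply: le_lt_trans (_ : M < +oo)%E; last by rewrite ltey.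
  apply: le_trans (step 1 d ltr01 d0); rewrite leeDr//.
  exact: mu_ext_ge0 (hausdorff_gauge_ge0 _ _) _.
have stepA d : 0 < d -> (hausdorff_outer s A + mu_ext (hausdorff_gauge s d) B <= M)%E.
  move=> d0; rewrite -leeBrDr ?Bfin//; apply: ge_ereal_sup => _ [d1 d10 <-].
  by rewrite leeBrDr ?Bfin//; exact: step.
have Afin : hausdorff_outer s A \is a fin_num.
  rewrite ge0_fin_numE ?outer_measure_ge0//.
  apply: le_lt_trans (_ : M < +oo)%E; last by rewrite ltey.
  apply: le_trans (stepA 1 ltr01); rewrite leeDl//.
  exact: mu_ext_ge0 (hausdorff_gauge_ge0 _ _) _.
rewrite addeC -leeBrDr//; apply: ge_ereal_sup => _ [d d0 <-].
by rewrite leeBrDr// addeC; exact: stepA.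
Qed.

(** Points with x_i - t at most p and points with x_i - t above q > p are more than (q - p)/2 apart,
    so the criterion applies to the function x_i - t. *)
Lemma hausdorff_halfspace (i : 'I_n) (t : R) :
  (@hausdorff_outer R n s).-caratheodory [set x | x 0 i <= t].
Proof.
have E : [set x : 'rV[R]_n | x 0 i - t <= 0] = [set x | x 0 i <= t].
  by apply/seteqP; split => x /=; rewrite subr_le0.
apply: (@eq_ind _ _ (fun C => (@hausdorff_outer R n s).-caratheodory C) _ _ E).
apply: separated_caratheodory => A B p q pq Ap Bq.
apply: (@hausdorff_separated _ _ ((q - p) / 2)); first by rewrite divr_gt0// subr_gt0.
move=> x y /Ap xp /Bq yq; rewrite enormB.
apply: lt_le_trans (coord_le_enorm _ i).
apply: lt_le_trans (ler_norm _); rewrite !mxE; lra.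
Qed.

End HausdorffHalfspace.

(** * From half-spaces to open sets and continuous functions *)

Section BorelCaratheodory.
Context {R : realType} {n : nat}.
Variable mu : {outer_measure set 'rV[R]_n -> \bar R}.
Hypothesis halfspace : forall (i : 'I_n) t, mu.-caratheodory [set x | x 0 i <= t].
Local Notation T := (caratheodory_type mu).

Lemma open_caratheodory (U : set 'rV[R]_n) : open U -> measurable (U : set T).
Proof.
move=> oU.
pose r (m : nat) : R := m.+1%:R^-1; have r0 m : 0 < r m by rewrite invr_gt0.
pose B (c : 'rV[rat]_n * nat) : set 'rV[R]_n :=
  [set x | forall i, ratr (c.1 0 i) - r c.2 < x 0 i < ratr (c.1 0 i) + r c.2].
have mlt (i : 'I_n) t : measurable ([set x : 'rV[R]_n | x 0 i < t] : set T).
  have -> : [set x : 'rV[R]_n | x 0 i < t] = \bigcup_m [set x | x 0 i <= t - r m].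
    apply/seteqP; split => x /=.
      by move=> /ltr_add_invr[m xm]; exists m => //=; rewrite lerBrDr ltW.
    by move=> [m _ /= xm]; rewrite (le_lt_trans xm)// ltrBlDr ltrDl.
  by apply: bigcupT_measurable => m; exact: halfspace.
have mB c : measurable (B c : set T).
  have -> : B c = \bigcap_(i in [set: 'I_n])
      (~` [set x | x 0 i <= ratr (c.1 0 i) - r c.2] `&`
       [set x | x 0 i < ratr (c.1 0 i) + r c.2]).
    apply/seteqP; split => x /= h i; first by case/andP: (h i) => h1 h2; split => //=; apply/negP; rewrite -ltNge.
    by have [/negP + h2] := h i Logic.I; rewrite -ltNge => ->.
  apply: (@fin_bigcap_measurable _ T); first exact: finite_finset.
  move=> i _; apply: measurableI; last exact: mlt.
  by apply: measurableC; exact: halfspace.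
pose F c := if pselect (B c `<=` U) then B c else set0.
have -> : U = \bigcup_c F c.
  apply/seteqP; split => [x Ux|x [c _]]; last by rewrite /F; case: pselect => // BU; exact: BU.
  have /nbhs_ballP[e /= e0 xeU] : nbhs x U by exact: open_nbhs_nbhs.
  (* Half of e, since the box has half-width [r m] about a rational point that may itself be [r m]
     away from x. *)
  have [m] := ltr_add_invr (divr_gt0 e0 (ltr0Sn R 1)); rewrite add0r -/(r m) => me.
  have /choice[q qx] : forall i, exists q : rat, x 0 i - r m < ratr q < x 0 i + r m.
    move=> i; have : x 0 i - r m < x 0 i + r m by rewrite ltrBlDr -addrA ltrDl addr_gt0.
    by move=> /rat_in_itvoo[q]; rewrite in_itv/=; exists q.
  have FB c : B c `<=` U -> F c = B c by rewrite /F; case: pselect.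
  exists (\row_i q i, m) => //; rewrite FB.
    by move=> i /=; rewrite mxE; have := qx i; lra.
  move=> y yB; apply: xeU; split=> // i j; rewrite ord1 /ball /=.
  have := yB j; have := qx j; rewrite /= mxE ltr_norml; lra.
apply: countable_bigcupT_measurable; first exact: countableP.
by move=> c; rewrite /F; case: pselect => //= _; exact: measurable0.
Qed.

Lemma closed_caratheodory (C : set 'rV[R]_n) : closed C -> measurable (C : set T).
Proof.
by move=> cC; rewrite -(setCK C); apply: measurableC; apply: open_caratheodory; exact: closed_openC.
Qed.

Lemma continuous_within_caratheodory (D : set 'rV[R]_n) (f : 'rV[R]_n -> R) :
  measurable (D : set T) -> {within D, continuous f} ->
  measurable_fun (D : set T) (f : T -> R).
Proof.
move=> mD /continuousP cf; apply: (measurability _ (measurable_realfun.RGenOpens.measurableE R)).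
move=> _ [_ [a [b ->] <-]].
have /open_subspaceP[V oV VD] := cf _ (@interval_open _ (BRight a) (BLeft b) isT isT).
have -> : D `&` f @^-1` `]a, b[ = V `&` D by rewrite VD setIC.
by apply: measurableI => //; exact: open_caratheodory.
Qed.

Lemma continuous_caratheodory (D : set 'rV[R]_n) (f : 'rV[R]_n -> R) :
  measurable (D : set T) -> continuous f -> measurable_fun (D : set T) (f : T -> R).
Proof.
by move=> mD cf; apply: continuous_within_caratheodory => //; exact: continuous_subspaceT.
Qed.

End BorelCaratheodory.

(** * Volumes of boxes and Hausdorff measure of graphs *)

Section GridCounting.
Context {R : realType}.

(** Used twice: with t = 1/M when grid points of a box are counted, and with small t when a closed
    box is widened to an open one. *)
Lemma prod_add_le (I : Type) (s : seq I) (l : I -> R) : (forall i, 0 <= l i) ->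
  exists2 K, 0 <= K & forall t, 0 <= t <= 1 ->
    \prod_(i <- s) (l i + t) <= \prod_(i <- s) l i + t * K.
Proof.
move=> l0; elim: s => [|i s [K K0 ih]].
  by exists 0 => // t _; rewrite !big_nil mulr0 addr0.
have P0 : 0 <= \prod_(i <- s) l i by rewrite prodr_ge0.
exists (\prod_(i <- s) l i + (l i + 1) * K) => [|t /andP[t0 t1]].
  by rewrite addr_ge0// mulr_ge0// addr_ge0.
rewrite !big_cons; have := ih t; rewrite t0 t1 => /(_ isT) h.
have lt0 : 0 <= l i + t by rewrite addr_ge0.
apply: le_trans (ler_wpM2l lt0 h) _.
have := mulr_ge0 t0 K0; have := l0 i; nra.
Qed.

Lemma count_nat_itv (x y : R) (M : nat) : x <= y ->
  \sum_(j < M) ((x <= j%:R <= y)%R%:R : R) <= y - x + 1.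
Proof.
move=> xy; set c := fun M => \sum_(j < M) ((x <= j%:R <= y)%R%:R : R).
(* The bound M - x strengthens the induction: if M itself is counted, then M <= y and the new count
   is at most M - x + 1 <= y - x + 1. *)
rewrite -/(c M); suff : c M = 0 \/ c M <= M%:R - x /\ c M <= y - x + 1.
  by case=> [->|[]//]; rewrite addr_ge0// subr_ge0.
elim: M => [|M ih]; first by left; rewrite /c big_ord0.
have -> : c M.+1 = c M + (x <= M%:R <= y)%R%:R by rewrite /c big_ord_recr.
rewrite -natr1; case: (boolP (x <= M%:R <= y)%R) => [/andP[xM My]|_] /=.
  by right; case: ih => [->|[]]; rewrite ?mulr1n; split; lra.
by rewrite addr0; case: ih => [->|[]]; [left|right; split; lra].
Qed.

Context {n : nat}.
Variables (a b : 'rV[R]_n).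
Hypothesis ab : forall i, a 0 i < b 0 i.

Definition grid_point (M : nat) (j : {ffun 'I_n -> 'I_M}) : 'rV[R]_n :=
  \row_i (a 0 i + (b 0 i - a 0 i) * (j i)%:R / M%:R).

Definition grid_count (M : nat) (O : set 'rV[R]_n) : R :=
  \sum_(j : {ffun 'I_n -> 'I_M}) (`[< O (grid_point j) >])%:R.

Let vol_gt0 : 0 < volume a b.
Proof. by apply: prodr_gt0 => i _; rewrite subr_gt0. Qed.

Lemma grid_count_box (p q : 'rV[R]_n) (O : set 'rV[R]_n) :
  (forall i, p 0 i <= q 0 i) -> O `<=` in_box p q ->
  exists2 K, 0 <= K & forall M : nat, (0 < M)%N ->
    grid_count M O <= M%:R ^+ n * (volume p q / volume a b + M%:R^-1 * K).
Proof.
move=> pq Opq; pose l i := (q 0 i - p 0 i) / (b 0 i - a 0 i).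
have ba i : 0 < b 0 i - a 0 i by rewrite subr_gt0.
have l0 i : 0 <= l i by rewrite divr_ge0 ?subr_ge0// ltW.
have [K K0 hK] := prod_add_le (index_enum 'I_n) l0.
exists K => // M M0; have MR : 0 < M%:R :> R by rewrite ltr0n.
have Mi : 0 <= (M%:R : R)^-1 <= 1 by rewrite invr_ge0 ltW//= invf_le1// ler1n.
have -> : volume p q / volume a b = \prod_i l i.
  by rewrite /volume -prodfV -big_split.
apply: le_trans (_ : \prod_(i < n) (M%:R * (l i + M%:R^-1)) <= _); last first.
  rewrite big_split/= prodr_const card_ord ler_wpM2l ?exprn_ge0//.
  exact: hK.
apply: le_trans (_ : \prod_(i < n) \sum_(j < M) ((p 0 i <= a 0 i + (b 0 i - a 0 i) * j%:R / M%:R <= q 0 i)%R%:R : R)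
  <= _).
  rewrite bigA_distr_bigA/=; apply: ler_sum => j _.
  case: asboolP => [/Opq h|_]; last by rewrite prodr_ge0.
  rewrite big1 ?lexx// => i _.
  by have := h i; rewrite mxE => ->.
apply: ler_prod => i _; rewrite sumr_ge0//=.
pose x := (p 0 i - a 0 i) / (b 0 i - a 0 i) * M%:R.
pose y := (q 0 i - a 0 i) / (b 0 i - a 0 i) * M%:R.
have xy : x <= y.
  by rewrite ler_pM2r// ler_pM2r ?invr_gt0// lerB.
apply: le_trans (_ : y - x + 1 <= _); last first.
  rewrite mulrDr mulfV ?gt_eqF// lerD2r le_eqVlt; apply/orP; left; apply/eqP.
  by rewrite /x /y /l -mulrBl -mulrBl mulrC; congr (_ * (_ / _)); ring.
apply: le_trans (count_nat_itv M xy); rewrite le_eqVlt; apply/orP; left; apply/eqP.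
apply: eq_bigr => j _; congr (_%:R); congr nat_of_bool; congr (_ && _).
  rewrite /x -ler_pdivlMr// ler_pdivrMr// -lerBlDl.
  by congr (_ <= _); ring.
rewrite /y -ler_pdivrMr// ler_pdivlMr// -lerBrDl.
by congr (_ <= _); ring.
Qed.

Lemma in_box_compact : compact (in_box a b).
Proof.
have -> : in_box a b = [set v : 'rV[R]_n | forall i, `[a 0 i, b 0 i]%classic (v ord0 i)].
  by apply/seteqP; split => v h i; have := h i; rewrite /= in_itv.
by apply: (@rV_compact _ _ (fun i => `[a 0 i, b 0 i]%classic)) => i; exact: segment_compact.
Qed.

Lemma grid_point_in_box M j : in_box a b (@grid_point M j).
Proof.
move=> i; rewrite mxE; have Mi := ltn_ord (j i).
have M0 : 0 < M%:R :> R by rewrite ltr0n (leq_ltn_trans _ Mi).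
have ba : 0 < b 0 i - a 0 i by rewrite subr_gt0.
rewrite lerDl divr_ge0 ?mulr_ge0 ?ler0n ?(ltW ba) ?(ltW M0)//=.
rewrite addrC -lerBrDr -mulrA ger_pMr// ler_pdivrMr// mul1r ler_nat; exact: ltnW.
Qed.

(** Subadditivity by counting: each of the M^n grid points lies in some [O k], and a box holds at
    most a fraction of them equal to its relative volume plus O(1/M); then M grows. *)
Lemma volume_le_finite_cover m (O : 'I_m -> set 'rV[R]_n) (w : 'I_m -> R) :
  in_box a b `<=` \bigcup_(k in setT) O k ->
  (forall k, 0 <= w k) ->
  (forall k, O k = set0 \/ exists p q : 'rV[R]_n, [/\ forall i, p 0 i <= q 0 i,
    O k `<=` in_box p q & volume p q <= w k]) ->
  volume a b <= \sum_k w k.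
Proof.
move=> cov w0 Ow.
have /choice[K hK] : forall k, exists K, 0 <= K /\ forall M : nat, (0 < M)%N ->
    grid_count M (O k) <= M%:R ^+ n * (w k / volume a b + M%:R^-1 * K).
  move=> k; case: (Ow k) => [->|[p [q [pq Opq wk]]]].
    exists 0; split => // M M0; rewrite /grid_count big1 => [|j _].
      by rewrite mulr_ge0 ?exprn_ge0// mulr0 addr0 divr_ge0// ltW.
    by case: asboolP.
  have [K K0 h] := grid_count_box pq Opq; exists K; split => // M M0.
  apply: le_trans (h M M0) _; rewrite ler_wpM2l ?exprn_ge0// lerD2r.
  by rewrite ler_pM2r ?invr_gt0.
have key (M : nat) : (0 < M)%N ->
    1 <= (\sum_k w k) / volume a b + M%:R^-1 * \sum_k K k.
  move=> M0; have MR : 0 < M%:R :> R by rewrite ltr0n.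
  rewrite -(@ler_pM2l _ (M%:R ^+ n)) ?exprn_gt0// mulr1.
  rewrite mulr_suml mulr_sumr -big_split/= mulr_sumr.
  apply: le_trans (ler_sum _ (fun k _ => (hK k).2 M M0)).
  rewrite /grid_count exchange_big/=.
  have -> : M%:R ^+ n = \sum_(j : {ffun 'I_n -> 'I_M}) (1 : R).
    by rewrite sumr_const card_ffun !card_ord natrX.
  apply: ler_sum => j _; have [k _ Okj] := cov _ (grid_point_in_box j).
  by rewrite (bigD1 k)//= asboolT// lerDl sumr_ge0.
rewrite -(@ler_pM2r _ (volume a b)^-1) ?invr_gt0// mulfV ?gt_eqF//.
apply/ler_addgt0Pr => e e0; have sK : 0 <= \sum_k K k.
  by apply: sumr_ge0 => k _; case: (hK k).
have [M] := ltr_add_invr (divr_gt0 e0 (ltr_pwDr ltr01 sK)).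
rewrite add0r => Me; apply: (le_trans (key M.+1 isT)); rewrite lerD2l.
have h : M.+1%:R^-1 * (\sum_k K k + 1) <= e.
  by rewrite -ler_pdivlMr ?ltW// ltr_pwDr.
by apply: le_trans h; rewrite ler_wpM2l// lerDl.
Qed.

Lemma open_box (p q : 'rV[R]_n) : open [set x : 'rV[R]_n | forall i, p 0 i < x 0 i < q 0 i].
Proof.
rewrite openE => x /= h.
suff : nbhs x [set y : 'rV[R]_n | forall i, p 0 i < y 0 i < q 0 i] by [].
apply: (@filter_forall _ _ (fun i => [set y : 'rV[R]_n | p 0 i < y 0 i < q 0 i]) (nbhs x) (nbhs_filter x)) => i.
have := @coord_continuous R 1 n 0 i x `]p 0 i, q 0 i[%classic; apply.
by apply: open_nbhs_nbhs; split; [exact: interval_open|rewrite /= in_itv/= h].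
Qed.

(** The covering sets are enlarged to open boxes at a total cost e, and compactness of the box
    reduces the countable covering to a finite one. *)
Lemma volume_le_lebesgue_outer : ((volume a b)%:E <= lebesgue_outer (in_box a b))%E.
Proof.
apply: le_mu_ext_cover => F cov.
have [->|Soo] := eqVneq (\sum_(k <oo) box_gauge (F k))%E +oo%E; first by rewrite leey.
have g0 k : (0 <= box_gauge (F k))%E by exact: box_gauge_ge0.
have gfin k : box_gauge (F k) \is a fin_num.
  rewrite ge0_fin_numE//; apply: (@le_lt_trans _ _ (\sum_(k <oo) box_gauge (F k)))%E; last by rewrite ltey.
  by rewrite (@nneseriesD1 _ _ k)// leeDl// nneseries_ge0.
apply/lee_addgt0Pr => e e0.
pose ek (k : nat) : R := e / (2 ^ k.+1)%:R.
have ek0 k : 0 < ek k by rewrite divr_gt0// ltr0n expn_gt0.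
have /choice[Ow hOw] : forall k, exists Ow : set 'rV[R]_n * R,
    [/\ open Ow.1, F k `<=` Ow.1, 0 <= Ow.2, Ow.2 <= fine (box_gauge (F k)) + ek k &
    Ow.1 = set0 \/ exists p q : 'rV[R]_n, [/\ forall i, p 0 i <= q 0 i,
    Ow.1 `<=` in_box p q & volume p q <= Ow.2]].
  move=> k; have [F0|F0] := pselect (F k = set0).
    exists (set0, 0); rewrite F0 box_gauge0 /= add0r; split => //=.
    - exact: ltW.
    - by left.
  have gE : box_gauge (F k) = ereal_inf [set (\prod_(i < n) (p.2 0%R i - p.1 0%R i))%:E
            | p in [set p : 'rV[R]_n * 'rV[R]_n |
                     (forall i, p.1 0 i <= p.2 0 i)%R /\
                     (forall x : 'rV[R]_n, F k x ->
                       forall i, p.1 0 i <= x 0 i <= p.2 0 i)%R]] by rewrite /box_gauge asboolF.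
  have e2 : 0 < ek k / 2 by rewrite divr_gt0.
  have := gfin k; rewrite gE => /(lb_ereal_inf_adherent e2)[_ [[p q] /= [pq Fpq] <-]].
  rewrite -gE -[box_gauge _]fineK// -EFinD lte_fin => hv.
  have l0 i : 0 <= q 0 i - p 0 i by rewrite subr_ge0.
  have [K K0 hK] := prod_add_le (index_enum 'I_n) l0.
  (* Half of [ek k] has paid for a nearly minimal box; this t keeps the cost of widening every side
     by t within the other half. *)
  pose t := Num.min 1 (ek k / 2 / (K + 1)).
  have K1 : 0 < K + 1 by rewrite ltr_wpDl.
  have t0 : 0 < t by rewrite lt_min ltr01 divr_gt0.
  have t1 : 0 <= t <= 1 by rewrite ltW//= ge_min lexx.
  have tK : t * K <= ek k / 2.
    have : t <= ek k / 2 / (K + 1) by rewrite ge_min lexx orbT.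
    rewrite ler_pdivlMr// => h; apply: le_trans h.
    by rewrite ler_pM2l// lerDl.
  pose p' : 'rV[R]_n := \row_i (p 0 i - t / 2); pose q' : 'rV[R]_n := \row_i (q 0 i + t / 2).
  have t2 : 0 < t / 2 by rewrite divr_gt0.
  have pq' i : p' 0 i <= q' 0 i by rewrite !mxE; have := pq i; lra.
  have vE : volume p' q' = \prod_i (q 0 i - p 0 i + t).
    by apply: eq_bigr => i _; rewrite !mxE; field.
  exists ([set x : 'rV[R]_n | forall i, p' 0 i < x 0 i < q' 0 i], volume p' q'); split => /=.
  - exact: open_box.
  - by move=> x /Fpq h i; rewrite !mxE; have := h i; lra.
  - by rewrite prodr_ge0// => i _; rewrite subr_ge0.
  - by rewrite vE; apply: le_trans (hK _ t1) _; lra.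
  - right; exists p', q'; split => // x h i.
    by have /andP[/ltW -> /ltW ->] := h i.
have := in_box_compact; rewrite compact_cover.
move=> /(_ nat setT (fun k => (Ow k).1)) [k _| |D _ hD].
- by case: (hOw k).
- move=> x /cov[k _ Fkx]; exists k => //.
  by case: (hOw k) => _ + _ _ _; exact.
pose m := (\max_(i <- finmap.enum_fset D) i).+1.
have hm : in_box a b `<=` \bigcup_(k in [set: 'I_m]) (Ow k).1.
  move=> x /hD[k /= kD Ox].
  have km : (k < m)%N by by rewrite ltnS (big_rem k)//= leq_maxl.
  by exists (Ordinal km).
have := volume_le_finite_cover hm (fun k => let: And5 _ _ h _ _ := hOw k in h)
  (fun k => let: And5 _ _ _ _ h := hOw k in h).
rewrite -lee_fin => /le_trans; apply.
apply: le_trans (epsilon_trick _ _ (ltW e0)); last by move=> k; exact: g0.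
apply: (@le_trans _ _ (\sum_(0 <= k < m) (box_gauge (F k) + (ek k)%:E))%E).
  rewrite big_mkord -sumEFin; apply: lee_sum => k _.
  by case: (hOw k) => _ _ _ h _; rewrite -[box_gauge _]fineK// -EFinD lee_fin.
by apply: nneseries_lim_ge => k _; rewrite adde_ge0// lee_fin ltW.
Qed.

End GridCounting.

Section FiniteCover.
Context {R : realType} {n : nat}.

Lemma mu_ext_le_finite_cover (g : set (powersets 'rV[R]_n) -> \bar R)
    (J : finType) (F : J -> set 'rV[R]_n) (A : set 'rV[R]_n) :
  g set0 = 0%E -> (forall U, 0 <= g U)%E -> A `<=` \bigcup_j F j ->
  (mu_ext g A <= \sum_j g (F j))%E.
Proof.
move=> g00 g0 AF; pose G : (set 'rV[R]_n)^nat := fun k => nth set0 [seq F j | j <- enum J] k.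
have AG : A `<=` \bigcup_k G k.
  move=> x /AF[j _ Fjx]; exists (index j (enum J)) => //; rewrite /G.
  by rewrite (nth_map j) ?index_mem ?mem_enum// nth_index// mem_enum.
apply: le_trans (mu_ext_le_cover g AG) _.
rewrite (@nneseries_split _ _ 0 #|J|)//= add0n eseries0 ?adde0; last first.
  by move=> k Jk _; rewrite /G nth_default// size_map -cardE.
rewrite -[leRHS]big_enum -(big_map F xpredT g) (big_nth set0) size_map.
by rewrite cardE.
Qed.

End FiniteCover.

(** * Hausdorff measure of Lipschitz graphs and of projections *)

Section HausdorffGraph.
Context {R : realType} {n : nat}.
Implicit Types (S U : set 'rV[R]_n) (i : 'I_n).
Local Notation s := n.-1.

Lemma unit_subdivision (M : nat) (x : R) : (0 < M)%N -> 0 <= x <= M%:R ->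
  exists j : 'I_M, j%:R <= x <= j.+1%:R.
Proof.
case: M => // M _; elim: M => [|M ih] /andP[x0 xM].
  by exists ord0; rewrite x0.
have [h|h] := leP x M.+1%:R; last by exists ord_max; rewrite (ltW h).
by have [|j hj] := ih; [rewrite x0|exists (widen_ord (leqnSn _) j)].
Qed.

(** The projection lies in a cube of side 2 rho. Cutting it into M^s cells cuts S into pieces of
    diameter at most 2 L rho / M, and M^s (2 L rho / M)^s does not depend on M. *)
Lemma hausdorff_graph_le i S (L rho : R) : 0 <= L -> 0 < rho ->
  (forall y z, S y -> S z -> enorm (y - z) <= L * `|col' i y - col' i z|) ->
  (forall y z, S y -> S z -> `|col' i y - col' i z| <= rho) ->
  (hausdorff_outer s S <= (@hausdorff_const R s * (2 * L * rho) ^+ s)%:E)%E.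
Proof.
move=> L0 r0 SL Sr; have [->|/set0P[y0 Sy0]] := eqVneq S set0.
  rewrite outer_measure0 lee_fin mulr_ge0 ?hausdorff_const_ge0// exprn_ge0//.
  by rewrite !mulr_ge0// ltW.
apply: ge_ereal_sup => _ [delta /= d0 <-].
have LR0 : 0 <= 2 * L * rho by rewrite !mulr_ge0// ltW.
(* M exceeds (2 L rho + 1) / delta, so pieces of diameter 2 L rho / M are admissible at scale
   delta. *)
have [m] := ltr_add_invr (divr_gt0 d0 (ltr_wpDl LR0 ltr01)); rewrite add0r => hm.
set M := m.+1 in hm; have M0 : 0 < M%:R :> R by rewrite ltr0n.
have LM : 2 * L * rho / M%:R <= delta.
  move: hm; rewrite ltr_pdivlMr ?ltr_wpDl// => hm; apply: ltW.
  apply: le_lt_trans hm; by rewrite mulrC ler_pM2l ?invr_gt0// lerDl.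
pose c := col' i y0.
pose cell (j : {ffun 'I_s -> 'I_M}) : set 'rV[R]_n := S `&` [set y | forall l : 'I_s,
  (j l)%:R <= (col' i y 0 l - c 0 l + rho) / (2 * rho) * M%:R <= (j l).+1%:R].
have cov : S `<=` \bigcup_j cell j.
  move=> y Sy.
  have /choice[j hj] : forall l : 'I_s, exists j : 'I_M,
      j%:R <= (col' i y 0 l - c 0 l + rho) / (2 * rho) * M%:R <= j.+1%:R.
    move=> l; apply: unit_subdivision => //.
    have := le_trans (coord_le_norm _ l) (Sr _ _ Sy Sy0).
    have -> : (col' i y - col' i y0) 0 l = col' i y 0 l - c 0 l by rewrite !mxE.
    set t := _ - _; rewrite ler_norml => /andP[h1 h2].
    have t0 : 0 <= t + rho by lra.
    rewrite mulr_ge0 ?(ltW M0) ?divr_ge0 ?mulr_ge0 ?(ltW r0)//=.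
    rewrite ger_pMl// ler_pdivrMr ?mulr_gt0// mul1r; lra.
  by exists [ffun l => j l] => //; split => //= l; rewrite ffunE.
have cover_le := @mu_ext_le_finite_cover R n (hausdorff_gauge s delta) _ _ _
  (@hausdorff_gauge0 R n s delta) (@hausdorff_gauge_ge0 R n s delta) cov.
apply: (le_trans cover_le).
have celld j y z : cell j y -> cell j z -> enorm (y - z) <= 2 * L * rho / M%:R.
  move=> [Sy hy] [Sz hz]; apply: le_trans (SL _ _ Sy Sz) _.
  have -> : 2 * L * rho / M%:R = L * (2 * rho / M%:R) by ring.
  rewrite ler_wpM2l// [leLHS]mx_normrE; apply/bigmax_leP; split.
    by rewrite divr_ge0 ?mulr_ge0// ltW.
  move=> [u l] _ /=; rewrite ord1 {u}.
  have := hy l; have := hz l => /=.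
  set a := (_ / _ * _); set b := (_ / _ * _) => /andP[a1 a2] /andP[b1 b2].
  have -> : (col' i y - col' i z) 0 l = (b - a) * (2 * rho / M%:R).
    rewrite /a /b -mulrBl -mulrBl !mxE; field.
    by rewrite gt_eqF// gt_eqF.
  rewrite normrM [X in _ * X]ger0_norm; last by rewrite divr_ge0 ?mulr_ge0// ltW.
  rewrite ler_piMl//; first by rewrite divr_ge0 ?mulr_ge0// ltW.
  by rewrite ler_norml; move: a1 a2 b1 b2; rewrite -!natr1; lra.
apply: (@le_trans _ _ (\sum_(j : {ffun 'I_s -> 'I_M})
    (@hausdorff_const R s * (2 * L * rho / M%:R) ^+ s)%:E)%E).
  apply: lee_sum => j _; rewrite /hausdorff_gauge; case: asboolP => _.
    by rewrite lee_fin mulr_ge0 ?hausdorff_const_ge0// exprn_ge0// divr_ge0// ltW.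
  rewrite asboolT; last by move=> y z yj zj; exact: le_trans (celld _ _ _ yj zj) LM.
  rewrite lee_fin ler_wpM2l ?hausdorff_const_ge0// lerXn2r ?nnegrE ?diam_ge0//.
    by rewrite divr_ge0// ltW.
  by apply: diam_le => [|y z]; [rewrite divr_ge0// ltW|exact: celld].
rewrite sumEFin lee_fin sumr_const card_ffun !card_ord -[X in X <= _]mulr_natl natrX.
rewrite mulrCA -exprMn mulrCA mulfV ?mulr1// gt_eqF//.
Qed.

(** A covering set of diameter t projects into a box of side 2 t, whose volume (2 t)^s is 2^s times
    the power of t in the gauge. *)
Lemma hausdorff_ge_projection i S :
  ((@hausdorff_const R s / 2 ^+ s)%:E * lebesgue_outer (col' i @` S : set 'rV[R]_s)
    <= hausdorff_outer s S)%E.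
Proof.
have c0 := @hausdorff_const_ge0 R s.
have c20 : 0 <= @hausdorff_const R s / 2 ^+ s by rewrite divr_ge0// exprn_ge0.
apply: (@le_trans _ _ (mu_ext (hausdorff_gauge s 1) S)); last first.
  by apply: ereal_sup_ubound; exists 1 => //=.
apply: le_mu_ext_cover => F SF.
apply: (@le_trans _ _ ((@hausdorff_const R s / 2 ^+ s)%:E *
    \sum_(k <oo) lebesgue_outer (col' i @` F k : set 'rV[R]_s))%E).
  rewrite lee_wpmul2l ?lee_fin//.
  apply: le_trans (outer_measure_sigma_subadditive _ _).
  apply: le_outer_measure => _ [y /SF[k _ Fky] <-].
  by exists k => //; exists y.
rewrite -nneseriesZl//; last by move=> k _; exact: outer_measure_ge0.
apply: lee_nneseries => [k _ _|k _].
  by rewrite mule_ge0 ?lee_fin// outer_measure_ge0.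
rewrite /hausdorff_gauge; case: asboolP => [->|F0].
  by rewrite image_set0 outer_measure0 mule0.
case: asboolP => [Fd|_]; last exact: leey.
have /set0P[y0 Fy0] : F k != set0 by apply/eqP.
have Fdiam y : F k y -> enorm (y - y0) <= diam (F k).
  move=> Fy; apply: ub_le_sup; last by exists (y, y0).
  by exists 1 => _ [[u v] /= [Fu Fv] <-]; exact: Fd.
set dF := diam (F k) in Fdiam *.
have dF0 : 0 <= dF by exact: diam_ge0.
pose a : 'rV[R]_s := \row_l (col' i y0 0 l - dF).
pose b : 'rV[R]_s := \row_l (col' i y0 0 l + dF).
have vE : volume a b = (2 * dF) ^+ s.
  rewrite /volume (eq_bigr (fun=> 2 * dF)) ?prodr_const ?card_ord// => l _.
  by rewrite !mxE; ring.
apply: (@le_trans _ _ ((@hausdorff_const R s / 2 ^+ s)%:E * (volume a b)%:E)%E).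
  rewrite lee_wpmul2l ?lee_fin//; apply: lebesgue_outer_le_volume => [l|_ [y Fy <-] l].
    by rewrite !mxE; lra.
  have := le_trans (coord_le_enorm _ (lift i l)) (Fdiam _ Fy).
  by rewrite !mxE ler_norml; lra.
rewrite vE -EFinM lee_fin exprMn le_eqVlt; apply/orP; left; apply/eqP.
by field.
Qed.

End HausdorffGraph.

(** The unit ball lies between two boxes. The outer one matters too, since [fine] sends an infinite
    measure to 0. *)
Lemma hausdorff_const_gt0 (R : realType) (s : nat) : 0 < @hausdorff_const R s.
Proof.
pose B : set 'rV[R]_s := [set x | enorm x <= 1].
pose r : R := (Num.sqrt s%:R + 1)^-1.
have s1 : 0 < Num.sqrt s%:R + 1 :> R by rewrite ltr_wpDl ?sqrtr_ge0.
have r0 : 0 < r by rewrite invr_gt0.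
pose a : 'rV[R]_s := const_mx (- r); pose b : 'rV[R]_s := const_mx r.
have ab l : a 0 l < b 0 l by rewrite !mxE; lra.
have abB : in_box a b `<=` B.
  move=> x xab; rewrite /B /=; apply: le_trans (enorm_le_norm x) _.
  apply: (@le_trans _ _ (Num.sqrt s%:R * r)).
    rewrite ler_wpM2l ?sqrtr_ge0// [leLHS]mx_normrE; apply/bigmax_leP; split.
      exact: ltW.
    by move=> [u l] _; rewrite ord1 ler_norml; have := xab l; rewrite !mxE.
  by rewrite ler_pdivrMr// mul1r lerDl.
have v0 : 0 < volume a b by apply: prodr_gt0 => l _; rewrite subr_gt0.
have lb : ((volume a b)%:E <= lebesgue_outer B)%E.
  by apply: le_trans (volume_le_lebesgue_outer ab) _; exact: le_outer_measure.
pose p : 'rV[R]_s := const_mx (-1); pose q : 'rV[R]_s := const_mx 1.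
have ub : (lebesgue_outer B <= (volume p q)%:E)%E.
  apply: lebesgue_outer_le_volume => [l|x Bx l]; first by rewrite !mxE; lra.
  by have := le_trans (coord_le_enorm _ l) Bx; rewrite ler_norml !mxE.
rewrite /hausdorff_const divr_gt0 ?exprn_gt0// -/B.
rewrite -lte_fin fineK; first exact: lt_le_trans lb.
rewrite ge0_fin_numE ?outer_measure_ge0//; apply: le_lt_trans ub _.
exact: ltry.
Qed.

Lemma nbhs_forall (T : topologicalType) (I : finType) (x : T) (P : I -> set T) :
  (forall i, nbhs x (P i)) -> nbhs x [set y | forall i, P i y].
Proof. by move=> h; apply: filter_forall. Qed.

Lemma nbhsS2 (T : topologicalType) (x : T) (P Q S : set T) :
  nbhs x P -> nbhs x Q -> (forall y, P y -> Q y -> S y) -> nbhs x S.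
Proof. by move=> hP hQ PQS; apply: (filterS _ (filterI hP hQ)) => y []; exact: PQS. Qed.

(** * Smooth boundaries *)

Section MeanValue.
Context {R : realType} {m : nat}.
Implicit Types (f : 'rV[R]_m -> R) (x y v : 'rV[R]_m).
Local Notation e_ i := (delta_mx 0 i : 'rV[R]_m).

Definition C1 f : Prop := forall i : 'I_m,
  (forall x, derivable f x (e_ i)) /\ continuous (fun x => 'D_(e_ i) f x).

(** The two conditions on c place it between 0 and t for either sign of t. *)
Lemma partial_mean_value f x (i : 'I_m) (t : R) : (forall z, derivable f z (e_ i)) ->
  exists2 c, `|c| <= `|t| /\ 0 <= c * t & f (x + t *: e_ i) - f x = 'D_(e_ i) f (x + c *: e_ i) * t.
Proof.
move=> df; pose p (s : R) := f (x + s *: e_ i).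
have quot s : (fun h => h^-1 *: ((p \o shift s) (h *: (1 : R)) - p s)) =
    (fun h => h^-1 *: ((f \o shift (x + s *: e_ i)) (h *: e_ i) - f (x + s *: e_ i))).
  apply/funext => h; congr (_ *: (f _ - _)).
  by rewrite /= [h *: 1]mulr1 scalerDl addrCA.
have dp s : is_derive s (1 : R) p ('D_(e_ i) f (x + s *: e_ i)).
  by split; [rewrite /derivable quot; exact: df|rewrite /derive quot].
have cp s : {for s, continuous p}.
  by apply: differentiable_continuous; apply/derivable1_diffP; case: (dp s).
have mv a b : a <= b -> exists2 c, a <= c <= b & p b - p a = 'D_(e_ i) f (x + c *: e_ i) * (b - a).
  move=> ab; have [c] := @MVT_segment R p (fun s => 'D_(e_ i) f (x + s *: e_ i)) a b ab
    (fun s _ => dp s) (continuous_subspaceT cp).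
  by rewrite in_itv /=; exists c.
have p0 : p 0 = f x by rewrite /p scale0r addr0.
have [t0|t0] := leP 0 t.
  have [c /andP[c0 ct] h] := mv 0 t t0; exists c; last by rewrite -p0 h subr0.
  by rewrite !ger0_norm// mulr_ge0.
have [c /andP[c0 ct] h] := mv t 0 (ltW t0); exists c.
  by rewrite (ler0_norm (ltW t0)) ler0_norm// lerN2; split => //; nra.
by rewrite -p0 -opprB h sub0r mulrN opprK.
Qed.

(** Moving from x to y one coordinate at a time requires partial derivatives only. Each coordinate
    of an intermediate point lies between those of x and y, so the point stays in every sup-norm
    ball that contains both. *)
Lemma mean_value f x y : (forall i z, derivable f z (e_ i)) ->
  exists2 xi : 'I_m -> 'rV[R]_m,
    forall k x0 r, `|x - x0| <= r -> `|y - x0| <= r -> `|xi k - x0| <= r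
  & f y - f x = \sum_k 'D_(e_ k) f (xi k) * (y 0 k - x 0 k).
Proof.
move=> df; pose z (k : nat) : 'rV[R]_m := \row_j (if (j < k)%N then y 0 j else x 0 j).
have zS (k : 'I_m) : z k.+1 = z k + (y 0 k - x 0 k) *: e_ k.
  apply/rowP => j; rewrite !mxE eqxx /= ltnS leq_eqVlt.
  rewrite val_eqE; have [->|jk] := eqVneq j k; first by rewrite ltnn mulr1 addrC subrK.
  by rewrite mulr0 addr0.
have /choice[xi hxi] : forall k : 'I_m, exists w : 'rV[R]_m,
    (forall x0 r, `|x - x0| <= r -> `|y - x0| <= r -> `|w - x0| <= r) /\
    f (z k.+1) - f (z k) = 'D_(e_ k) f w * (y 0 k - x 0 k).
  move=> k; have [c [c1 c2] h] := partial_mean_value (z k) (y 0 k - x 0 k) (df k).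
  exists (z k + c *: e_ k); rewrite zS; split => // x0 r xr yr.
  have r0 : 0 <= r := le_trans (normr_ge0 _) xr.
  rewrite [leLHS]mx_normrE; apply/bigmax_leP; split => // -[u j] _ /=; rewrite ord1 {u}.
  have := le_trans (coord_le_norm _ j) xr; have := le_trans (coord_le_norm _ j) yr.
  rewrite !mxE eqxx /=; have [->|jk] := eqVneq j k; last first.
    by rewrite mulr0 addr0; case: ifP.
  rewrite ltnn mulr1; move: c1 c2; set a := x 0 k; set b := y 0 k; set q := x0 0 k.
  move=> c1 c2 hb ha.
  have [ab|ab] := leP 0 (b - a).
    move: c1; rewrite (ger0_norm ab) ler_norml => /andP[c1' c1].
    have c0 : 0 <= c by rewrite leNgt; apply/negP => c0; nra.
    by move: ha hb; rewrite !ler_norml; lra.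
  move: c1; rewrite (ltr0_norm ab) ler_norml => /andP[c1 c1'].
  have c0 : c <= 0 by rewrite leNgt; apply/negP => c0; nra.
  by move: ha hb; rewrite !ler_norml; lra.
exists xi => [k|]; first by case: (hxi k).
under eq_bigr do rewrite -(hxi _).2.
have zm : z m = y by apply/rowP => j; rewrite mxE ltn_ord.
have z0 : z 0%N = x by apply/rowP => j; rewrite mxE.
rewrite -{1}zm -{1}z0 -(big_mkord xpredT (fun k => f (z k.+1) - f (z k))).
by rewrite telescope_sumr.
Qed.

Lemma C1_locally_lipschitz f x0 : C1 f -> exists2 r : R, 0 < r &
  exists2 K : R, 0 <= K & forall x y, `|x - x0| <= r -> `|y - x0| <= r ->
    `|f y - f x| <= K * `|y - x|.
Proof.
move=> Cf; pose D k x := 'D_(e_ k) f x.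
have : \forall x \near x0, forall k : 'I_m, `|D k x - D k x0| < 1.
  apply: (@nbhs_forall _ _ _ (fun k x => `|D k x - D k x0| < _)) => k.
  have [_ /(_ x0)] := Cf k.
  by move=> /cvgrPdist_lt/(_ 1 ltr01); apply: filterS => x; rewrite distrC.
move=> /nbhs_ballP[e /= e0 he]; exists (e / 2); first by rewrite divr_gt0.
pose K := \sum_k (`|D k x0| + 1); have K0 : 0 <= K by apply: sumr_ge0 => k _; rewrite addr_ge0.
exists K => // x y xr yr.
have [xi hxi ->] := mean_value x y (fun i => (Cf i).1).
apply: le_trans (ler_norm_sum _ _ _) _; rewrite mulr_suml; apply: ler_sum => k _.
have := le_trans (coord_le_norm (y - x) k) (lexx _); rewrite !mxE => yxk.
rewrite normrM ler_pM//.
have /he/(_ k) : ball x0 e (xi k).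
  rewrite -ball_normE /= distrC; apply: le_lt_trans (hxi k x0 _ xr yr) _; lra.
by rewrite -/(D k _) => h; have := ler_normD (D k (xi k) - D k x0) (D k x0); rewrite subrK; lra.
Qed.

Lemma C1_differentiable f x0 (e : R) : C1 f -> 0 < e ->
  exists2 r : R, 0 < r & forall y, `|y - x0| <= r ->
    `|f y - f x0 - dot (grad f x0) (y - x0)| <= e * `|y - x0|.
Proof.
move=> Cf e0; pose D k x := 'D_(e_ k) f x; pose e1 := e / (m%:R + 1).
have m1 : 0 < m%:R + 1 :> R by rewrite ltr_wpDl.
have e10 : 0 < e1 by rewrite divr_gt0.
have : \forall x \near x0, forall k : 'I_m, `|D k x - D k x0| < e1.
  apply: (@nbhs_forall _ _ _ (fun k x => `|D k x - D k x0| < _)) => k.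
  have [_ /(_ x0)] := Cf k.
  by move=> /cvgrPdist_lt/(_ e1 e10); apply: filterS => x; rewrite distrC.
move=> /nbhs_ballP[r /= r0 hr]; exists (r / 2); first by rewrite divr_gt0.
move=> y yr; have [xi hxi ->] := mean_value x0 y (fun i => (Cf i).1).
rewrite /dot -sumrB; apply: le_trans (ler_norm_sum _ _ _) _.
apply: (@le_trans _ _ (\sum_(k < m) e1 * `|y - x0|)); last first.
  rewrite sumr_const card_ord -mulr_natl mulrA ler_wpM2r// /e1 mulrCA ger_pMr//.
  by rewrite ler_pdivrMr// mul1r lerDl.
apply: ler_sum => k _; rewrite !mxE -mulrBl normrM ler_pM//; last first.
  by have := coord_le_norm (y - x0) k; rewrite !mxE.
apply/ltW/hr; rewrite -ball_normE /= distrC.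
by apply: le_lt_trans (hxi k x0 (r / 2) _ yr) _; [rewrite subrr normr0; lra|lra].
Qed.

Lemma C1_directional f x0 v : C1 f -> dot (grad f x0) v < 0 ->
  exists2 r : R, 0 < r & forall t, 0 < t < r -> f (x0 + t *: v) < f x0.
Proof.
move=> Cf Dv; pose e := - dot (grad f x0) v / 2 / (`|v| + 1).
have v1 : 0 < `|v| + 1 by rewrite ltr_wpDl.
have e0 : 0 < e by rewrite divr_gt0// divr_gt0// oppr_gt0.
have [r r0 hr] := C1_differentiable x0 Cf e0.
exists (r / (`|v| + 1)); first by rewrite divr_gt0.
move=> t /andP[t0 tr]; have := hr (x0 + t *: v).
rewrite addrAC subrr add0r normrZ gtr0_norm// dotZr => h.
have {}h : `|f (x0 + t *: v) - f x0 - t * dot (grad f x0) v| <= e * (t * `|v|).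
  apply: h; move: tr; rewrite ltr_pdivlMr// => tr; nra.
have ev : e * `|v| <= - dot (grad f x0) v / 2.
  have : e * (`|v| + 1) = - dot (grad f x0) v / 2 by rewrite /e divfK ?gt_eqF.
  by nra.
move: h; rewrite ler_norml => /andP[_]; nra.
Qed.

End MeanValue.

Section GraphFunction.
Context {R : realType} {d : nat}.
Implicit Types (x y v : 'rV[R]_d) (i : 'I_d) (g : 'rV[R]_d.-1 -> R).
Local Notation e_ i := (delta_mx 0 i : 'rV[R]_d).

Lemma C1N (f : 'rV[R]_d -> R) : C1 f -> C1 (fun x => - f x).
Proof.
move=> Cf j; split => [x|]; first by apply: derivableN; exact: (Cf j).1.
have -> : (fun x => 'D_(e_ j) (fun x => - f x) x) = (fun x => - 'D_(e_ j) f x).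
  by apply/funext => x; rewrite -deriveN//; exact: (Cf j).1.
by move=> x; have FF := nbhs_filter x; apply: cvgN; exact: (Cf j).2.
Qed.

Lemma gradN (f : 'rV[R]_d -> R) x : C1 f -> grad (fun x => - f x) x = - grad f x.
Proof.
by move=> Cf; apply/rowP => j; rewrite !mxE -deriveN//; exact: (Cf j).1.
Qed.

Lemma col'_continuous i : continuous (fun y => col' i y).
Proof.
move=> y; have FF := nbhs_filter y; apply/cvgrPdist_lt => /= e e0.
suff H : nbhs (y : 'rV[R]_d) [set t : 'rV[R]_d | `|col' i y - col' i t| < e] by exact: H.
apply/nbhs_ballP; exists e => // z; rewrite -ball_normE /= => yz.
apply: le_lt_trans yz; rewrite [leLHS]mx_normrE; apply/bigmax_leP; split => // -[u j] _ /=.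
by rewrite ord1; have := coord_le_norm (y - z) (lift i j); rewrite !mxE.
Qed.

Lemma col'_delta_lift i (l : 'I_d.-1) : col' i (e_ (lift i l)) = delta_mx 0 l.
Proof. by apply/rowP => j; rewrite !mxE (inj_eq lift_inj). Qed.

Lemma col'_delta_id i : col' i (e_ i) = 0.
Proof. by apply/rowP => j; rewrite !mxE eq_sym (negPf (neq_lift i j)) andbF. Qed.

Lemma derive_comp_col' i g (l : 'I_d.-1) y : derivable g (col' i y) (delta_mx 0 l) ->
  is_derive y (e_ (lift i l)) (fun y => g (col' i y)) ('D_(delta_mx 0 l) g (col' i y)).
Proof.
move=> dg.
have quot : (fun h => h^-1 *: (((fun y => g (col' i y)) \o shift y) (h *: e_ (lift i l)) - g (col' i y))) =
    (fun h => h^-1 *: ((g \o shift (col' i y)) (h *: delta_mx 0 l) - g (col' i y))).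
  by apply/funext => h; congr (_ *: (g _ - _)); rewrite /= linearD linearZ /= col'_delta_lift.
by split; [rewrite /derivable quot|rewrite /derive quot].
Qed.

Lemma derive_comp_col'_id i g y :
  is_derive y (e_ i) (fun y => g (col' i y)) 0.
Proof.
have quot : (fun h => h^-1 *: (((fun y => g (col' i y)) \o shift y) (h *: e_ i) - g (col' i y))) =
    (fun=> 0).
  apply/funext => h; have -> : ((fun y => g (col' i y)) \o shift y) (h *: e_ i) = g (col' i y).
    by congr g; rewrite /= linearD linearZ /= col'_delta_id scaler0 add0r.
  by rewrite subrr scaler0.
by split; [rewrite /derivable quot; exact: is_cvg_cst|rewrite /derive quot; exact: lim_cst].
Qed.

Lemma derive_coord i j y :
  is_derive y (e_ j) (fun y => y 0 i) ((i == j)%:R : R).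
Proof.
have quot : (fun h => h^-1 *: (((fun y => y 0 i) \o shift y) (h *: e_ j) - y 0 i)) @ (0:R)^' -->
   ((i == j)%:R : R).
  apply: cvg_near_cst; near=> h; rewrite /= !mxE addrK.
  by rewrite [_ *: _]mulrA mulVf ?mul1r//; near: h; exact: nbhs_dnbhs_neq.
split; first by apply/cvg_ex; exists ((i == j)%:R).
by apply/cvg_lim.
Unshelve. all: by end_near. Qed.

Lemma graph_fun_partial b i g j y : smooth g ->
  is_derive y (e_ j) (graph_fun b i g) ((-1) ^+ b *
    (if unlift i j is Some l then 'D_(delta_mx 0 l) g (col' i y) else -1)).
Proof.
move=> sg; have dg l z : derivable g z (delta_mx 0 l) by have [_ /(_ l)[]] := sg 1%N.
have dB : is_derive y (e_ j) (fun y => g (col' i y) - y 0 i)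
    (if unlift i j is Some l then 'D_(delta_mx 0 l) g (col' i y) else -1).
  case: unliftP => [l ->|->].
    have := is_deriveB (derive_comp_col' (dg l (col' i y))) (derive_coord i (lift i l) y).
    by rewrite (negPf (neq_lift i l)) subr0.
  have := is_deriveB (derive_comp_col'_id i g y) (derive_coord i i y).
  by rewrite eqxx sub0r.
exact: is_deriveZ.
Qed.

Lemma C1_graph_fun b i g : smooth g -> C1 (graph_fun b i g).
Proof.
move=> sg j; split => [x|]; first by case: (graph_fun_partial b i j x sg).
have -> : (fun x => 'D_(e_ j) (graph_fun b i g) x) = (fun y => (-1) ^+ b *
    (if unlift i j is Some l then 'D_(delta_mx 0 l) g (col' i y) else -1)).
  by apply/funext => x; case: (graph_fun_partial b i j x sg).
move=> x; have FF := nbhs_filter x; apply: cvgM; first exact: cvg_cst.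
case: (unlift i j) => [l|]; last exact: cvg_cst.
apply: (@continuous_comp _ _ _ (fun y => col' i y) (fun z => 'D_(delta_mx 0 l) g z)).
  exact: col'_continuous.
by have [_ /(_ l)[_ [h _]]] := sg 1%N; exact: h.
Qed.

(** The i-th partial derivative is 1 or -1. *)
Lemma grad_graph_fun_neq0 b i g y : smooth g -> grad (graph_fun b i g) y != 0.
Proof.
move=> sg; apply/eqP => /rowP/(_ i); rewrite !mxE.
case: (graph_fun_partial b i i y sg) => _ ->; rewrite unlift_none.
by move/eqP; rewrite mulf_eq0 signr_eq0 oppr_eq0 oner_eq0.
Qed.

Lemma graph_fun_continuous b i g : smooth g -> continuous (graph_fun b i g).
Proof.
move=> sg y; have FF := nbhs_filter y; apply: cvgM; first exact: cvg_cst.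
apply: cvgB; last exact: coord_continuous.
apply: (@continuous_comp _ _ _ (fun y => col' i y) g); first exact: col'_continuous.
by have [+ _] := sg 0%N; exact.
Qed.

End GraphFunction.

Section UnitVectors.
Context {R : realType} {d : nat}.
Implicit Types (n v : 'rV[R]_d).

(** If two charts had different normals at one point, the direction n2 - n1 would enter the domain
    according to the first and leave it according to the second. *)
Lemma unit_vectors_separated n1 n2 : dot n1 n1 = 1 -> dot n2 n2 = 1 -> n1 <> n2 ->
  dot n1 (n2 - n1) < 0 /\ 0 < dot n2 (n2 - n1).
Proof.
move=> n11 n22 n12; have : 0 < dot (n1 - n2) (n1 - n2).
  rewrite lt_neqAle dot_ge0 andbT eq_sym; apply/eqP => /dot_eq0/eqP.
  by rewrite subr_eq0 => /eqP.
rewrite !dotDr !dotDl !dotNr !dotNl n11 n22 (dotC n2); lra.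
Qed.

Lemma small_step v (t1 t2 r1 r2 : R) : 0 < t1 -> 0 < t2 -> 0 < r1 -> 0 < r2 ->
  exists t, [/\ 0 < t, t < t1, t < t2, t * enorm v < r1 & t * enorm v < r2].
Proof.
move=> t10 t20 r10 r20; have v0 : 0 < enorm v + 1 by rewrite ltr_wpDl ?enorm_ge0.
pose r := Num.min (Num.min t1 t2) (Num.min (r1 / (enorm v + 1)) (r2 / (enorm v + 1))).
have r0 : 0 < r by rewrite !lt_min t10 t20 !divr_gt0.
have r2r : r / 2 < r by lra.
have small q : r / 2 < q / (enorm v + 1) -> r / 2 * enorm v < q.
  rewrite ltr_pdivlMr// => h; apply: le_lt_trans h.
  by rewrite ler_wpM2l ?lerDl// divr_ge0// ltW.
have := r2r; rewrite {2}/r !lt_min => /andP[/andP[h1 h2] /andP[h3 h4]].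
by exists (r / 2); split; rewrite ?divr_gt0// small.
Qed.

End UnitVectors.

(** * Unit normal and surface measure of the boundary *)

Section SmoothBoundary.
Context {R : realType} {d : nat}.
Variable Omega : set 'rV[R]_d.
Hypothesis sO : smooth_domain Omega.
Local Notation Gamma := (frontier Omega).
Implicit Types (x y z v : 'rV[R]_d) (i : 'I_d) (g : 'rV[R]_d.-1 -> R).

Let oO : open Omega. Proof. by case: sO. Qed.

Lemma nbhs_enorm (x : 'rV[R]_d) (r : R) : 0 < r -> nbhs x [set y | enorm (y - x) < r].
Proof.
move=> r0; apply/nbhs_ballP; exists (r / (Num.sqrt d%:R + 1)).
  by rewrite /= divr_gt0// ltr_wpDl ?sqrtr_ge0.
move=> y; rewrite -ball_normE /= distrC ltr_pdivlMr ?ltr_wpDl ?sqrtr_ge0// => h.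
apply: le_lt_trans (enorm_le_norm _) _; apply: le_lt_trans h.
by rewrite mulrC ler_wpM2l// lerDl.
Qed.

Lemma enorm_ball_subset (x : 'rV[R]_d) (A : set 'rV[R]_d) : nbhs x A ->
  exists2 r, 0 < r & forall y, enorm (y - x) < r -> A y.
Proof.
move=> /nbhs_ballP[r /= r0 xA]; exists r => // y yx; apply: xA.
by rewrite -ball_normE /= distrC; apply: le_lt_trans (norm_le_enorm _) yx.
Qed.

Lemma frontier_notin x : Gamma x -> ~ Omega x.
Proof. by case=> _ + Ox; apply; rewrite ((interior_id _).1 oO). Qed.

Lemma frontier_closed : closed Gamma.
Proof.
rewrite /frontier setDE; apply: closedI; first exact: closed_closure.
by apply: open_closedC; exact: open_interior.
Qed.

Lemma frontier_bounded : exists M : R, forall x, closure Omega x -> `|x| <= M.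
Proof.
have [_ _ [M [_ hM]] _ _] := sO; exists (M + 1).
have cM : closed [set x : 'rV[R]_d | `|x| <= M + 1].
  apply: (@closed_comp _ _ (fun x : 'rV[R]_d => `|x|) [set r : R | r <= M + 1]).
    by move=> x _; exact: norm_continuous.
  exact: closed_le.
have OM : Omega `<=` [set x : 'rV[R]_d | `|x| <= M + 1].
  by move=> x; apply: hM; rewrite ltrDl.
by move=> x /(closureS OM); rewrite -((closure_id _).1 cM).
Qed.

Lemma frontier_compact : compact Gamma.
Proof.
apply: bounded_closed_compact; last exact: frontier_closed.
have [M hM] := frontier_bounded; exists M; split; first exact: num_real.
by move=> K MK x [cx _]; apply: le_trans (hM x cx) (ltW MK).
Qed.

Lemma local_graph_shift x b i g : local_graph Omega x b i g ->
  exists2 r : R, 0 < r & forall y, enorm (y - x) < r -> local_graph Omega y b i g.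
Proof.
move=> [sg [r r0 h]]; exists r => // z zx; split => //.
exists (r - enorm (z - x)); first by rewrite subr_gt0.
move=> w wz; apply: h; have := enorm_triangle (w - z) (z - x).
by rewrite addrA subrK; lra.
Qed.

Lemma graph_fun_frontier x b i g : local_graph Omega x b i g -> Gamma x ->
  graph_fun b i g x = 0.
Proof.
move=> [sg [r r0 h]] Gx; have xO := frontier_notin Gx.
apply/eqP; rewrite eq_le; apply/andP; split; last first.
  by rewrite leNgt; apply/negP => /(h x _).2; rewrite subrr enorm0 => /(_ r0).
rewrite leNgt; apply/negP => px.
have cf := graph_fun_continuous (b := b) (i := i) sg.
have near : nbhs x [set y | enorm (y - x) < r /\ 0 < graph_fun b i g y].
  have pos : nbhs x [set y | 0 < graph_fun b i g y].
    by apply: (cf x [set t : R | 0 < t]); apply: open_nbhs_nbhs; split => //; exact: open_gt.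
  by apply: nbhsS2 (nbhs_enorm x r0) pos _ => y.
have [y [Oy [yx py]]] := Gx.1 _ near.
by move: ((h y yx).1 Oy); rewrite ltNge ltW.
Qed.

Definition unit_grad b i g x : 'rV[R]_d :=
  (enorm (grad (graph_fun b i g) x))^-1 *: grad (graph_fun b i g) x.

Let enorm_grad_gt0 b i g x : smooth g -> 0 < enorm (grad (graph_fun b i g) x).
Proof.
move=> sg; rewrite lt_neqAle enorm_ge0 andbT eq_sym.
by apply/eqP => /enorm_eq0 /eqP; rewrite (negPf (grad_graph_fun_neq0 _ _ _ sg)).
Qed.

Lemma unit_gradE b i g x v : smooth g ->
  dot (grad (graph_fun b i g) x) v = enorm (grad (graph_fun b i g) x) * dot (unit_grad b i g x) v.
Proof.
by move=> sg; rewrite dotZl mulrA mulfV ?mul1r// gt_eqF// enorm_grad_gt0.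
Qed.

Lemma unit_grad_dot b i g x : smooth g ->
  dot (unit_grad b i g x) (unit_grad b i g x) = 1.
Proof.
move=> sg; have e0 := enorm_grad_gt0 b i x sg.
by rewrite dotZl dotZr -sqr_enorm; field; rewrite gt_eqF.
Qed.

(** [exterior_unit_normal] picks an arbitrary chart, so its value must not depend on it. A short
    step along n2 - n1 makes the first defining function negative and the second positive, a point
    both inside and outside Omega. *)
Lemma unit_grad_unique x b1 i1 g1 b2 i2 g2 :
  Gamma x -> local_graph Omega x b1 i1 g1 -> local_graph Omega x b2 i2 g2 ->
  unit_grad b1 i1 g1 x = unit_grad b2 i2 g2 x.
Proof.
move=> Gx l1 l2; have [sg1 [r1 r10 h1]] := l1; have [sg2 [r2 r20 h2]] := l2.
apply: contrapT => n12.
have [v1 v2] := unit_vectors_separated (unit_grad_dot b1 i1 x sg1) (unit_grad_dot b2 i2 x sg2) n12.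
set v := _ - _ in v1 v2.
have w1 : dot (grad (graph_fun b1 i1 g1) x) v < 0.
  by rewrite (unit_gradE b1 i1 x v sg1) (pmulr_rlt0 _ (enorm_grad_gt0 b1 i1 x sg1)).
have w2 : dot (grad (fun y => - graph_fun b2 i2 g2 y) x) v < 0.
  rewrite (gradN x (C1_graph_fun b2 i2 sg2)) dotNl (unit_gradE b2 i2 x v sg2) oppr_lt0.
  by rewrite (pmulr_rgt0 _ (enorm_grad_gt0 b2 i2 x sg2)).
have [t1 t10 ht1] := C1_directional (C1_graph_fun b1 i1 sg1) w1.
have [t2 t20 ht2] := C1_directional (C1N (C1_graph_fun b2 i2 sg2)) w2.
have [t [t0 tt1 tt2 tr1 tr2]] := small_step v t10 t20 r10 r20.
have yx : enorm (x + t *: v - x) = t * enorm v.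
  by rewrite addrAC subrr add0r enormZ gtr0_norm.
have p1 : graph_fun b1 i1 g1 (x + t *: v) < graph_fun b1 i1 g1 x by apply: ht1; rewrite t0.
have p2 : - graph_fun b2 i2 g2 (x + t *: v) < - graph_fun b2 i2 g2 x by apply: ht2; rewrite t0.
have Oy : Omega (x + t *: v).
  by apply/h1; rewrite ?yx// -(graph_fun_frontier l1 Gx).
have := (h2 (x + t *: v) _).1 Oy; rewrite yx => /(_ tr2).
by rewrite ltNge => /negP; apply; move: p2; rewrite (graph_fun_frontier l2 Gx) oppr0 oppr_lt0 => /ltW.
Qed.

Lemma exterior_unit_normalE x b i g : Gamma x -> local_graph Omega x b i g ->
  exterior_unit_normal Omega x = unit_grad b i g x.
Proof.
move=> Gx l; apply: xget_unique; first by exists b, i, g.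
by move=> _ [b' [i' [g' [l' ->]]]]; exact: unit_grad_unique Gx l' l.
Qed.

Lemma unit_grad_continuous b i g j : smooth g -> continuous (fun x => unit_grad b i g x 0 j).
Proof.
move=> sg; have Cg := C1_graph_fun b i sg.
pose G k x := 'D_(delta_mx 0 k) (graph_fun b i g) x.
have GE : (fun x => unit_grad b i g x 0 j) = fun x => (Num.sqrt (\sum_k G k x * G k x))^-1 * G j x.
  apply/funext => x; rewrite /unit_grad !mxE; congr (_^-1 * _).
  by rewrite /enorm /dot; congr Num.sqrt; apply: eq_bigr => k _; rewrite !mxE.
rewrite GE => x; have FF := nbhs_filter x; apply: cvgM; last exact: (Cg j).2.
have S0 : Num.sqrt (\sum_k G k x * G k x) != 0.
  have := enorm_grad_gt0 b i x sg; rewrite lt0r => /andP[+ _]; congr (_ != 0).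
  by rewrite /enorm /dot; congr Num.sqrt; apply: eq_bigr => k _; rewrite !mxE.
apply: cvgV => //.
apply: (@continuous_comp _ _ _ (fun x => \sum_k G k x * G k x) Num.sqrt).
  apply: cvg_big => [|k _]; first exact: add_continuous.
  by apply: cvgM; exact: (Cg k).2.
exact: sqrt_continuous.
Qed.

(** A chart at x serves all boundary points near x, so there the normal is one continuous normalised
    gradient. *)
Lemma normal_continuous j :
  {within Gamma, continuous (fun x => exterior_unit_normal Omega x 0 j)}.
Proof.
apply/subspace_continuousP => x Gx.
have [_ _ _ _ /(_ x Gx)[b [i [g l]]]] := sO.
have [r r0 hr] := local_graph_shift l.
have sg : smooth g by case: l.
move=> A; rewrite /from_subspace (exterior_unit_normalE Gx l) => nA.
suff : nbhs x [set y | Gamma y -> A (exterior_unit_normal Omega y 0 j)] by [].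
have cA := unit_grad_continuous (b := b) (i := i) (j := j) sg nA.
apply: nbhsS2 cA (nbhs_enorm x r0) _ => y Ay yx Gy.
by rewrite (exterior_unit_normalE Gy (hr y yx)).
Qed.

Lemma local_graph_hausdorff x0 : Gamma x0 ->
  exists2 U : set 'rV[R]_d, open U /\ U x0 & exists2 C : R, 0 <= C &
  forall (S : set 'rV[R]_d) (rho : R), 0 < rho ->
    (forall y z, S y -> S z -> `|y - z| <= rho) ->
    (hausdorff_outer d.-1 (S `&` Gamma `&` U) <= (C * rho ^+ d.-1)%:E)%E.
Proof.
move=> Gx0; have [_ _ _ _ /(_ x0 Gx0)[b [i [g l]]]] := sO.
have [r r0 hr] := local_graph_shift l.
have sg : smooth g by case: l.
have Cg : C1 g by move=> k; have [_ /(_ k)[dg [cg _]]] := sg 1%N.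
have [r1 r10 [K K0 hK]] := C1_locally_lipschitz (col' i x0) Cg.
pose U := [set y : 'rV[R]_d | enorm (y - x0) < r]° `&` [set y : 'rV[R]_d | `|col' i y - col' i x0| < r1]°.
exists U.
  split; first by apply: openI; exact: open_interior.
  split; first exact: nbhs_enorm.
  apply: (@col'_continuous R d i x0 [set z | `|z - col' i x0| < r1]).
  apply/nbhs_ballP; exists r1 => // z; by rewrite -ball_normE /= distrC.
have sub1 y : U y -> enorm (y - x0) < r by case=> /interior_subset.
have sub2 y : U y -> `|col' i y - col' i x0| < r1 by case=> _ /interior_subset.
(* On the graph the i-th coordinate is K-Lipschitz in the others, so the sup distance of two points
   is at most K + 1 times that of their projections; the square root passes to the Euclidean
   distance. *)
pose L := Num.sqrt d%:R * (K + 1).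
have L0 : 0 <= L by rewrite mulr_ge0 ?sqrtr_ge0// addr_ge0.
exists (@hausdorff_const R d.-1 * (2 * L) ^+ d.-1).
  by rewrite mulr_ge0 ?hausdorff_const_ge0// exprn_ge0// mulr_ge0.
move=> S rho rho0 Srho; rewrite -mulrA -exprMn.
have col_le (y z : 'rV[R]_d) : `|col' i y - col' i z| <= `|y - z|.
  rewrite [leLHS]mx_normrE; apply/bigmax_leP; split => // -[u k] _ /=; rewrite ord1.
  by have := coord_le_norm (y - z) (lift i k); rewrite !mxE.
apply: (hausdorff_graph_le L0 rho0) => y z [[Sy Gy] Uy] [[Sz Gz] Uz]; last first.
  by apply: le_trans (col_le _ _) (Srho _ _ Sy Sz).
have coordE w : Gamma w -> U w -> w 0 i = g (col' i w).
  move=> Gw Uw; have := graph_fun_frontier (hr w (sub1 w Uw)) Gw.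
  by move/eqP; rewrite mulf_eq0 signr_eq0 /= subr_eq0 => /eqP.
apply: le_trans (enorm_le_norm _) _; rewrite /L -mulrA ler_wpM2l ?sqrtr_ge0//.
have N0 := normr_ge0 (col' i y - col' i z).
rewrite [leLHS]mx_normrE; apply/bigmax_leP; split; first by rewrite mulr_ge0// addr_ge0.
move=> [u j] _ /=; rewrite ord1 {u}; case: (unliftP i j) => [k ->|->].
  have := coord_le_norm (col' i y - col' i z) k; rewrite !mxE; nra.
rewrite !mxE !coordE//.
have := hK _ _ (ltW (sub2 z Uz)) (ltW (sub2 y Uy)); nra.
Qed.

(** Compactness of Gamma replaces the local constants by their sum over a finite subcover. As rho is
    arbitrary, this controls the boundary part of one element as well as the total surface. *)
Lemma frontier_hausdorff_le : exists2 C : R, 0 <= C &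
  forall (S : set 'rV[R]_d) (rho : R), 0 < rho ->
    (forall y z, S y -> S z -> `|y - z| <= rho) ->
    (hausdorff_outer d.-1 (S `&` Gamma) <= (C * rho ^+ d.-1)%:E)%E.
Proof.
pose P (U : set 'rV[R]_d) (C : R) := 0 <= C /\ forall (S : set 'rV[R]_d) (rho : R), 0 < rho ->
    (forall y z, S y -> S z -> `|y - z| <= rho) ->
    (hausdorff_outer d.-1 (S `&` Gamma `&` U) <= (C * rho ^+ d.-1)%:E)%E.
have /choice[UC hUC] : forall x0, exists UC : set 'rV[R]_d * R, Gamma x0 ->
    [/\ open UC.1, UC.1 x0 & P UC.1 UC.2].
  move=> x0; have [Gx0|nG] := pselect (Gamma x0); last by exists (set0, 0).
  by have [U [oU Ux0] [C C0 h]] := local_graph_hausdorff Gx0; exists (U, C).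
have := frontier_compact; rewrite compact_cover.
move=> /(_ _ Gamma (fun x => (UC x).1)) [x Gx| |D DG hD].
- by case: (hUC x Gx).
- by move=> x Gx; exists x => //; case: (hUC x Gx).
exists (\sum_(x <- finmap.enum_fset D) `|(UC x).2|); first exact: sumr_ge0.
move=> S rho rho0 Srho.
apply: (@le_trans _ _ (\sum_(x <- finmap.enum_fset D) (`|(UC x).2| * rho ^+ d.-1)%:E)%E); last first.
  by rewrite sumEFin lee_fin mulr_suml.
apply: (@le_trans _ _ (\sum_(x <- finmap.enum_fset D) hausdorff_outer d.-1 (S `&` Gamma `&` (UC x).1))%E); last first.
  rewrite !big_seq; apply: lee_sum => x xD.
  have Gx : Gamma x by apply/set_mem; exact: DG.
  have [_ _ [C0 h]] := hUC x Gx.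
  by rewrite ger0_norm//; exact: h.
have cov : S `&` Gamma `<=` \bigcup_(x in [set` finmap.enum_fset D]) (S `&` Gamma `&` (UC x).1).
  by move=> y [Sy Gy]; have [x xD Uy] := hD y Gy; exists x.
apply: le_trans (le_outer_measure _ _ _ cov) _.
elim: (finmap.enum_fset D) => [|x s ih]; first by rewrite set_nil bigcup_set0 outer_measure0 big_nil.
rewrite big_cons; apply: le_trans (leeD2l _ ih); apply: le_trans (outer_measureU2 _ _ _).
apply: le_outer_measure => y [z /=]; rewrite inE => /orP[/eqP ->|zs] h; [by left|right].
by exists z.
Qed.

Lemma frontier_hausdorff_fin : (hausdorff_outer d.-1 Gamma < +oo)%E.
Proof.
have [C _ hC] := frontier_hausdorff_le; have [M hM] := frontier_bounded.
have bM (y z : 'rV[R]_d) : Gamma y -> Gamma z -> `|y - z| <= M + M + 1.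
  move=> [cy _] [cz _]; have := ler_normB y z; have := hM y cy; have := hM z cz; lra.
have [G0|/set0P[x Gx]] := eqVneq Gamma set0; first by rewrite G0 outer_measure0.
have M0 : 0 < M + M + 1.
  by have [cx _] := Gx; have := hM x cx; have := normr_ge0 x; lra.
by have := hC Gamma _ M0 bM; rewrite setIid => /le_lt_trans; apply; exact: ltry.
Qed.

(** Omega is bounded, so every line parallel to axis i through a small box in Omega has a highest
    point in the closure of its part in Omega, and that point lies on Gamma. Hence the projection of
    Gamma contains a box of positive volume. *)
Lemma frontier_hausdorff_gt0 : (0 < d)%N -> (0 < hausdorff_outer d.-1 Gamma)%E.
Proof.
move=> d0; pose i : 'I_d := Ordinal d0.
have [_ _ _ [x0 Ox0] _] := sO.
have [r r0 hr] : exists2 r, 0 < r & forall y, `|y - x0| < r -> Omega y.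
  have /nbhs_ballP[r r0 xO] : nbhs x0 Omega by exact: open_nbhs_nbhs.
  by exists r => // y yx; apply: xO; rewrite -ball_normE /= distrC.
pose c := col' i x0.
pose a : 'rV[R]_d.-1 := \row_l (c 0 l - r / 2).
pose b : 'rV[R]_d.-1 := \row_l (c 0 l + r / 2).
have ab l : a 0 l < b 0 l by rewrite !mxE; lra.
have [M hM] := frontier_bounded.
have proj : in_box a b `<=` col' i @` Gamma.
  move=> p pab.
  pose y (t : R) : 'rV[R]_d := \row_j (if unlift i j is Some l then p 0 l else t).
  have yi t : y t 0 i = t by rewrite mxE unlift_none.
  have yl t l : y t 0 (lift i l) = p 0 l by rewrite mxE liftK.
  have colE t : col' i (y t) = p by apply/rowP => l; rewrite mxE yl.
  have yd s t : `|y s - y t| <= `|s - t|.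
    rewrite [leLHS]mx_normrE; apply/bigmax_leP; split => // -[u j] _ /=; rewrite ord1.
    rewrite [X in `|X|]mxE [(- y t) _ _]mxE.
    by case: (unliftP i j) => [l ->|->]; rewrite ?yl ?yi// subrr normr0.
  pose E := [set t : R | Omega (y t)].
  have E0 : E (x0 0 i).
    apply: hr; apply: (@le_lt_trans _ _ (r / 2)); last by lra.
    rewrite [leLHS]mx_normrE; apply/bigmax_leP; split; first by lra.
    move=> [u j] _ /=; rewrite ord1; case: (unliftP i j) => [l ->|->].
      have := pab l; rewrite !mxE liftK ler_norml; lra.
    by rewrite [X in `|X|]mxE yi [(- x0) _ _]mxE subrr normr0; lra.
  have supE : has_sup E.
    split; first by exists (x0 0 i).
    exists M => t Et; have := hM _ (@subset_closure _ Omega _ Et).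
    by move=> h; have := le_trans (coord_le_norm _ i) h; rewrite yi => /(le_trans (ler_norm _)).
  exists (y (sup E)); last exact: colE.
  have nE : ~ Omega (y (sup E)).
    move=> OyE; have /nbhs_ballP[e e0 eO] : nbhs (y (sup E)) Omega by exact: open_nbhs_nbhs.
    have : E (sup E + e / 2).
      apply: eO; rewrite -ball_normE /=; apply: le_lt_trans (yd _ _) _.
      by rewrite opprD addrA subrr sub0r normrN gtr0_norm; move: e0 => /= e0; lra.
    by move/(ub_le_sup supE.2); move: e0 => /= e0; lra.
  split; last by rewrite ((interior_id _).1 oO).
  move=> B /nbhs_ballP[e /= e0 eB].
  have [t Et tE] := sup_adherent e0 supE.
  exists (y t); split => //; apply: eB; rewrite -ball_normE /=.
  apply: le_lt_trans (yd _ _) _; have := ub_le_sup supE.2 Et => h.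
  by rewrite ger0_norm ?subr_ge0//; lra.
apply: lt_le_trans (hausdorff_ge_projection i Gamma).
have v0 : 0 < volume a b by apply: prodr_gt0 => l _; rewrite subr_gt0.
apply: mule_gt0; first by rewrite lte_fin divr_gt0 ?hausdorff_const_gt0// exprn_gt0.
apply: (@lt_le_trans _ _ (volume a b)%:E); first by rewrite lte_fin.
by apply: le_trans (volume_le_lebesgue_outer ab) _; exact: le_outer_measure.
Qed.

End SmoothBoundary.

(** * Finite elements *)

Section AffineFunctions.
Context {R : realType} {d : nat}.
Implicit Types (p q : R * 'rV[R]_d) (x y : 'rV[R]_d).

Lemma pevalD p q x : peval (p + q) x = peval p x + peval q x.
Proof. by rewrite /peval /= dotDl addrACA. Qed.

Lemma pevalZ (a : R) p x : peval (a *: p) x = a * peval p x.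
Proof. by rewrite /peval /= dotZl mulrDr. Qed.

Lemma peval0 x : peval (0 : R * 'rV[R]_d) x = 0.
Proof. by rewrite /peval /= dot0l addr0. Qed.

Lemma peval_sum (I : Type) (s : seq I) (P : pred I) (F : I -> R * 'rV[R]_d) x :
  peval (\sum_(i <- s | P i) F i) x = \sum_(i <- s | P i) peval (F i) x.
Proof.
elim: s => [|i s ih]; first by rewrite !big_nil peval0.
by rewrite !big_cons; case: ifP => // _; rewrite pevalD ih.
Qed.

Lemma pevalDr p x y : peval p (x + y) = peval p x + dot p.2 y.
Proof. by rewrite /peval dotDr addrA. Qed.

Lemma dot_sumr (I : Type) (s : seq I) (P : pred I) (F : I -> 'rV[R]_d) x :
  dot x (\sum_(i <- s | P i) F i) = \sum_(i <- s | P i) dot x (F i).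
Proof.
elim: s => [|i s ih]; first by rewrite !big_nil dot0r.
by rewrite !big_cons; case: ifP => // _; rewrite dotDr ih.
Qed.

Lemma peval_affine (I : finType) (c : I -> R) (z : I -> 'rV[R]_d) p :
  \sum_i c i = 1 -> peval p (\sum_i c i *: z i) = \sum_i c i * peval p (z i).
Proof.
move=> c1; rewrite {1}/peval dot_sumr -[p.1]mul1r -{1}c1 mulr_suml -big_split /=.
by apply: eq_bigr => i _; rewrite dotZr mulrDr.
Qed.

Lemma dot_continuous x : continuous (dot x).
Proof.
move=> y; have FF := nbhs_filter y; apply: cvg_big => [|i _]; first exact: add_continuous.
by apply: cvgM; [exact: cvg_cst|exact: coord_continuous].
Qed.

Lemma peval_continuous p : continuous (peval p).
Proof.
move=> y; have FF := nbhs_filter y; apply: cvgD; first exact: cvg_cst.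
exact: dot_continuous.
Qed.

Lemma peval_eq0_ball p x (r : R) : 0 < r ->
  (forall y, enorm (y - x) < r -> peval p y = 0) -> p = 0.
Proof.
move=> r0 h; have px : peval p x = 0 by apply: h; rewrite subrr enorm0.
have p2 : p.2 = 0.
  apply: enorm_eq0; apply: contrapT => /eqP n0.
  have n1 : 0 < enorm p.2 + 1 by rewrite ltr_wpDl ?enorm_ge0.
  pose t := r / 2 / (enorm p.2 + 1); have t0 : 0 < t by rewrite !divr_gt0.
  have := h (x + t *: p.2); rewrite addrAC subrr add0r enormZ gtr0_norm//.
  rewrite pevalDr px add0r dotZr -sqr_enorm => h0.
  have : t * enorm p.2 ^+ 2 = 0.
    apply: h0; have : t * (enorm p.2 + 1) = r / 2 by rewrite /t divfK// gt_eqF.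
    by have := enorm_ge0 p.2; nra.
  by move/eqP; rewrite mulf_eq0 (gt_eqF t0) expf_eq0 (negPf n0).
move: px; rewrite /peval p2 dot0l addr0 => p1.
by case: p p1 p2 {h} => /= a b -> ->.
Qed.

End AffineFunctions.

Section Barycentric.
Context {R : realType} {d : nat}.
Variable M : mesh R d.
Implicit Types (A B : elt M) (p q : R * 'rV[R]_d) (x y : 'rV[R]_d).
Local Notation vert := (@vert R d M).

Definition nondegenerate A : Prop := #|A| = d.+1 /\ affinely_independent A.

Definition barycentric_on A (l : 'I_(nvert M) -> R * 'rV[R]_d) : Prop :=
  forall i j, i \in A -> j \in A -> peval (l i) (vert j) = (i == j)%:R.

(** Homogeneous coordinates (1, x): affine independence of the vertices becomes linear independence
    of the rows of [vmx], and affine functions become columns. *)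
Let homog (x : 'rV[R]_d) : 'rV[R]_d.+1 :=
  \row_c (if unlift ord0 c is Some l then x 0 l else 1).
Let vmx A : 'M[R]_(#|A|, d.+1) := \matrix_(r, c) homog (vert (enum_val r)) 0 c.
Let pcol p : 'cV[R]_d.+1 := \col_c (if unlift ord0 c is Some l then p.2 0 l else p.1).

Let vmx_pcol A p r : (vmx A *m pcol p) r 0 = peval p (vert (enum_val r)).
Proof.
rewrite mxE big_ord_recl !mxE unlift_none mul1r; congr (_ + _).
by apply: eq_bigr => l _; rewrite !mxE liftK mulrC.
Qed.

Let vmx_free A : nondegenerate A -> row_free (vmx A).
Proof.
move=> [cA iA]; rewrite -kermx_eq0; apply/eqP/row_matrixP => r.
rewrite row0; set c := row r _.
have cV : c *m vmx A = 0 by rewrite -row_mul mulmx_ker row0.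
pose c' i := if i \in A then \sum_(s < #|A| | enum_val s == i) c 0 s else 0.
have c'E s : c' (enum_val s) = c 0 s.
  rewrite /c' enum_valP (big_pred1 s)// => t; rewrite /= (inj_eq enum_val_inj).
  by rewrite eq_sym.
have sumE (V : lmodType R) (F : 'I_(nvert M) -> V) :
    \sum_i c' i *: F i = \sum_s c 0 s *: F (enum_val s).
  rewrite (bigID (mem A))/= [X in _ + X]big1 ?addr0; last first.
    by move=> i /negPf iA'; rewrite /c' iA' scale0r.
  by rewrite big_enum_val; apply: eq_bigr => s _; rewrite c'E.
have c'0 : forall i, c' i = 0.
  apply: iA => [i /negPf iA'||]; first by rewrite /c' iA'.
    have := sumE R^o (fun=> 1); rewrite /GRing.scale /=.
    under eq_bigr do rewrite mulr1; move=> ->.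
    transitivity ((c *m vmx A) 0 ord0); last by rewrite cV mxE.
    by rewrite mxE; apply: eq_bigr => s _; rewrite !mxE unlift_none.
  rewrite sumE; apply/rowP => l; rewrite summxE mxE.
  transitivity ((c *m vmx A) 0 (lift ord0 l)); last by rewrite cV mxE.
  by rewrite [RHS]mxE; apply: eq_bigr => s _; rewrite !mxE liftK.
by apply/rowP => s; rewrite -c'E c'0 mxE.
Qed.

Lemma barycentric_exists A : nondegenerate A -> exists l, barycentric_on A l.
Proof.
move=> nA; have /row_freeP[B VB] := vmx_free nA.
pose l (i : 'I_(nvert M)) : R * 'rV[R]_d := if [pick s : 'I_#|A| | enum_val s == i] is Some s
  then (B ord0 s, \row_l B (lift ord0 l) s) else 0.
have lE s : pcol (l (enum_val s)) = col s B.
  rewrite /l; case: pickP => [t /eqP/enum_val_inj ->|/(_ s)]; last by rewrite eqxx.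
  by apply/colP => c; rewrite !mxE; case: (unliftP ord0 c) => [k ->|->]; rewrite ?mxE.
exists l => i j iA jA.
rewrite -(enum_rankK_in iA iA) -(enum_rankK_in iA jA) -vmx_pcol lE colE mulmxA VB mul1mx.
rewrite !mxE eqxx andbT.
by rewrite (inj_eq enum_val_inj) eq_sym.
Qed.

(** With d + 1 independent rows the vertex matrix also has a left inverse, so vertex values
    determine the coefficients. *)
Lemma affine_ext A p q : nondegenerate A ->
  (forall j, j \in A -> peval p (vert j) = peval q (vert j)) -> p = q.
Proof.
move=> nA pq; have [cA _] := nA.
have full : row_full (vmx A).
  by rewrite /row_full; have := vmx_free nA; rewrite /row_free => /eqP ->; rewrite cA.
have [B BV] := row_fullP full.
have pqc : pcol p = pcol q.
  rewrite -[pcol p]mul1mx -[pcol q]mul1mx -BV -!mulmxA; congr (_ *m _).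
  by apply/colP => r; rewrite !vmx_pcol pq// enum_valP.
have e1 : p.1 = q.1 by move/colP/(_ ord0): pqc; rewrite !mxE unlift_none.
have e2 : p.2 = q.2.
  by apply/rowP => l; move/colP/(_ (lift ord0 l)): pqc; rewrite !mxE liftK.
by case: p q e1 e2 {pq pqc} => a b [a' b'] /= -> ->.
Qed.

Definition bary A : 'I_(nvert M) -> R * 'rV[R]_d := xget (fun=> 0) (barycentric_on A).

Lemma baryE A i j : nondegenerate A -> i \in A -> j \in A ->
  peval (bary A i) (vert j) = (i == j)%:R.
Proof. by move=> /barycentric_exists[l lA]; have := xgetPex (fun=> 0) (ex_intro _ l lA); apply. Qed.

Lemma affine_bary A p x : nondegenerate A ->
  peval p x = \sum_(i in A) peval p (vert i) * peval (bary A i) x.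
Proof.
move=> nA; have -> : p = \sum_(i in A) peval p (vert i) *: bary A i.
  apply: (affine_ext nA) => j jA; rewrite peval_sum (bigD1 j)//= pevalZ baryE// eqxx mulr1.
  rewrite big1 ?addr0// => i /andP[iA /negPf ij].
  by rewrite pevalZ baryE// ij mulr0.
rewrite peval_sum; apply: eq_bigr => j jA; rewrite pevalZ; congr (_ * _).
rewrite peval_sum (bigD1 j)//= pevalZ baryE// eqxx mulr1.
rewrite big1 ?addr0// => i /andP[iA /negPf ij].
by rewrite pevalZ baryE// ij mulr0.
Qed.

Lemma bary_sum A x : nondegenerate A -> \sum_(i in A) peval (bary A i) x = 1.
Proof.
move=> nA; have := affine_bary (1, 0) x nA; rewrite {1}/peval dot0l addr0 /= => ->.
by apply: eq_bigr => i _; rewrite /peval /= dot0l addr0 mul1r.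
Qed.

Lemma bary_vert A x : nondegenerate A -> x = \sum_(i in A) peval (bary A i) x *: vert i.
Proof.
move=> nA; apply/rowP => l; rewrite summxE.
have dE y : dot (delta_mx 0 l) y = y 0 l.
  rewrite /dot (bigD1 l)//= mxE !eqxx mul1r big1 ?addr0// => j /negPf jl.
  by rewrite mxE jl mul0r.
have := affine_bary (0, delta_mx 0 l) x nA; rewrite {1}/peval add0r dE => ->.
by apply: eq_bigr => i _; rewrite mxE /peval /= add0r dE mulrC.
Qed.

Lemma bary_coef A (c : 'I_(nvert M) -> R) i : nondegenerate A ->
  (forall i, i \notin A -> c i = 0) -> \sum_i c i = 1 -> i \in A ->
  peval (bary A i) (\sum_j c j *: vert j) = c i.
Proof.
move=> nA cA c1 iA; rewrite peval_affine// (bigD1 i)//= baryE// eqxx mulr1.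
rewrite big1 ?addr0// => j ji; have [jA|jA] := boolP (j \in A); last by rewrite cA// mul0r.
by rewrite baryE// eq_sym (negPf ji) mulr0.
Qed.

Lemma simplexP A x : nondegenerate A ->
  simplex A x <-> forall i, i \in A -> 0 <= peval (bary A i) x.
Proof.
move=> nA; split=> [[c [c0 cA c1 ->]] i iA|h]; first by rewrite bary_coef.
exists (fun i => if i \in A then peval (bary A i) x else 0); split.
- by move=> i; case: ifP => // iA; exact: h.
- by move=> i /negPf ->.
- by rewrite -big_mkcond /= bary_sum.
- rewrite {1}(bary_vert x nA) big_mkcond /=; apply: eq_bigr => i _.
  by case: ifP; rewrite ?scale0r.
Qed.

Lemma vert_simplex A i : i \in A -> simplex A (vert i).
Proof.
move=> iA; exists (fun j => (j == i)%:R); split => //.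
- by move=> j jA; case: eqP => // ji; rewrite ji iA in jA.
- by rewrite (bigD1 i)//= eqxx big1 ?addr0// => j /negPf ->.
- by rewrite (bigD1 i)//= eqxx scale1r big1 ?addr0// => j /negPf ->; rewrite scale0r.
Qed.

Lemma simplex_max A p x (m : R) : 
  (forall j, j \in A -> `|peval p (vert j)| <= m) -> simplex A x -> `|peval p x| <= m.
Proof.
move=> pm [c [c0 cA c1 ->]]; rewrite peval_affine//.
apply: le_trans (ler_norm_sum _ _ _) _; rewrite -[m]mul1r -c1 mulr_suml.
apply: ler_sum => i _; rewrite normrM ger0_norm//.
have [iA|iA] := boolP (i \in A); last by rewrite cA// !mul0r.
by rewrite ler_wpM2l// pm.
Qed.

(** Between the ends x + w and x - w of the diameter of the ball along the gradient, p changes by 2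
    r times the length of the gradient, while both values are at most m in modulus. *)
Lemma gradient_le A p x (m r : R) : 0 < r ->
  (forall y, enorm (y - x) <= r -> simplex A y) ->
  (forall j, j \in A -> `|peval p (vert j)| <= m) -> enorm p.2 <= m / r.
Proof.
move=> r0 xrA pm; rewrite ler_pdivlMr//.
have [->|p0] := eqVneq p.2 0.
  rewrite enorm0 mul0r; apply: le_trans (normr_ge0 (peval p x)) _.
  by apply: simplex_max pm _; apply: xrA; rewrite subrr enorm0 ltW.
have e0 : 0 < enorm p.2.
  by rewrite lt_neqAle enorm_ge0 andbT eq_sym; apply: contra p0 => /eqP/enorm_eq0 ->.
pose w := (r / enorm p.2) *: p.2.
have ew : enorm w = r by rewrite enormZ gtr0_norm ?divr_gt0// divfK// gt_eqF.
have dw : dot p.2 w = enorm p.2 * r.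
  by rewrite dotZr -sqr_enorm; field; rewrite gt_eqF.
have := simplex_max pm (xrA (x + w) _); rewrite addrAC subrr add0r ew => /(_ (lexx _)).
have := simplex_max pm (xrA (x - w) _); rewrite addrAC subrr add0r enormN ew => /(_ (lexx _)).
by rewrite !pevalDr dotNr dw !ler_norml; lra.
Qed.

Lemma simplex_norm_le A x : simplex A x -> `|x| <= \sum_i `|vert i|.
Proof.
move=> [c [c0 cA c1 ->]].
apply: le_trans (ler_norm_sum _ _ _) _; apply: ler_sum => i _.
rewrite normrZ ger0_norm// ler_piMl// -c1 (bigD1 i)//= lerDl.
by apply: sumr_ge0.
Qed.

Lemma simplex_bounded (S : set 'rV[R]_d) : (forall x, S x -> exists A, simplex A x) ->
  bounded_set S.
Proof.
move=> hS; exists (\sum_i `|vert i|); split; first exact: num_real.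
by move=> K hK x /hS[A xA]; apply: le_trans (ltW hK); exact: simplex_norm_le xA.
Qed.

Lemma simplex_closed A : nondegenerate A -> closed (simplex A).
Proof.
move=> nA; have -> : simplex A = \bigcap_(i in [set i | i \in A]) [set x | 0 <= peval (bary A i) x].
  by apply/seteqP; split => x; [move/(simplexP x nA)|move=> h; apply/(simplexP x nA)].
apply: closed_bigI => i _.
apply: (@closed_comp _ _ (fun x => peval (bary A i) x) [set t | 0 <= t]).
  move=> x _; exact: peval_continuous.
exact: closed_ge.
Qed.

End Barycentric.

(** * Number of elements near a point *)

Section Packing.
Context {R : realType} {d : nat}.
Variable M : mesh R d.
Hypothesis nd : forall A, A \in elts M -> nondegenerate A.
Hypothesis simplexI : forall A B, A \in elts M -> B \in elts M ->
  simplex A `&` simplex B = simplex (A :&: B).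

(** For a vertex of A outside B the barycentric coordinate vanishes on the common face, hence on a
    ball, hence identically, although it is 1 at that vertex. *)
Lemma simplex_interior_disjoint (A B : elt M) x (r : R) : A \in elts M -> B \in elts M ->
  0 < r -> (forall y, enorm (y - x) < r -> simplex A y) ->
  (forall y, enorm (y - x) < r -> simplex B y) -> A = B.
Proof.
move=> hA hB r0 xA xB; have [cA _] := nd hA; have [cB _] := nd hB.
suff AB : A \subset B by apply/eqP; rewrite eqEcard AB cA cB leqnn.
apply/fintype.subsetP => i iA; apply: contrapT => /negP iB.
have b0 : bary A i = 0.
  apply: (@peval_eq0_ball R d _ x r r0) => y yx.
  have : (simplex A `&` simplex B) y by split; [exact: xA|exact: xB].
  rewrite simplexI// => -[c [c0 cAB c1 ->]].
  rewrite (bary_coef (nd hA))//.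
    by apply: cAB; rewrite inE (negPf iB) andbF.
  by move=> j jA; apply: cAB; rewrite inE (negPf jA).
by have := baryE (nd hA) iA iA; rewrite b0 peval0 eqxx => /eqP; rewrite eq_sym oner_eq0.
Qed.

(* An element is coded by the cell of a grid of spacing s that contains the centre of its inscribed ball;
   s is so small that the corner of the cell lies in the ball. *)
Lemma packing (S : {set elt M}) (q : 'rV[R]_d) (rho r : R) (K : nat) :
  S \subset elts M -> 0 < rho ->
  (forall A, A \in S -> exists x, (forall y, enorm (y - x) <= rho -> simplex A y) /\
     `|x - q| <= r) ->
  2 * r * (Num.sqrt d%:R + 1) / rho + 1 <= K%:R -> (#|S| <= K ^ d)%N.
Proof.
move=> /fintype.subsetP SM rho0 Sx hK.
have sd : 0 < Num.sqrt d%:R + 1 :> R by rewrite ltr_wpDl ?sqrtr_ge0.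
pose s := rho / (Num.sqrt d%:R + 1); have s0 : 0 < s by rewrite divr_gt0.
have /choice[x hx] : forall A, exists x, A \in S ->
    (forall y, enorm (y - x) <= rho -> simplex A y) /\ `|x - q| <= r.
  by move=> A; have [/Sx[x hx]|nS] := boolP (A \in S); [exists x|exists 0].
have [->|/set0Pn[A0 A0S]] := eqVneq S finset.set0; first by rewrite cards0.
have r0 : 0 <= r by have [_] := hx A0 A0S; exact: le_trans.
have K0 : (0 < K)%N.
  rewrite -(ltr0n R); apply: lt_le_trans hK; rewrite ltr_wpDl//.
  by rewrite divr_ge0 ?mulr_ge0 ?(ltW sd) ?(ltW rho0).
pose z A (l : 'I_d) : nat := Num.truncn ((x A 0 l - q 0 l + r) / s).
have zl A l : A \in S -> (z A l)%:R * s <= x A 0 l - q 0 l + r < (z A l).+1%:R * s /\ (z A l < K)%N.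
  move=> AS; have [_ xq] := hx A AS; have := le_trans (coord_le_norm _ l) xq.
  rewrite !mxE ler_norml => /andP[h1 h2].
  have h0 : 0 <= (x A 0 l - q 0 l + r) / s by rewrite divr_ge0 ?(ltW s0)//; lra.
  have /andP[] := truncn_itv h0; rewrite -/(z A l) => t1 t2; split.
    by rewrite -ler_pdivlMr// t1 -ltr_pdivrMr.
  rewrite -(ltr_nat R); apply: le_lt_trans t1 _; apply: lt_le_trans hK.
  have -> : 2 * r * (Num.sqrt d%:R + 1) / rho = 2 * r / s by rewrite /s invf_div mulrA.
  by apply: (@le_lt_trans _ _ (2 * r / s)); [rewrite ler_pM2r ?invr_gt0//; lra|rewrite ltrDl].
pose code A : {ffun 'I_d -> 'I_K.-1.+1} := [ffun l => inord (z A l)].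
have inj : {in S &, injective code}.
  move=> A B AS BS /ffunP cAB.
  have zAB l : z A l = z B l.
    have [_ zA] := zl A l AS; have [_ zB] := zl B l BS.
    by have := cAB l; rewrite !ffunE => /(congr1 val) /=; rewrite !inordK// prednK.
  have [bA _] := hx A AS; have [bB _] := hx B BS.
  pose w : 'rV[R]_d := \row_l ((z A l)%:R * s + q 0 l - r).
  have wC C : C \in S -> (forall l, z C l = z A l) -> enorm (w - x C) < rho.
    move=> CS zC; apply: le_lt_trans (enorm_le_norm _) _.
    apply: (@le_lt_trans _ _ (Num.sqrt d%:R * s)).
      rewrite ler_wpM2l ?sqrtr_ge0// [leLHS]mx_normrE; apply/bigmax_leP; split; first exact: ltW.
      move=> [u l] _ /=; rewrite ord1 !mxE -zC ler_norml.
      by have [+ _] := zl C l CS; rewrite -natr1; lra.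
    by rewrite /s mulrCA gtr_pMr// ltr_pdivrMr// mul1r ltrDl.
  have wA := wC A AS (fun=> erefl); have wB := wC B BS (fun l => esym (zAB l)).
  pose t := Num.min (rho - enorm (w - x A)) (rho - enorm (w - x B)).
  apply: (@simplex_interior_disjoint A B w t (SM _ AS) (SM _ BS)).
  - by rewrite lt_min !subr_gt0 wA wB.
  - move=> y; rewrite lt_min => /andP[yw _]; apply: bA.
    have := enorm_triangle (y - w) (w - x A); rewrite addrA subrK; lra.
  - move=> y; rewrite lt_min => /andP[_ yw]; apply: bB.
    have := enorm_triangle (y - w) (w - x B); rewrite addrA subrK; lra.
rewrite -(card_in_imset inj); apply: leq_trans (max_card _) _.
by rewrite card_ffun !card_ord prednK.
Qed.

End Packing.

(** * Nodal bases, discrete extension and lumped product *)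

Section FunctionSpaces.
Context {R : realType} {d : nat}.
Variables (Omega : set 'rV[R]_d) (D : cutmesh R d).
Hypothesis nd : forall A, A \in elts D -> nondegenerate A.
Hypothesis simplexI : forall A B, A \in elts D -> B \in elts D ->
  simplex A `&` simplex B = simplex (A :&: B).
Local Notation active := (active Omega D).
Local Notation interior_elts := (interior_elts Omega D).
Local Notation dofs := (dofs Omega D).
Local Notation Vh := (Vh Omega D).
Local Notation VhI := (VhI Omega D).
Local Notation VhE := (VhE Omega D).
Local Notation Eh := (@Eh R d Omega D).
Local Notation ebasis := (@ebasis R d Omega D).
Local Notation vert := (@vert R d D).
Implicit Types (A B : elt D) (u v w : pwlin D) (i j : 'I_(nvert D)).

Lemma active_nd A : A \in active -> nondegenerate A.
Proof. by rewrite inE => /andP[/nd]. Qed.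

Lemma interior_active A : A \in interior_elts -> A \in active.
Proof. by rewrite inE => /andP[]. Qed.

Lemma active_simplexI A B : A \in active -> B \in active ->
  simplex A `&` simplex B = simplex (A :&: B).
Proof. by rewrite !inE => /andP[hA _] /andP[hB _]; exact: simplexI. Qed.

Lemma pwlinE (a : R) u w A : (a *: u + w) A = a *: u A + w A.
Proof. by rewrite !ffunE. Qed.

Lemma pwlin_sumE (I : Type) (s : seq I) (P : pred I) (F : I -> pwlin D) A :
  (\sum_(i <- s | P i) F i) A = \sum_(i <- s | P i) F i A.
Proof. by rewrite sum_ffunE. Qed.

Lemma subspace_Vh : subspace Vh.
Proof.
split; first by split => [A _|A B _ _ x _ _]; rewrite !ffunE.
move=> a u v [Wu Cu] [Wv Cv]; split => [A nA|A B hA hB x xA xB] /=.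
  by rewrite pwlinE Wu// Wv// scaler0 addr0.
by rewrite !pwlinE !pevalD !pevalZ (Cu A B)// (Cv A B).
Qed.

Lemma restr_linear (S : {set elt D}) (a : R) u v :
  restr S (a *: u + v) = a *: restr S u + restr S v.
Proof.
by apply/ffunP => A; rewrite !ffunE; case: ifP => _; rewrite ?ffunE// scaler0 addr0.
Qed.

Lemma subspace_VhI : subspace VhI.
Proof.
split.
  exists 0; first exact: subspace0 subspace_Vh.
  by apply/ffunP => A; rewrite !ffunE; case: ifP.
move=> a _ _ [u Vu <-] [v Vv <-]; exists (a *: u + v); last exact: restr_linear.
exact: subspace_Vh.2.
Qed.

Lemma Eh_linear (a : R) u v : Eh (a *: u + v) = a *: Eh u + Eh v.
Proof.
rewrite /Eh /Ah scaler_sumr -big_split/=; apply: eq_bigr => i _.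
rewrite scalerA -scalerDl; congr (_ *: _).
rewrite /nodal_average mulr_sumr -big_split/=; apply: eq_bigr => A /andP[hA _].
by rewrite /Fh !ffunE hA ?ffunE pevalD pevalZ mulrDr mulrCA.
Qed.

Lemma Eh0 : Eh 0 = 0.
Proof. by have := Eh_linear (-1) 0 0; rewrite scaler0 addr0 scaleN1r addNr. Qed.

Lemma Eh_sum (I : Type) (s : seq I) (P : pred I) (c : I -> R) (F : I -> pwlin D) :
  Eh (\sum_(i <- s | P i) c i *: F i) = \sum_(i <- s | P i) c i *: Eh (F i).
Proof.
elim: s => [|i s ih]; first by rewrite !big_nil Eh0.
by rewrite !big_cons; case: ifP => // _; rewrite Eh_linear ih.
Qed.

Lemma subspace_VhE : subspace VhE.
Proof.
split; first by exists 0; [exact: subspace0 subspace_VhI|exact: Eh0].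
move=> a _ _ [u Vu <-] [v Vv <-]; exists (a *: u + v); last exact: Eh_linear.
exact: subspace_VhI.2.
Qed.

(** An explicit witness that [nodal] chooses from a nonempty set. It is continuous because two
    elements meet in the simplex of their common vertices. *)
Definition hat i : pwlin D := [ffun A => if (A \in active) && (i \in A) then bary A i else 0].

Lemma hatE i A j : A \in active -> j \in A -> peval (hat i A) (vert j) = (i == j)%:R.
Proof.
move=> hA jA; rewrite ffunE hA /=; case: ifPn => iA; first by rewrite baryE//; exact: active_nd.
by rewrite peval0; case: eqP => // ij; rewrite ij jA in iA.
Qed.

Lemma hat_Vh i : Vh (hat i).
Proof.
split=> [A /negPf nA|A B hA hB x xA xB] /=; first by rewrite ffunE nA.
have : (simplex A `&` simplex B) x by [].
rewrite active_simplexI// => -[c [c0 cAB c1 ->]].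
rewrite !peval_affine//; apply: eq_bigr => j _.
have [jAB|jAB] := boolP (j \in A :&: B); last by rewrite cAB// !mul0r.
by move: jAB; rewrite inE => /andP[jA jB]; rewrite !hatE.
Qed.

Lemma nodalE i A j : A \in active -> j \in A ->
  peval (nodal Vh active i A) (vert j) = (i == j)%:R.
Proof.
have := xgetPex (0 : pwlin D) (ex_intro (Vh `&` [set w | forall A, A \in active ->
    forall j, j \in A -> peval (w A) (vert j) = (i == j)%:R]) (hat i) _).
by case=> [|_ h]; [split; [exact: hat_Vh|move=> B hB k kB; exact: hatE]|move=> hA jA; exact: (h A hA j jA)].
Qed.

Lemma nodal_Vh i : Vh (nodal Vh active i).
Proof.
have := xgetPex (0 : pwlin D) (ex_intro (Vh `&` [set w | forall A, A \in active ->
    forall j, j \in A -> peval (w A) (vert j) = (i == j)%:R]) (hat i) _).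
by case=> //; split; [exact: hat_Vh|move=> B hB k kB; exact: hatE].
Qed.

Lemma nodal_VhIP i : VhI (nodal VhI interior_elts i) /\
  forall A, A \in interior_elts -> forall j, j \in A ->
    peval (nodal VhI interior_elts i A) (vert j) = (i == j)%:R.
Proof.
have := xgetPex (0 : pwlin D) (ex_intro (VhI `&` [set w | forall A, A \in interior_elts ->
    forall j, j \in A -> peval (w A) (vert j) = (i == j)%:R]) (restr interior_elts (hat i)) _).
apply; split; first by exists (hat i) => //; exact: hat_Vh.
by move=> A hA j jA; rewrite ffunE hA hatE//; exact: interior_active.
Qed.

Lemma Eh_Vh u : Vh (Eh u).
Proof.
apply: (subspace_sum subspace_Vh) => i _; apply: (subspaceZ subspace_Vh).
exact: nodal_Vh.
Qed.

Lemma VhE_Vh v : VhE v -> Vh v.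
Proof. by case=> u _ <-; exact: Eh_Vh. Qed.

Lemma Eh_vert u A j : A \in active -> j \in A ->
  peval (Eh u A) (vert j) = nodal_average Omega (Fh Omega u) j.
Proof.
move=> hA jA; rewrite /Eh /Ah pwlin_sumE peval_sum.
have jv : j \in verts active by apply/bigcupP; exists A.
rewrite (bigD1 j)//= ffunE pevalZ nodalE// eqxx mulr1 big1 ?addr0// => i /andP[_ /negPf ij].
by rewrite ffunE pevalZ nodalE// ij mulr0.
Qed.

Lemma ebasis_VhE i : VhE (ebasis i).
Proof. by exists (nodal VhI interior_elts i) => //; case: (nodal_VhIP i). Qed.

Lemma VhI_expand u : VhI u -> exists c : 'I_(nvert D) -> R,
  (forall A j, A \in interior_elts -> j \in A -> peval (u A) (vert j) = c j) /\
  u = \sum_(i in dofs) c i *: nodal VhI interior_elts i.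
Proof.
move=> [w [Ww Cw] <-].
pose c i := if [pick A in interior_elts | i \in A] is Some A then peval (w A) (vert i) else 0.
have cE A j : A \in interior_elts -> j \in A -> peval (restr interior_elts w A) (vert j) = c j.
  move=> hA jA; rewrite ffunE hA /c; case: pickP => [B /andP[hB jB]|/(_ A)]; last by rewrite hA jA.
  by apply: Cw; [exact: interior_active|exact: interior_active|exact: vert_simplex|exact: vert_simplex].
exists c; split => //; apply/ffunP => A; rewrite pwlin_sumE.
have [hA|hA] := boolP (A \in interior_elts); last first.
  rewrite ffunE (negPf hA) big1// => i _; rewrite ffunE.
  have [[w' _ <-] _] := nodal_VhIP i.
  by rewrite ffunE (negPf hA) scaler0.
apply: (affine_ext (active_nd (interior_active hA))) => j jA; rewrite cE// peval_sum.
have jd : j \in dofs by apply/bigcupP; exists A.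
rewrite (bigD1 j)//= ffunE pevalZ (nodal_VhIP j).2// eqxx mulr1 big1 ?addr0// => i /andP[_ /negPf ij].
by rewrite ffunE pevalZ (nodal_VhIP i).2// ij mulr0.
Qed.

Hypothesis free : ebasis_free Omega D.

Lemma ecoef_unique (c : {ffun 'I_(nvert D) -> R}) v : (forall i, i \notin dofs -> c i = 0) ->
  v = \sum_(i in dofs) c i *: ebasis i -> ecoef Omega v = c.
Proof.
move=> c0 vE; apply: xget_unique; first by split.
move=> c' [c'0 vE']; apply/ffunP => i.
have [idf|idf] := boolP (i \in dofs); last by rewrite c0// c'0.
apply/eqP; rewrite -subr_eq0; apply/eqP; apply: (free (c := fun i => c' i - c i)) => //.
under eq_bigr do rewrite scalerBl.
by rewrite sumrB -vE -vE' subrr.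
Qed.

Lemma ecoefP v : VhE v -> (forall i, i \notin dofs -> ecoef Omega v i = 0) /\
  v = \sum_(i in dofs) ecoef Omega v i *: ebasis i.
Proof.
move=> [u Vu <-]; have [c [_ uE]] := VhI_expand Vu.
have : exists c, [set c : {ffun 'I_(nvert D) -> R} | (forall i, i \notin dofs -> c i = 0) /\
                     Eh u = \sum_(i in dofs) c i *: ebasis i] c.
  exists [ffun i => if i \in dofs then c i else 0]; split.
    by move=> i /negPf hi; rewrite ffunE hi.
  rewrite {1}uE Eh_sum; apply: eq_bigr => i hi; by rewrite ffunE hi.
by move=> /(xgetPex [ffun=> 0]) hc; have := xgetPex 0 (ex_intro _ _ hc); apply.
Qed.

Lemma ecoef_linear (a : R) u v i : VhE u -> VhE v ->
  ecoef Omega (a *: u + v) i = a * ecoef Omega u i + ecoef Omega v i.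
Proof.
move=> Vu Vv; have [u0 uE] := ecoefP Vu; have [v0 vE] := ecoefP Vv.
rewrite (@ecoef_unique [ffun i => a * ecoef Omega u i + ecoef Omega v i]) ?ffunE//.
  by move=> j jd; rewrite ffunE u0// v0// mulr0 addr0.
rewrite {1}uE {1}vE scaler_sumr -big_split /=; apply: eq_bigr => j _.
by rewrite ffunE scalerA scalerDl.
Qed.

(** The freeness of the basis lets nodal values of u be read as coefficients of [Eh u]; this links
    element values to the lumped norm. *)
Lemma ecoef_vert u A j : VhI u -> A \in interior_elts -> j \in A ->
  peval (u A) (vert j) = ecoef Omega (Eh u) j.
Proof.
move=> Vu hA jA; have [c [cE uE]] := VhI_expand Vu; rewrite cE//.
rewrite (@ecoef_unique [ffun i => if i \in dofs then c i else 0]).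
- by rewrite ffunE; case: ifPn => // /negP[]; apply/bigcupP; exists A.
- by move=> i /negPf hi; rewrite ffunE hi.
- by rewrite {1}uE Eh_sum; apply: eq_bigr => i hi; rewrite ffunE hi.
Qed.

Lemma lumped_inner_product : (forall i, i \in dofs -> 0 < lumped_mass Omega D i) ->
  inner_product_on VhE (ip_lumped Omega D).
Proof.
move=> m0; split.
- move=> w Vw a u v Vu Vv; rewrite /ip_lumped mulr_sumr -big_split/=.
  by apply: eq_bigr => i _; rewrite ecoef_linear//; ring.
- by move=> u v _ _; apply: eq_bigr => i _; rewrite mulrAC.
- move=> u _; apply: sumr_ge0 => i hi; rewrite -mulrA -expr2.
  by rewrite mulr_ge0 ?sqr_ge0// ltW// m0.
- move=> u Vu /eqP; rewrite psumr_eq0 => [/allP h|i hi]; last first.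
    by rewrite -mulrA -expr2 mulr_ge0 ?sqr_ge0// ltW// m0.
  have [_ ->] := ecoefP Vu; rewrite big1// => i hi.
  have := h i (mem_index_enum i); rewrite hi /= -mulrA mulf_eq0 (gt_eqF (m0 i hi)) /= mulf_eq0 orbb.
  by move=> /eqP ->; rewrite scale0r.
Qed.

(** The basis is reindexed by an ordinal, the form that the Gram matrix of [ip_riesz] requires. *)
Lemma ebasis_enum : exists e : 'I_#|dofs| -> pwlin D, [/\ forall s, VhE (e s),
  forall c : 'I_#|dofs| -> R, \sum_s c s *: e s = 0 -> forall s, c s = 0
  & forall v, VhE v -> exists c : 'I_#|dofs| -> R, v = \sum_s c s *: e s].
Proof.
exists (fun s => ebasis (enum_val s)); split=> [s|c c0 s|v Vv]; first exact: ebasis_VhE.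
  pose c' i := \sum_(t | enum_val t == i) c t.
  have c'E t : c' (enum_val t) = c t.
    by rewrite /c' (big_pred1 t)// => q; rewrite /= (inj_eq enum_val_inj) eq_sym.
  rewrite -c'E; apply: (free (c := c')); last exact: enum_valP.
  by rewrite big_enum_val -[RHS]c0; apply: eq_bigr => t _; rewrite c'E.
have [_ vE] := ecoefP Vv; exists (fun s => ecoef Omega v (enum_val s)).
by rewrite {1}vE big_enum_val.
Qed.

End FunctionSpaces.

(** * Elementwise bounds by nearby coefficients *)

Section DiscreteBounds.
Context {R : realType} {d : nat}.
Variables (Omega : set 'rV[R]_d) (D : cutmesh R d) (sigma C h : R).
Hypothesis nd : forall A, A \in elts D -> nondegenerate A.
Hypothesis simplexI : forall A B, A \in elts D -> B \in elts D ->
  simplex A `&` simplex B = simplex (A :&: B).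
Hypothesis free : ebasis_free Omega D.
Hypotheses (sigma0 : 0 < sigma) (h0 : 0 < h).
Hypothesis reg : forall A, A \in elts D -> diam (simplex A) <= sigma * h /\
  exists x, forall y, enorm (y - x) <= sigma^-1 * h -> simplex A y.
Hypothesis em : element_map Omega D C h.
Hypothesis aw : averaging_weights Omega D.
Local Notation active := (active Omega D).
Local Notation interior_elts := (interior_elts Omega D).
Local Notation dofs := (dofs Omega D).
Local Notation VhE := (VhE Omega D).
Local Notation vert := (@vert R d D).
Implicit Types (A B : elt D) (u v w : pwlin D) (i j : 'I_(nvert D)).

(** C bounds the distance to [smap A] for cut elements; for interior ones [smap A] is A itself, of
    diameter at most sigma h. The maximum is positive whatever C is. *)
Let C1_ := Num.max C sigma.
Let C10 : 0 < C1_. Proof. by rewrite lt_max sigma0 orbT. Qed.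

Definition near_vertex A i : bool := [exists j in A, enorm (vert i - vert j) <= C1_ * h].

Definition local_norm2 (c : 'I_(nvert D) -> R) A : R := \sum_(i in dofs | near_vertex A i) c i ^+ 2.

Lemma local_norm2_ge0 c A : 0 <= local_norm2 c A.
Proof. by apply: sumr_ge0 => i _; exact: sqr_ge0. Qed.

Let bndd A : bounded_set (simplex A).
Proof. by apply: simplex_bounded => x xA; exists A. Qed.

Lemma smap_near A j i : A \in active -> j \in A -> i \in smap A ->
  enorm (vert i - vert j) <= C1_ * h.
Proof.
move=> hA jA iA; case: em => _ smapI smapB.
have [hI|hI] := boolP (A \in interior_elts).
  rewrite smapI// in iA; have hE : A \in elts D by move: hA; rewrite inE => /andP[].
  apply: le_trans (enorm_le_diam (bndd A) (vert_simplex iA) (vert_simplex jA)) _.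
  apply: le_trans (reg hE).1 _; by rewrite ler_pM2r// le_max lexx orbT.
have hc : A \in cut_elts Omega D by rewrite inE hI.
apply: le_trans (_ : C * h <= _); last by rewrite ler_pM2r// le_max lexx.
apply: le_trans (smapB _ hc); apply: enorm_le_diam.
- by apply: (@simplex_bounded R d D) => x [xA|xA]; [exists A|exists (smap A)].
- by right; exact: vert_simplex.
- by left; exact: vert_simplex.
Qed.

(** Cost of extending an affine function from [smap A]: a vertex value, plus a gradient of size
    sigma/h over a distance [C1_ * h]. *)
Definition stab_const : R := 1 + sigma * C1_.

(** The vertex value is a convex combination of extended values, and every element sharing the
    vertex j draws on coefficients within [C1_ * h] of j, hence near A. *)
Lemma vertex_bound v A j : VhE v -> A \in active -> j \in A ->
  `|peval (v A) (vert j)| <= stab_const * Num.sqrt (local_norm2 (ecoef Omega v) A).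
Proof.
move=> [u Vu <-] hA jA; rewrite (Eh_vert nd simplexI u hA jA).
have jv : j \in verts active by apply/bigcupP; exists A.
have [k0 k1] := aw jv; set N := Num.sqrt _; have N0 : 0 <= N := sqrtr_ge0 _.
have cN i : i \in dofs -> near_vertex A i -> `|ecoef Omega (Eh Omega u) i| <= N.
  move=> hi ni; rewrite -sqrtr_sqr ler_wsqrtr// /local_norm2 (bigD1 i) ?hi//= lerDl.
  by apply: sumr_ge0 => k _; exact: sqr_ge0.
have bound B : B \in active -> j \in B -> `|peval (Fh Omega u B) (vert j)| <= stab_const * N.
  move=> hB jB; rewrite ffunE hB; case: (em) => smI _ _; have hS := smI _ hB.
  have hSE : smap B \in elts D by move: hS; rewrite !inE => /andP[/andP[]].
  have uN i : i \in smap B -> `|peval (u (smap B)) (vert i)| <= N.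
    move=> iS; rewrite (ecoef_vert nd simplexI free Vu hS iS); apply: cN.
      by apply/bigcupP; exists (smap B).
    by apply/existsP; exists j; rewrite jA /=; exact: smap_near jB iS.
  have [_ [x xS]] := reg hSE.
  have r0 : 0 < sigma^-1 * h by rewrite mulr_gt0 ?invr_gt0.
  have gN := gradient_le r0 xS uN.
  have /set0Pn[i iS] : smap B != finset.set0 by rewrite -card_gt0 (nd hSE).1.
  rewrite -(subrK (vert i) (vert j)) addrC pevalDr; apply: le_trans (ler_normD _ _) _.
  rewrite /stab_const mulrDl mul1r lerD ?uN//.
  apply: le_trans (dot_le_enorm _ _) _; rewrite enormB.
  apply: le_trans (ler_pM (enorm_ge0 _) (enorm_ge0 _) gN (smap_near hB jB iS)) _.
  by rewrite le_eqVlt; apply/orP; left; apply/eqP; field; rewrite !gt_eqF.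
apply: le_trans (ler_norm_sum _ _ _) _.
rewrite -[leRHS]mul1r -k1 mulr_suml; apply: ler_sum => B /andP[hB jB].
by rewrite normrM ger0_norm ?k0// ler_wpM2l ?k0// bound.
Qed.

Lemma value_bound v A x : VhE v -> A \in active -> simplex A x ->
  peval (v A) x ^+ 2 <= stab_const ^+ 2 * local_norm2 (ecoef Omega v) A.
Proof.
move=> Vv hA xA; rewrite -real_normK ?num_real//.
rewrite -[X in _ * X]sqr_sqrtr ?local_norm2_ge0// -exprMn lerXn2r ?nnegrE//.
  by rewrite mulr_ge0 ?sqrtr_ge0// addr_ge0// mulr_ge0// ltW.
by apply: (simplex_max _ xA) => j jA; exact: vertex_bound.
Qed.

Lemma gradient_bound v A : VhE v -> A \in active ->
  enorm (v A).2 ^+ 2 <= (sigma / h * stab_const) ^+ 2 * local_norm2 (ecoef Omega v) A.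
Proof.
move=> Vv hA; have hE : A \in elts D by move: hA; rewrite inE => /andP[].
have [_ [x xA]] := reg hE.
have r0 : 0 < sigma^-1 * h by rewrite mulr_gt0 ?invr_gt0.
have := gradient_le r0 xA (fun j => @vertex_bound v A j Vv hA) => g.
rewrite -[X in _ * X]sqr_sqrtr ?local_norm2_ge0// -exprMn lerXn2r ?nnegrE ?enorm_ge0//.
  rewrite !mulr_ge0 ?sqrtr_ge0 ?invr_ge0 ?(ltW sigma0) ?(ltW h0)//.
  by rewrite addr_ge0// mulr_ge0// ltW.
apply: le_trans g _; rewrite le_eqVlt; apply/orP; left; apply/eqP.
by field; rewrite !gt_eqF.
Qed.

(** After exchanging the sums, a coefficient is counted once per element near its vertex. Packing
    bounds that number with balls of radius h / sigma centred within (sigma + C1) h, so h cancels in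
    the condition on K. *)
Lemma sum_local_norm2 (c : 'I_(nvert D) -> R) (K : nat) :
  2 * (sigma + C1_) * sigma * (Num.sqrt d%:R + 1) + 1 <= K%:R ->
  \sum_(A in active) local_norm2 c A <= (K ^ d)%:R * \sum_(i in dofs) c i ^+ 2.
Proof.
move=> hK; rewrite /local_norm2.
under eq_bigr do rewrite big_mkcondr /=.
rewrite exchange_big /= mulr_sumr; apply: ler_sum => i _.
rewrite -big_mkcondr /= sumr_const -[leLHS]mulr_natl ler_wpM2r ?sqr_ge0// ler_nat.
pose S := [set A in active | near_vertex A i].
have -> : #|[pred A in active | near_vertex A i]| = #|S|.
  by apply: eq_card => A; rewrite !inE.
apply: (@packing R d D nd simplexI S (vert i) (sigma^-1 * h) ((sigma + C1_) * h)).
- by apply/fintype.subsetP => A; rewrite !inE => /andP[/andP[]].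
- by rewrite mulr_gt0 ?invr_gt0.
- move=> A; rewrite inE => /andP[hA /existsP[j /andP[jA ij]]].
  have hE : A \in elts D by move: hA; rewrite inE => /andP[].
  have [dA [x xA]] := reg hE; exists x; split => //.
  apply: le_trans (norm_le_enorm _) _.
  have -> : x - vert i = (x - vert j) + (vert j - vert i) by rewrite addrA subrK.
  apply: le_trans (enorm_triangle _ _) _; rewrite mulrDl lerD//; last by rewrite enormB.
  apply: le_trans dA; apply: enorm_le_diam; [exact: bndd| |exact: vert_simplex].
  by apply: xA; rewrite subrr enorm0 mulr_ge0 ?invr_ge0 ?ltW.
- apply: le_trans hK; rewrite le_eqVlt; apply/orP; left; apply/eqP.
  by congr (_ + 1); field; rewrite !gt_eqF.
Qed.

End DiscreteBounds.

(** * Integrals of piecewise linear functions *)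

Section BoundedMeasurable.
Context (disp : measure_display) (T : measurableType disp) (R : realType).
Variables (mu : {measure set T -> \bar R}) (D : set T).
Hypotheses (mD : measurable D) (Dfin : (mu D < +oo)%E).
Implicit Types (f g : T -> R) (E : set T).

(** On a set of finite measure this class consists of integrable functions and, unlike
    integrability, is closed under products. *)
Definition bounded_measurable f : Prop :=
  measurable_fun D f /\ exists M, forall x, D x -> `|f x| <= M.
Local Notation bm := bounded_measurable.

Lemma bm_integrable f : bm f -> mu.-integrable D (EFin \o f).
Proof.
move=> [mf [M fM]]; apply: measurable_bounded_integrable => //.
exists M; split; first exact: num_real.
by move=> K MK x /fM /le_trans; apply; exact: ltW.
Qed.

Lemma bm_eq f g : (forall x, D x -> f x = g x) -> bm g -> bm f.
Proof.
move=> fg [mg [M gM]]; split; last by exists M => x Dx; rewrite fg//; exact: gM.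
by apply: eq_measurable_fun mg => x /set_mem Dx; rewrite fg.
Qed.

Lemma bm_cst (c : R) : bm (fun=> c).
Proof. by split; [exact: measurable_cst|exists `|c|]. Qed.

Lemma bm_add f g : bm f -> bm g -> bm (fun x => f x + g x).
Proof.
move=> [mf [M fM]] [mg [N gN]]; split; first exact: measurable_funD.
exists (M + N) => x Dx; apply: le_trans (ler_normD _ _) _.
by rewrite lerD ?fM ?gN.
Qed.

Lemma bm_mul f g : bm f -> bm g -> bm (fun x => f x * g x).
Proof.
move=> [mf [M fM]] [mg [N gN]]; split; first exact: measurable_funM.
by exists (M * N) => x Dx; rewrite normrM ler_pM ?fM ?gN.
Qed.

Lemma bm_sum (I : Type) (s : seq I) (F : I -> T -> R) : (forall i, bm (F i)) ->
  bm (fun x => \sum_(i <- s) F i x).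
Proof.
move=> bF; elim: s => [|i s ih].
  by apply: (bm_eq _ (bm_cst 0)) => x _; rewrite big_nil.
by apply: (bm_eq _ (bm_add (bF i) ih)) => x _; rewrite big_cons.
Qed.

Lemma bm_indic E : measurable (D `&` E) -> bm (fun x => (`[< E x >])%:R).
Proof.
move=> mE; apply: (@bm_eq _ (\1_(D `&` E))).
  by move=> x Dx; rewrite indicE in_setI (mem_set Dx).
split; first exact: measurable_indic.
by exists 1 => x _; rewrite indicE; case: (_ \in _); rewrite ?normr1 ?normr0 ?ler01.
Qed.

Let bm_pick_all (J : finType) (P : pred J) (Q : J -> set T) (F : J -> T -> R) :
  (forall A, measurable (D `&` Q A)) -> (forall A, bm (F A)) ->
  bm (fun x => if [pick A | P A && `[< Q A x >]] is Some A then F A x else 0).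
Proof.
move=> mQ bF.
(* The pattern b records which [Q A] contain x. The picked index is constant on the set of one
   pattern, so the function is a finite sum over patterns. *)
pose V (b : {ffun J -> bool}) := [set x | forall A, `[< Q A x >] = b A].
have mV b : measurable (D `&` V b).
  have -> : D `&` V b = D `&` \bigcap_(A in [set: J]) (if b A then D `&` Q A else D `\` (D `&` Q A)).
    apply/seteqP; split => x [Dx h]; split => // A.
      by move=> _; have := h A; case: (b A) => /asboolP hA; split => // -[].
    by have := h A Logic.I; case: (b A) => -[_ hA]; apply/asboolP => // Qx; exact: hA.
  apply: measurableI => //; apply: fin_bigcap_measurable; first exact: finite_finset.
  by move=> A _; case: ifP => _ //; exact: measurableD.
pose G (b : {ffun J -> bool}) x := if [pick A | P A && b A] is Some A then F A x else 0.
have bG b : bm (G b) by rewrite /G; case: pickP => [A _|_]; [exact: bF|exact: bm_cst].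
apply: (bm_eq _ (bm_sum (index_enum {ffun J -> bool}) (fun b => bm_mul (bm_indic (mV b)) (bG b)))).
move=> x Dx; pose b := [ffun A => `[< Q A x >]].
rewrite (bigD1 b)//= asboolT; last by move=> A; rewrite ffunE.
rewrite mul1r big1 ?addr0 => [|b' /eqP b'b]; last first.
  rewrite asboolF ?mul0r// => h; apply: b'b; apply/ffunP => A.
  by rewrite ffunE h.
by rewrite /G; under [in RHS]eq_pick do rewrite ffunE.
Qed.

Lemma bm_pick (J : finType) (P : pred J) (Q : J -> set T) (F : J -> T -> R) :
  (forall A, P A -> measurable (D `&` Q A)) -> (forall A, bm (F A)) ->
  bm (fun x => if [pick A | P A && `[< Q A x >]] is Some A then F A x else 0).
Proof.
move=> mQ bF; pose Q' A := if P A then Q A else set0.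
apply: (bm_eq _ (@bm_pick_all J P Q' F _ bF)) => [x _|A]; last first.
  by rewrite /Q'; case: ifPn => [/mQ//|_]; rewrite setI0; exact: measurable0.
rewrite (@eq_pick _ _ [pred A | P A && `[< Q' A x >]])// => A /=.
by rewrite /Q'; case: (P A).
Qed.

Lemma Rintegral_linear (a : R) f g : bm f -> bm g ->
  \int[mu]_(x in D) (a * f x + g x) = a * \int[mu]_(x in D) f x + \int[mu]_(x in D) g x.
Proof.
move=> bf bg; have baf := bm_mul (bm_cst a) bf.
by rewrite RintegralD ?RintegralZl//; exact: bm_integrable.
Qed.

Lemma Rintegral_indic E : measurable (D `&` E) ->
  \int[mu]_(x in D) (`[< E x >])%:R = fine (mu (D `&` E)).
Proof.
move=> mE; rewrite (@eq_Rintegral _ _ _ mu D (\1_(D `&` E))).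
  rewrite /Rintegral integral_indic//; congr (fine (mu _)).
  by rewrite setIC setIA setIid.
by move=> x Dx; rewrite indicE in_setI Dx.
Qed.

Lemma Rintegral_step_le (J : finType) (P : pred J) (S : J -> set T) (M : J -> R) f :
  bm f -> (forall A, P A -> measurable (D `&` S A)) ->
  (forall x, D x -> f x <= \sum_(A | P A) M A * (`[< S A x >])%:R) ->
  \int[mu]_(x in D) f x <= \sum_(A | P A) M A * fine (mu (D `&` S A)).
Proof.
move=> bf mS fM.
have bS (s : seq J) : bm (fun x => \sum_(A <- s | P A) M A * (`[< S A x >])%:R) /\
    \int[mu]_(x in D) (\sum_(A <- s | P A) M A * (`[< S A x >])%:R) =
    \sum_(A <- s | P A) M A * fine (mu (D `&` S A)).
  elim: s => [|A s [b ih]].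
    under eq_Rintegral do rewrite big_nil; rewrite Rintegral_cst// mul0r big_nil; split => //.
    by apply: (bm_eq _ (bm_cst 0)) => x _; rewrite big_nil.
  have [PA|PA] := boolP (P A); last first.
    under eq_Rintegral do rewrite big_cons (negPf PA).
    rewrite big_cons (negPf PA); split => //.
    by apply: bm_eq b => x _; rewrite big_cons (negPf PA).
  have bA := bm_indic (mS A PA).
  under eq_Rintegral do rewrite big_cons PA.
  split; last by rewrite (Rintegral_linear (M A) bA b) ih (Rintegral_indic (mS A PA)) big_cons PA.
  apply: (bm_eq _ (bm_add (bm_mul (bm_cst (M A)) bA) b)) => x _.
  by rewrite big_cons PA.
have [b <-] := bS (index_enum J).
by apply: le_Rintegral => //; exact: bm_integrable.
Qed.

Lemma Rintegral_ge_indic (c : R) E f : bm f -> measurable (D `&` E) ->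
  (forall x, D x -> c * (`[< E x >])%:R <= f x) ->
  c * fine (mu (D `&` E)) <= \int[mu]_(x in D) f x.
Proof.
move=> bf mE cf; have bE := bm_indic mE.
rewrite -Rintegral_indic// -RintegralZl//; last exact: bm_integrable.
apply: le_Rintegral => //; apply: bm_integrable => //.
exact: bm_mul (bm_cst c) bE.
Qed.

End BoundedMeasurable.

Section CaratheodoryIntegral.
Context (R : realType) (T : pointedType).
Variables (mu : {outer_measure set T -> \bar R}) (D : set T).
Hypotheses (mD : measurable (D : set (caratheodory_type mu))) (Dfin : (mu D < +oo)%E).
Local Notation bm := (bounded_measurable (D : set (caratheodory_type mu))).
Local Notation mes := (mu : {measure set (caratheodory_type mu) -> \bar R}).
Implicit Types (f g : T -> R) (E : set T).

Lemma ointegral_linear (a : R) f g : bm f -> bm g ->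
  ointegral mu D (fun x => a * f x + g x) = a * ointegral mu D f + ointegral mu D g.
Proof. exact: (@Rintegral_linear _ _ _ mes D mD Dfin). Qed.

Lemma ointegral_ge0 f : (forall x, D x -> 0 <= f x) -> 0 <= ointegral mu D f.
Proof. exact: (@Rintegral_ge0 _ _ _ mes D). Qed.

Lemma ointegral_step_le (J : finType) (P : pred J) (S : J -> set T) (M : J -> R) f :
  bm f -> (forall A, P A -> measurable (D `&` S A : set (caratheodory_type mu))) ->
  (forall x, D x -> f x <= \sum_(A | P A) M A * (`[< S A x >])%:R) ->
  ointegral mu D f <= \sum_(A | P A) M A * fine (mu (D `&` S A)).
Proof. exact: (@Rintegral_step_le _ _ _ mes D mD Dfin). Qed.

Lemma ointegral_ge_indic (c : R) E f : bm f ->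
  measurable (D `&` E : set (caratheodory_type mu)) ->
  (forall x, D x -> c * (`[< E x >])%:R <= f x) ->
  c * fine (mu (D `&` E)) <= ointegral mu D f.
Proof. exact: (@Rintegral_ge_indic _ _ _ mes D mD Dfin). Qed.

End CaratheodoryIntegral.

Section BorelBounded.
Context {R : realType} {d : nat}.
Variables (mu : {outer_measure set 'rV[R]_d -> \bar R}) (D : set 'rV[R]_d) (M : R).
Hypothesis halfspace : forall (i : 'I_d) t, mu.-caratheodory [set x | x 0 i <= t].
Hypothesis mD : measurable (D : set (caratheodory_type mu)).
Hypothesis DM : forall x, D x -> `|x| <= M.

Lemma bm_peval (p : R * 'rV[R]_d) :
  bounded_measurable (D : set (caratheodory_type mu)) (peval p).
Proof.
split; first by apply: continuous_caratheodory => //; exact: peval_continuous.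
exists (`|p.1| + enorm p.2 * (Num.sqrt d%:R * M)) => x Dx.
apply: le_trans (ler_normD _ _) _; rewrite lerD2l.
apply: le_trans (dot_le_enorm _ _) _; rewrite ler_wpM2l ?enorm_ge0//.
apply: le_trans (enorm_le_norm _) _; rewrite ler_wpM2l ?sqrtr_ge0//; exact: DM.
Qed.

Lemma bm_simplex_pick (N : mesh R d) (P : pred (elt N)) (F : elt N -> 'rV[R]_d -> R) :
  (forall A, P A -> nondegenerate A) ->
  (forall A, bounded_measurable (D : set (caratheodory_type mu)) (F A)) ->
  bounded_measurable (D : set (caratheodory_type mu))
    (fun x => if [pick A | P A && (x \in simplex A)] is Some A then F A x else 0).
Proof.
move=> nd bF; apply: bm_pick => // A /nd nA; apply: measurableI => //.
by apply: closed_caratheodory => //; exact: simplex_closed.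
Qed.

End BorelBounded.

(** * Measurable integrands and bilinearity of the Nitsche form *)

Section Nitsche.
Context {R : realType} {d : nat}.
Variables (Omega : set 'rV[R]_d) (D : cutmesh R d).
Hypothesis sO : smooth_domain Omega.
Hypothesis nd : forall A, A \in elts D -> nondegenerate A.
Local Notation active := (active Omega D).
Local Notation Gamma := (frontier Omega).
Local Notation normal := (exterior_unit_normal Omega).
Local Notation val_at := (@val_at R d Omega D).
Local Notation grad_at := (@grad_at R d Omega D).
Local Notation normal_derivative := (@normal_derivative R d Omega D).
Local Notation lebesgue := (caratheodory_type (@lebesgue_outer R d)).
Local Notation hausdorff := (caratheodory_type (@hausdorff_outer R d d.-1)).
Local Notation bmO := (bounded_measurable (Omega : set lebesgue)).
Local Notation bmG := (bounded_measurable (Gamma : set hausdorff)).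
Implicit Types (A : elt D) (u v w : pwlin D) (x : 'rV[R]_d).

Lemma measurable_Omega : measurable (Omega : set lebesgue).
Proof. by apply: open_caratheodory; [exact: lebesgue_halfspace|case: sO]. Qed.

Lemma measurable_Gamma : measurable (Gamma : set hausdorff).
Proof.
by apply: closed_caratheodory; [exact: hausdorff_halfspace|exact: frontier_closed].
Qed.

Lemma Omega_fin : (lebesgue_outer Omega < +oo)%E.
Proof.
have [M hM] := frontier_bounded sO.
have [x Ox] : Omega !=set0 by case: sO.
have M0 : 0 <= M by apply: le_trans (hM x _) => //; exact: subset_closure.
apply: (@le_lt_trans _ _ (volume (const_mx (- M)) (const_mx M) : R)%:E); last exact: ltry.
apply: lebesgue_outer_le_volume => [i|y Oy i]; rewrite !mxE; first lra.
rewrite -ler_norml; apply: le_trans (coord_le_norm _ _) _; apply: hM; exact: subset_closure.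
Qed.

(** Both factors pick the same element, so the product is a single pick, the form treated by
    [bm_simplex_pick]. *)
Lemma dot_grad_atE u v x : dot (grad_at u x) (grad_at v x) =
  if [pick A in active | x \in simplex A] is Some A then dot (u A).2 (v A).2 else 0.
Proof. by rewrite /grad_at; case: pickP => // _; rewrite dot0l. Qed.

Lemma bmO_grad u v : bmO (fun x => dot (grad_at u x) (grad_at v x)).
Proof.
rewrite (funext (dot_grad_atE u v)).
apply: (bm_simplex_pick (@lebesgue_halfspace R d) measurable_Omega
  (F := fun A _ => dot (u A).2 (v A).2)) => A; first exact: active_nd.
exact: bm_cst.
Qed.

Lemma bmG_val v : bmG (val_at v).
Proof.
have [M hM] := frontier_bounded sO.
apply: (bm_simplex_pick (@hausdorff_halfspace R d d.-1) measurable_Gamma) => A; first exact: active_nd.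
apply: (@bm_peval _ _ _ _ M) => //; [exact: hausdorff_halfspace|exact: measurable_Gamma|].
by move=> x [cx _]; exact: hM.
Qed.

Lemma normal_unit x : Gamma x -> dot (normal x) (normal x) = 1.
Proof.
move=> Gx; have [_ _ _ _ /(_ x Gx)[b [i [g l]]]] := sO.
by rewrite (exterior_unit_normalE sO Gx l) unit_grad_dot//; case: l.
Qed.

Lemma bmG_dot_normal (c : 'rV[R]_d) : bmG (fun x => dot (normal x) c).
Proof.
apply: bm_sum => i; apply: bm_mul; last exact: bm_cst.
split; last first.
  exists 1 => x Gx; apply: le_trans (coord_le_enorm _ i) _.
  by rewrite /enorm normal_unit// sqrtr1.
apply: continuous_within_caratheodory; [exact: hausdorff_halfspace|exact: measurable_Gamma|].
exact: normal_continuous.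
Qed.

Definition inward A x : Prop := \forall t \near (0 : R)^'+, simplex A (x - t *: normal x).

(* On the right only countably many conditions occur, each measurable in x. *)
Lemma inwardP A x : nondegenerate A -> inward A x <->
  exists m : nat, forall i, i \in A -> 0 <= peval (bary A i) x /\
    0 <= peval (bary A i) x - m.+1%:R^-1 * dot (normal x) (bary A i).2.
Proof.
move=> nA; have pE i t : peval (bary A i) (x - t *: normal x) =
    peval (bary A i) x - t * dot (normal x) (bary A i).2.
  by rewrite pevalDr dotNr dotZr (dotC (normal x)).
split.
  move=> /nbhs_ballP[e /= e0 he].
  have {}he t : 0 < t < e -> forall i, i \in A ->
      0 <= peval (bary A i) x - t * dot (normal x) (bary A i).2.
    move=> /andP[t0 te] i iA; rewrite -pE; apply: (simplexP _ nA).1 => //.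
    by apply: he => //; rewrite /ball /= sub0r normrN gtr0_norm.
  have [m] := ltr_add_invr e0; rewrite add0r => me.
  exists m => i iA; split; last by apply: he => //; rewrite invr_gt0 ltr0n me.
  rewrite leNgt; apply/negP; set c := peval _ _ => c0; set b := dot (normal x) (bary A i).2.
  (* A negative value c at t = 0 would persist: here t |b| <= -c/2, so c - t b <= c/2 < 0. *)
  pose t := Num.min (e / 2) (- c / 2 / (`|b| + 1)).
  have b1 : 0 < `|b| + 1 by rewrite ltr_wpDl.
  have t0 : 0 < t by rewrite lt_min divr_gt0//= divr_gt0// divr_gt0// oppr_gt0.
  have te : t < e by rewrite gt_min; apply/orP; left; lra.
  have tb : t * (`|b| + 1) <= - c / 2 by rewrite -ler_pdivlMr// ge_min lexx orbT.
  have := he t _ i iA; rewrite t0 te -/c -/b => /(_ isT).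
  have := ler_norm (- b); rewrite normrN; nra.
move=> [m hm]; rewrite /inward; near=> t; apply/(simplexP _ nA) => i iA; rewrite pE.
have t0 : 0 < t by near: t; exact: nbhs_right_gt.
have tm : t < m.+1%:R^-1 by near: t; apply: nbhs_right_lt; rewrite invr_gt0.
have [h1 h2] := hm i iA; move: h1 h2 tm.
set c := peval _ _; set b := dot _ _; set q := _^-1 => h1 h2 tm.
(* Affine in t and nonnegative at 0 and at q, hence nonnegative in between. *)
by have [b0|b0] := leP b 0; nra.
Unshelve. all: by end_near. Qed.

Lemma inward_simplex A x : nondegenerate A -> inward A x -> simplex A x.
Proof. by move=> nA /(inwardP x nA)[m h]; apply/(simplexP x nA) => i /h[]. Qed.

Lemma measurable_inward A : nondegenerate A ->
  measurable (Gamma `&` inward A : set hausdorff).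
Proof.
move=> nA; have [M hM] := frontier_bounded sO.
have bP p : bmG (peval p).
  apply: (@bm_peval _ _ _ _ M) => //; [exact: hausdorff_halfspace|exact: measurable_Gamma|].
  by move=> x [cx _]; exact: hM.
have ge0 (f : 'rV[R]_d -> R) : bmG f -> measurable (Gamma `&` [set x | 0 <= f x] : set hausdorff).
  move=> [mf _]; have := mf measurable_Gamma `[0, +oo[%classic (measurable_itv _).
  by congr (measurable _); apply/seteqP; split => x /=; rewrite in_itv/= andbT.
pose E m i : set hausdorff := (Gamma `&` [set x | 0 <= peval (bary A i) x]) `&`
  (Gamma `&` [set x | 0 <= peval (bary A i) x + - m.+1%:R^-1 * dot (normal x) (bary A i).2]).
have mE m i : measurable (E m i).
  have bN := bm_mul (bm_cst _ (- m.+1%:R^-1 : R)) (bmG_dot_normal (bary A i).2).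
  by apply: measurableI; [exact: ge0 (bP _)|exact: ge0 (bm_add (bP _) bN)].
have -> : Gamma `&` inward A = \bigcup_(m in [set: nat]) (Gamma `&` \bigcap_(i in [set i | i \in A]) E m i).
  apply/seteqP; split => x.
    move=> [Gx /(inwardP x nA)[m h]]; exists m => //; split => // i /h[h1 h2].
    by split; split => //=; rewrite mulNr.
  move=> [m _ [Gx h]]; split => //; apply/(inwardP x nA); exists m => i iA.
  by have [[_ h1] [_ /= h2]] := h i iA; split => //; rewrite -mulNr.
apply: bigcupT_measurable => m; apply: measurableI; first exact: measurable_Gamma.
by apply: fin_bigcap_measurable => //; exact: finite_finset.
Qed.

Lemma bmG_normal_derivative v : bmG (normal_derivative v).
Proof.
apply: (@bm_pick _ _ _ _ measurable_Gamma _ (mem active) inward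
  (fun A x => dot (normal x) (v A).2)) => A.
  by move=> hA; apply: measurable_inward; exact: active_nd hA.
exact: bmG_dot_normal.
Qed.

Lemma val_at_linear (a : R) u v x : val_at (a *: u + v) x = a * val_at u x + val_at v x.
Proof.
rewrite /val_at; case: pickP => [A _|_]; last by rewrite mulr0 addr0.
by rewrite pwlinE pevalD pevalZ.
Qed.

Lemma grad_at_linear (a : R) u v x : grad_at (a *: u + v) x = a *: grad_at u x + grad_at v x.
Proof.
by rewrite /grad_at; case: pickP => [A _|_]; rewrite ?pwlinE// scaler0 addr0.
Qed.

Lemma normal_derivative_linear (a : R) u v x :
  normal_derivative (a *: u + v) x = a * normal_derivative u x + normal_derivative v x.
Proof.
rewrite /normal_derivative; case: pickP => [A _|_]; last by rewrite mulr0 addr0.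
by rewrite pwlinE /= dotDr dotZr.
Qed.

Lemma int_dom_linear (a : R) (f g : 'rV[R]_d -> R) : bmO f -> bmO g ->
  int_dom Omega (fun x => a * f x + g x) = a * int_dom Omega f + int_dom Omega g.
Proof. by move=> bf bg; exact: (ointegral_linear measurable_Omega Omega_fin a bf bg). Qed.

Lemma int_bd_linear (a : R) (f g : 'rV[R]_d -> R) : bmG f -> bmG g ->
  int_bd Omega (fun x => a * f x + g x) = a * int_bd Omega f + int_bd Omega g.
Proof.
by move=> bf bg; exact: (ointegral_linear measurable_Gamma (frontier_hausdorff_fin sO) a bf bg).
Qed.

Lemma nitscheC (gamma h : R) u v : nitsche Omega D gamma h u v = nitsche Omega D gamma h v u.
Proof.
have swap (f g : 'rV[R]_d -> R) : (fun x => f x * g x) = (fun x => g x * f x).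
  by apply/funext => x; rewrite mulrC.
rewrite /nitsche (swap (val_at u) (normal_derivative v)) (swap (val_at u) (val_at v)).
rewrite (swap (val_at v) (normal_derivative u)).
have -> : (fun x => dot (grad_at u x) (grad_at v x)) = (fun x => dot (grad_at v x) (grad_at u x)).
  by apply/funext => x; rewrite dotC.
ring.
Qed.

Lemma nitsche_linear (gamma h : R) (S : set (pwlin D)) w : linear_on S (fun v => nitsche Omega D gamma h v w).
Proof.
move=> a u v _ _; rewrite /nitsche.
have -> : (fun x => dot (grad_at (a *: u + v) x) (grad_at w x)) =
    (fun x => a * dot (grad_at u x) (grad_at w x) + dot (grad_at v x) (grad_at w x)).
  by apply/funext => x; rewrite grad_at_linear dotDl dotZl.
have -> : (fun x => normal_derivative (a *: u + v) x * val_at w x) =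
    (fun x => a * (normal_derivative u x * val_at w x) + normal_derivative v x * val_at w x).
  by apply/funext => x; rewrite normal_derivative_linear; ring.
have -> : (fun x => val_at (a *: u + v) x * normal_derivative w x) =
    (fun x => a * (val_at u x * normal_derivative w x) + val_at v x * normal_derivative w x).
  by apply/funext => x; rewrite val_at_linear; ring.
have -> : (fun x => val_at (a *: u + v) x * val_at w x) =
    (fun x => a * (val_at u x * val_at w x) + val_at v x * val_at w x).
  by apply/funext => x; rewrite val_at_linear; ring.
rewrite int_dom_linear; [|exact: bmO_grad|exact: bmO_grad].
have bN z := bmG_normal_derivative z; have bV z := bmG_val z.
rewrite !int_bd_linear; try exact: bm_mul.
ring.
Qed.

Lemma energy_terms_ge0 v :
  [/\ 0 <= int_dom Omega (fun x => enorm (grad_at v x) ^+ 2),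
      0 <= int_bd Omega (fun x => normal_derivative v x ^+ 2)
    & 0 <= int_bd Omega (fun x => val_at v x ^+ 2)].
Proof. by split; apply: ointegral_ge0 => x _; exact: sqr_ge0. Qed.

End Nitsche.

(** * The Nitsche form *)

Section Definiteness.
Context {R : realType} {d : nat}.
Variables (Omega Omega0 : set 'rV[R]_d) (D : cutmesh R d).
Hypotheses (sO : smooth_domain Omega) (d0 : (0 < d)%N).
Hypothesis tri : triangulation D Omega0.
Hypothesis OO : Omega `<=` Omega0.
Local Notation active := (active Omega D).
Local Notation Gamma := (frontier Omega).
Local Notation Vh := (Vh Omega D).
Local Notation VhE := (VhE Omega D).
Implicit Types (A B : elt D) (u v w : pwlin D) (x : 'rV[R]_d).

Lemma elts_nondegenerate A : A \in elts D -> nondegenerate A.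
Proof. by case: tri => _ + _ _; exact. Qed.

Lemma elts_simplexI A B : A \in elts D -> B \in elts D ->
  simplex A `&` simplex B = simplex (A :&: B).
Proof. by case: tri => _ _ + _; exact. Qed.

Let nd := elts_nondegenerate.

Lemma avoid_open (P : pred (elt D)) : (forall A, P A -> A \in active) ->
  open [set x | forall A, P A -> ~ simplex A x].
Proof.
move=> Pa; rewrite openE => x hx; apply: (@nbhs_forall _ _ x (fun A y => P A -> ~ simplex A y)) => A.
have [PA|PA] := boolP (P A); last by apply: (@filterS _ _ (nbhs_filter x) setT) => //; exact: filterT.
have oA : open (~` simplex A) by apply: closed_openC; apply: simplex_closed; exact: active_nd (Pa _ PA).
have : nbhs x (~` simplex A) by apply: open_nbhs_nbhs; split => //; exact: hx.
by apply: (@filterS _ _ (nbhs_filter x)) => y.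
Qed.

(** Otherwise a neighbourhood of x would avoid the finitely many closed active simplices. It
    contains a point of Omega, and the element that covers this point is active. *)
Lemma active_cover x : closure Omega x -> exists2 A, A \in active & simplex A x.
Proof.
move=> cx; apply: contrapT => nA.
have : nbhs x [set y | forall A, A \in active -> ~ simplex A y].
  apply: open_nbhs_nbhs; split; first exact: avoid_open.
  by move=> A hA xA; apply: nA; exists A.
move=> /cx[y [Oy hy]]; case: tri => _ _ _ cov.
have : closure Omega0 y by apply: subset_closure; exact: OO.
rewrite cov => -[A /= hA yA]; apply: (hy A _ yA).
by rewrite inE hA; apply/asboolP; exists y.
Qed.

Lemma Vh_consistent v A B x : Vh v -> A \in active -> B \in active ->
  simplex A x -> simplex B x -> peval (v A) x = peval (v B) x.
Proof. by move=> [_ +] hA hB xA xB; exact. Qed.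

Lemma val_atE v A x : Vh v -> A \in active -> simplex A x ->
  val_at Omega v x = peval (v A) x.
Proof.
move=> Vv hA xA; rewrite /val_at; case: pickP => [B /andP[hB /set_mem xB]|/(_ A)].
  exact: Vh_consistent.
by rewrite hA /= mem_set.
Qed.

Definition open_simplex A : set 'rV[R]_d := [set x | forall i, i \in A -> 0 < peval (bary A i) x].

Lemma open_simplex_open A : open (open_simplex A).
Proof.
rewrite openE => x hx.
apply: (@nbhs_forall _ _ x (fun i y => i \in A -> 0 < peval (bary A i) y)) => i.
have [iA|iA] := boolP (i \in A); last by apply: (@filterS _ _ (nbhs_filter x) setT) => //; exact: filterT.
have : nbhs x [set y | 0 < peval (bary A i) y].
  apply: (@peval_continuous R d (bary A i) x [set t | 0 < t]).
  by apply: open_nbhs_nbhs; split; [exact: open_gt|exact: hx].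
by apply: (@filterS _ _ (nbhs_filter x)) => y.
Qed.

(** A point of the common face has coordinate 0 at every vertex of A outside B. So in the open
    simplex the choice made by [grad_at] is forced. *)
Lemma open_simplex_unique A B x : A \in active -> B \in active ->
  open_simplex A x -> simplex B x -> B = A.
Proof.
move=> hA hB xA xB; have [cA _] := active_nd nd hA; have [cB _] := active_nd nd hB.
suff AB : A \subset B by apply/esym/eqP; rewrite eqEcard AB cA cB leqnn.
apply/fintype.subsetP => i iA; apply: contrapT => /negP iB.
have : (simplex A `&` simplex B) x.
  by split => //; apply/(simplexP x (active_nd nd hA)) => j /xA/ltW.
rewrite (active_simplexI elts_simplexI hA hB) => -[c [c0 cAB c1 xE]].
have := xA i iA; rewrite xE (bary_coef (active_nd nd hA))//.
  by rewrite cAB ?ltxx// inE (negPf iB) andbF.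
by move=> j jA; apply: cAB; rewrite inE (negPf jA).
Qed.

(** An active element may touch Omega only in a face; a short step from the common point towards the
    barycentre stays in the open set Omega and makes all coordinates positive. *)
Lemma open_simplex_meets A : A \in active -> Omega `&` open_simplex A !=set0.
Proof.
move=> hA; have nA := active_nd nd hA.
have : simplex A `&` Omega !=set0 by move: hA; rewrite inE => /andP[_ /asboolP].
move=> [x [xA Ox]]; have [cA _] := nA.
have oO : open Omega by case: sO.
have [r r0 xr] : exists2 r, 0 < r & forall y, enorm (y - x) < r -> Omega y.
  by apply: enorm_ball_subset; exact: open_nbhs_nbhs.
pose c (j : 'I_(nvert D)) : R := if j \in A then d.+1%:R^-1 else 0.
have c1 : \sum_j c j = 1.
  rewrite -big_mkcond /= sumr_const cA -[LHS]mulr_natr mulVf//.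
pose b := \sum_j c j *: vert j.
have bb i : i \in A -> peval (bary A i) b = d.+1%:R^-1.
  move=> iA; rewrite (bary_coef nA _ c1 iA) /c ?iA// => j /negPf jA.
  by rewrite jA.
have e1 : 0 < enorm (b - x) + 1 by rewrite ltr_wpDl ?enorm_ge0.
pose t := Num.min (1 / 2) (r / 2 / (enorm (b - x) + 1)).
have t0 : 0 < t by rewrite lt_min divr_gt0//= !divr_gt0.
have t1 : t <= 1 / 2 by rewrite ge_min lexx.
have tr : t * (enorm (b - x) + 1) <= r / 2 by rewrite -ler_pdivlMr// ge_min lexx orbT.
exists (x + t *: (b - x)); split.
  apply: xr; rewrite addrAC subrr add0r enormZ gtr0_norm//; nra.
move=> i iA; rewrite pevalDr dotZr.
have -> : dot (bary A i).2 (b - x) = peval (bary A i) b - peval (bary A i) x.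
  by rewrite /peval dotDr dotNr; ring.
rewrite bb//; have := (simplexP x nA).1 xA i iA.
have q0 : 0 < d.+1%:R^-1 :> R by rewrite invr_gt0.
set p := peval _ _; set q := _^-1 in q0 *; move=> p0.
have tq := mulr_gt0 t0 q0; have : 0 <= (1 - t) * p by rewrite mulr_ge0//; lra.
by move: tq; clear; lra.
Qed.

Lemma open_lebesgue_gt0 (U : set 'rV[R]_d) : open U -> U !=set0 -> (0 < lebesgue_outer U)%E.
Proof.
move=> oU [x Ux]; have /nbhs_ballP[r /= r0 xU] : nbhs x U by exact: open_nbhs_nbhs.
pose a : 'rV[R]_d := \row_i (x 0 i - r / 2); pose b : 'rV[R]_d := \row_i (x 0 i + r / 2).
have ab i : a 0 i < b 0 i by rewrite !mxE; lra.
have v0 : 0 < volume a b by apply: prodr_gt0 => i _; rewrite subr_gt0.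
apply: (@lt_le_trans _ _ (volume a b)%:E); first by rewrite lte_fin.
apply: le_trans (volume_le_lebesgue_outer ab) _; apply: le_outer_measure => y yab.
apply: xU; rewrite -ball_normE /=; apply: (@le_lt_trans _ _ (r / 2)); last lra.
rewrite [leLHS]mx_normrE; apply/bigmax_leP; split; first lra.
by move=> [u j] _ /=; rewrite ord1 !mxE ler_norml; have := yab j; rewrite !mxE; lra.
Qed.

(** The integrand is the constant |grad v|^2 of A on the part of Omega in the open simplex, a
    nonempty open set and so of positive measure. *)
Lemma gradient_eq0 v A : int_dom Omega (fun x => enorm (grad_at Omega v x) ^+ 2) <= 0 ->
  A \in active -> (v A).2 = 0.
Proof.
move=> I0 hA; have oO : open Omega by case: sO.
have oU : open (Omega `&` open_simplex A) by apply: openI => //; exact: open_simplex_open.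
have mU := open_caratheodory (@lebesgue_halfspace R d) oU.
have bg : bounded_measurable (Omega : set (caratheodory_type (@lebesgue_outer R d)))
    (fun x => enorm (grad_at Omega v x) ^+ 2).
  rewrite (funext (fun x => sqr_enorm (grad_at Omega v x))).
  exact: bmO_grad.
have pos : 0 < fine (lebesgue_outer (Omega `&` open_simplex A)).
  rewrite fine_gt0// open_lebesgue_gt0//=; last exact: open_simplex_meets.
  by apply: le_lt_trans (Omega_fin sO); apply: le_outer_measure => x [].
have := ointegral_ge_indic (measurable_Omega sO) (Omega_fin sO) (c := enorm (v A).2 ^+ 2) bg mU.
have cle x : Omega x -> enorm (v A).2 ^+ 2 * (`[< open_simplex A x >])%:R <=
    enorm (grad_at Omega v x) ^+ 2.
  move=> Ox; case: asboolP => [xA|_]; last by rewrite mulr0 sqr_ge0.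
  rewrite mulr1 /grad_at; case: pickP => [B /andP[hB /set_mem xB]|/(_ A)].
    by rewrite (open_simplex_unique hA hB xA xB).
  rewrite hA /= mem_set//; apply/(simplexP x (active_nd nd hA)) => j /xA/ltW //.
move=> /(_ cle) h; have {}h := le_trans h I0.
rewrite pmulr_lle0// in h; apply/enorm_eq0/eqP.
by rewrite -sqrf_eq0 eq_le h sqr_ge0.
Qed.

Lemma Vh_constant v A B : Vh v -> (forall A, A \in active -> (v A).2 = 0) ->
  A \in active -> B \in active -> (v B).1 = (v A).1.
Proof.
move=> Vv v0 hA hB; have vE C x : C \in active -> peval (v C) x = (v C).1.
  by move=> hC; rewrite /peval v0// dot0l addr0.
have cons C1 C2 x : C1 \in active -> C2 \in active -> simplex C1 x -> simplex C2 x ->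
    (v C1).1 = (v C2).1.
  by move=> h1 h2 x1 x2; rewrite -(vE C1 x)// -(vE C2 x)//; exact: Vh_consistent.
pose P1 C := (C \in active) && ((v C).1 == (v A).1).
pose P2 C := (C \in active) && ((v C).1 != (v A).1).
have meets C : C \in active -> exists2 x, Omega x & simplex C x.
  by rewrite inE => /andP[_ /asboolP[x []]]; exists x.
(* Elements with different constants cannot meet. S is relatively open as it stands and relatively
   closed in the form [SE], so connectedness gives S = Omega. *)
pose S := Omega `&` [set x | forall C, P2 C -> ~ simplex C x].
have SE : S = Omega `&` ~` [set x | forall C, P1 C -> ~ simplex C x].
  apply/seteqP; split => x [Ox h]; split => //.
    move=> h1; have [C hC xC] := active_cover (subset_closure Ox).
    have [e|e] := boolP ((v C).1 == (v A).1).
      by apply: (h1 C _ xC); rewrite /P1 hC.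
    by apply: (h C _ xC); rewrite /P2 hC.
  move=> C /andP[hC /eqP nC] xC; apply: h => C' /andP[hC' /eqP eC'] xC'.
  by apply: nC; rewrite (cons C C' x).
have conn : connected Omega by case: sO.
have SO : S = Omega.
  apply: conn.
  - have [x Ox xA] := meets A hA; exists x; split => // C /andP[hC /eqP nC] xC.
    by apply: nC; exact: cons xC xA.
  - exists [set x | forall C, P2 C -> ~ simplex C x] => //.
    by apply: avoid_open => C /andP[].
  - exists (~` [set x | forall C, P1 C -> ~ simplex C x]) => //.
    by apply: open_closedC; apply: avoid_open => C /andP[].
have [x Ox xB] := meets B hB; have : S x by rewrite SO.
move=> [_ h]; apply/eqP; apply: contrapT => /negP nB; apply: (h B _ xB).
by rewrite /P2 hB.
Qed.

Lemma Vh_eq0 v : Vh v ->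
  int_dom Omega (fun x => enorm (grad_at Omega v x) ^+ 2) <= 0 ->
  int_bd Omega (fun x => val_at Omega v x ^+ 2) <= 0 -> v = 0.
Proof.
move=> Vv I1 I3; have g0 A : A \in active -> (v A).2 = 0 by exact: gradient_eq0.
apply/ffunP => A; rewrite [RHS]ffunE.
have [hA|hA] := boolP (A \in active); last by case: Vv => + _; exact.
have vc x : Gamma x -> val_at Omega v x = (v A).1.
  move=> [cx _]; have [B hB xB] := active_cover cx.
  by rewrite (val_atE Vv hB xB) /peval (g0 B hB) dot0l addr0; exact: Vh_constant.
have bv : bounded_measurable (Gamma : set (caratheodory_type (@hausdorff_outer R d d.-1)))
    (fun x => val_at Omega v x ^+ 2).
  by apply: bm_mul; exact: bmG_val.
have Hfin := frontier_hausdorff_fin sO.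
have mG : measurable (Gamma `&` setT : set (caratheodory_type (@hausdorff_outer R d d.-1))).
  by rewrite setIT; exact: measurable_Gamma.
have := ointegral_ge_indic (measurable_Gamma Omega) Hfin (c := (v A).1 ^+ 2) bv mG.
have cle x : Gamma x -> (v A).1 ^+ 2 * (`[< [set: 'rV[R]_d] x >])%:R <= val_at Omega v x ^+ 2.
  by move=> Gx; rewrite vc// asboolT// mulr1.
move=> /(_ cle) h; have {}h := le_trans h I3.
have pos : 0 < fine (hausdorff_outer d.-1 (Gamma `&` setT)).
  by rewrite setIT fine_gt0// frontier_hausdorff_gt0//=.
rewrite pmulr_lle0// in h.
have v1 : (v A).1 = 0 by apply/eqP; rewrite -sqrf_eq0 eq_le h sqr_ge0.
by move: v1 (g0 A hA); case: (v A) => a b /= -> ->.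
Qed.

Lemma nitsche_inner_product (gamma h alpha : R) : 0 < h -> 0 < alpha ->
  (forall v, VhE v -> alpha * energy_sq Omega D h v <= nitsche Omega D gamma h v v) ->
  inner_product_on VhE (nitsche Omega D gamma h).
Proof.
move=> h0 a0 coer; split.
- move=> w _; exact: nitsche_linear.
- by move=> u v _ _; exact: nitscheC.
- move=> v Vv; apply: le_trans (coer v Vv); have [e1 e2 e3] := @energy_terms_ge0 R d Omega D v.
  by rewrite mulr_ge0 ?(ltW a0)// /energy_sq !addr_ge0// mulr_ge0 ?invr_ge0 ?(ltW h0).
- move=> v Vv n0; have := coer v Vv; rewrite n0 pmulr_rle0// /energy_sq => E0.
  have [e1 e2 e3] := @energy_terms_ge0 R d Omega D v.
  have he2 := mulr_ge0 (ltW h0) e2.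
  have hi : 0 < h^-1 by rewrite invr_gt0.
  have he3 := mulr_ge0 (ltW hi) e3.
  apply: Vh_eq0; first exact: (VhE_Vh nd elts_simplexI Vv).
    lra.
  by rewrite -(pmulr_rle0 _ hi); lra.
Qed.

End Definiteness.

(** * Inverse estimate and step restriction *)

Section InverseInequality.
Context {R : realType} {d : nat}.
Variables (Omega Omega0 : set 'rV[R]_d) (D : cutmesh R d) (sigma C h gamma CG : R) (K : nat).
Hypotheses (sO : smooth_domain Omega) (d0 : (0 < d)%N).
Hypothesis tri : triangulation D Omega0.
Hypothesis free : ebasis_free Omega D.
Hypotheses (sigma0 : 0 < sigma) (h0 : 0 < h) (CG0 : 0 <= CG).
Hypothesis reg : forall A, A \in elts D -> diam (simplex A) <= sigma * h /\
  exists x, forall y, enorm (y - x) <= sigma^-1 * h -> simplex A y.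
Hypothesis em : element_map Omega D C h.
Hypothesis aw : averaging_weights Omega D.
Hypothesis hCG : forall (S : set 'rV[R]_d) (rho : R), 0 < rho ->
    (forall y z, S y -> S z -> `|y - z| <= rho) ->
    (hausdorff_outer d.-1 (S `&` frontier Omega) <= (CG * rho ^+ d.-1)%:E)%E.
Hypothesis hK : 2 * (sigma + Num.max C sigma) * sigma * (Num.sqrt d%:R + 1) + 1 <= K%:R.
Local Notation active := (active Omega D).
Local Notation Gamma := (frontier Omega).
Local Notation dofs := (dofs Omega D).
Local Notation VhE := (VhE Omega D).
Local Notation kap := (stab_const sigma C).
Local Notation N2 v A := (local_norm2 Omega sigma C h (ecoef Omega v) A).
Local Notation S2 v := (\sum_(i in dofs) ecoef Omega v i ^+ 2).
Implicit Types (A B : elt D) (v : pwlin D) (x : 'rV[R]_d).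

Let nd := elts_nondegenerate tri.
Let simplexI := elts_simplexI tri.

Lemma step_sum_le v (c m : R) (T : elt D -> R) : 0 <= c -> 0 <= m ->
  (forall A, A \in active -> 0 <= T A <= m) ->
  \sum_(A in active) (c * N2 v A) * T A <= c * m * (K ^ d)%:R * S2 v.
Proof.
move=> c0 m0 hT.
apply: (@le_trans _ _ (\sum_(A in active) (c * m) * N2 v A)).
  apply: ler_sum => A /hT /andP[T0 Tm]; rewrite [leRHS]mulrAC ler_wpM2l//.
  by rewrite mulr_ge0// local_norm2_ge0.
rewrite -mulr_sumr -[leRHS]mulrA ler_wpM2l ?mulr_ge0//.
by apply: sum_local_norm2 hK.
Qed.

Let sh0 : 0 < sigma * h. Proof. by rewrite mulr_gt0. Qed.

Lemma simplex_dist A (y z : 'rV[R]_d) : A \in active -> simplex A y -> simplex A z ->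
  `|y - z| <= sigma * h.
Proof.
move=> hA yA zA; have hE : A \in elts D by move: hA; rewrite inE => /andP[].
apply: le_trans (norm_le_enorm _) _; apply: le_trans (reg hE).1.
by apply: enorm_le_diam => //; apply: simplex_bounded => x xA; exists A.
Qed.

Lemma simplex_volume_le A : A \in active ->
  0 <= fine (lebesgue_outer (Omega `&` simplex A)) <= (2 * (sigma * h)) ^+ d.
Proof.
move=> hA; rewrite fine_ge0 ?outer_measure_ge0//=.
have /set0Pn[i iA] : A != finset.set0 by rewrite -card_gt0 (active_nd nd hA).1.
pose a : 'rV[R]_d := \row_l (vert i 0 l - sigma * h).
pose b : 'rV[R]_d := \row_l (vert i 0 l + sigma * h).
have le_vol : (lebesgue_outer (Omega `&` simplex A) <= (volume a b)%:E)%E.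
  apply: lebesgue_outer_le_volume => [l|y [_ yA] l]; first by rewrite !mxE; move: sh0; lra.
  have := le_trans (coord_le_norm _ l) (simplex_dist hA yA (vert_simplex iA)).
  by rewrite !mxE ler_norml; lra.
have <- : volume a b = (2 * (sigma * h)) ^+ d.
  rewrite /volume (eq_bigr (fun=> 2 * (sigma * h))) ?prodr_const ?card_ord// => l _.
  by rewrite !mxE; ring.
rewrite -lee_fin fineK// ge0_fin_numE ?outer_measure_ge0//.
by apply: le_lt_trans le_vol _; exact: ltry.
Qed.

Lemma simplex_surface_le A : A \in active ->
  0 <= fine (hausdorff_outer d.-1 (Gamma `&` simplex A)) <= CG * (sigma * h) ^+ d.-1.
Proof.
move=> hA; rewrite fine_ge0 ?outer_measure_ge0//=.
have := hCG sh0 (fun y z => @simplex_dist A y z hA); rewrite setIC => hs.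
rewrite -lee_fin fineK// ge0_fin_numE ?outer_measure_ge0//.
by apply: le_lt_trans hs _; exact: ltry.
Qed.

Let indic_le v (c : R) A (S : elt D -> set 'rV[R]_d) x : 0 <= c -> A \in active -> S A x ->
  c * N2 v A <= \sum_(B in active) (c * N2 v B) * (`[< S B x >])%:R.
Proof.
move=> c0 hA xA; rewrite (bigD1 A)//= asboolT// mulr1 lerDl.
by apply: sumr_ge0 => B _; rewrite !mulr_ge0// local_norm2_ge0.
Qed.

Let indic_ge0 v (c : R) (S : elt D -> set 'rV[R]_d) x : 0 <= c ->
  0 <= \sum_(B in active) (c * N2 v B) * (`[< S B x >])%:R.
Proof. by move=> c0; apply: sumr_ge0 => B _; rewrite !mulr_ge0// local_norm2_ge0. Qed.

Lemma measurable_bd_simplex A : A \in active ->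
  measurable (Gamma `&` simplex A : set (caratheodory_type (@hausdorff_outer R d d.-1))).
Proof.
move=> hA; apply: measurableI; first exact: measurable_Gamma.
apply: closed_caratheodory; first exact: hausdorff_halfspace.
by apply: simplex_closed; exact: active_nd hA.
Qed.

Lemma grad_dom_le v : VhE v -> int_dom Omega (fun x => enorm (grad_at Omega v x) ^+ 2) <=
  (sigma / h * kap) ^+ 2 * (2 * (sigma * h)) ^+ d * (K ^ d)%:R * S2 v.
Proof.
move=> Vv; have c0 : 0 <= (sigma / h * kap) ^+ 2 by exact: sqr_ge0.
apply: le_trans (step_sum_le v c0 _ simplex_volume_le); last first.
  by rewrite exprn_ge0// mulr_ge0// ltW.
apply: (ointegral_step_le (measurable_Omega sO) (Omega_fin sO)).
- by rewrite (funext (fun x => sqr_enorm (grad_at Omega v x))); exact: bmO_grad.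
- move=> A hA; apply: measurableI; first exact: measurable_Omega.
  apply: closed_caratheodory; first exact: lebesgue_halfspace.
  by apply: simplex_closed; exact: active_nd hA.
- move=> x Ox; rewrite /grad_at; case: pickP => [A /andP[hA /set_mem xA]|_]; last first.
    by rewrite enorm0 expr0n /=; exact: indic_ge0.
  apply: le_trans (indic_le v c0 hA xA).
  exact: (gradient_bound nd simplexI free sigma0 h0 reg em aw).
Qed.

Lemma normal_bd_le v : VhE v -> int_bd Omega (fun x => normal_derivative Omega v x ^+ 2) <=
  (sigma / h * kap) ^+ 2 * (CG * (sigma * h) ^+ d.-1) * (K ^ d)%:R * S2 v.
Proof.
move=> Vv; have c0 : 0 <= (sigma / h * kap) ^+ 2 by exact: sqr_ge0.
apply: le_trans (step_sum_le v c0 _ simplex_surface_le); last first.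
  by rewrite mulr_ge0// exprn_ge0// ltW.
apply: (ointegral_step_le (measurable_Gamma Omega) (frontier_hausdorff_fin sO)).
- by apply: bm_mul; exact: bmG_normal_derivative.
- exact: measurable_bd_simplex.
- move=> x Gx; rewrite /normal_derivative; case: pickP => [A /andP[hA /asboolP xA]|_]; last first.
    by rewrite expr0n /=; exact: indic_ge0.
  have sA := inward_simplex (active_nd nd hA) xA.
  apply: le_trans (indic_le v c0 hA sA).
  apply: le_trans (gradient_bound nd simplexI free sigma0 h0 reg em aw Vv hA).
  rewrite -real_normK ?num_real// lerXn2r ?nnegrE ?enorm_ge0//.
  apply: le_trans (dot_le_enorm _ _) _.
  by rewrite {1}/enorm (normal_unit sO Gx) sqrtr1 mul1r.
Qed.

Lemma val_bd_le v : VhE v -> int_bd Omega (fun x => val_at Omega v x ^+ 2) <=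
  kap ^+ 2 * (CG * (sigma * h) ^+ d.-1) * (K ^ d)%:R * S2 v.
Proof.
move=> Vv; have c0 : 0 <= kap ^+ 2 by exact: sqr_ge0.
apply: le_trans (step_sum_le v c0 _ simplex_surface_le); last first.
  by rewrite mulr_ge0// exprn_ge0// ltW.
apply: (ointegral_step_le (measurable_Gamma Omega) (frontier_hausdorff_fin sO)).
- by apply: bm_mul; exact: bmG_val.
- exact: measurable_bd_simplex.
- move=> x Gx; rewrite /val_at; case: pickP => [A /andP[hA /set_mem xA]|_]; last first.
    by rewrite expr0n /=; exact: indic_ge0.
  apply: le_trans (indic_le v c0 hA xA).
  exact: (value_bound nd simplexI free sigma0 h0 reg em aw).
Qed.

(** The first summand is the domain term. In the second, sigma^2 and 1 come from the normal
    derivative and the trace after the consistency terms are split by Young's inequality, and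
    |gamma| from the penalty. *)
Definition inverse_const : R := (K ^ d)%:R * kap ^+ 2 *
  (sigma ^+ 2 * (2 * sigma) ^+ d + (sigma ^+ 2 + 1 + `|gamma|) * CG * sigma ^+ d.-1).

Lemma inverse_inequality v : VhE v ->
  nitsche Omega D gamma h v v <= inverse_const * h^-1 ^+ 2 * (h ^+ d * S2 v).
Proof.
move=> Vv; have I1 := grad_dom_le Vv; have I2 := normal_bd_le Vv; have I3 := val_bd_le Vv.
have bN := bmG_normal_derivative sO nd v; have bV := bmG_val sO nd v.
have hi : 0 < h^-1 by rewrite invr_gt0.
have S0 : 0 <= S2 v by apply: sumr_ge0 => i _; exact: sqr_ge0.
set J1 := int_dom _ _ in I1; set J2 := int_bd _ _ in I2; set J3 := int_bd _ _ in I3.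
have E1 : int_dom Omega (fun x => dot (grad_at Omega v x) (grad_at Omega v x)) = J1.
  by rewrite /J1; congr int_dom; apply/funext => x; rewrite sqr_enorm.
have E3 : int_bd Omega (fun x => val_at Omega v x * val_at Omega v x) = J3 by [].
have E2 : int_bd Omega (fun x => val_at Omega v x * normal_derivative Omega v x) =
    int_bd Omega (fun x => normal_derivative Omega v x * val_at Omega v x).
  by congr int_bd; apply/funext => x; rewrite mulrC.
(* - 2 a b <= h a^2 + h^-1 b^2 *)
have cross : - 2 * int_bd Omega (fun x => normal_derivative Omega v x * val_at Omega v x) <=
    h * J2 + h^-1 * J3.
  have bNV := bm_mul bN bV.
  have := int_bd_linear sO (h ^+ 2) (bm_mul bN bN) (bm_add (bm_mul (bm_cst _ (2 * h)) bNV) (bm_mul bV bV)).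
  rewrite (int_bd_linear sO (2 * h) bNV (bm_mul bV bV)) -/J2 -/J3 => E.
  have : 0 <= h ^+ 2 * J2 + (2 * h * int_bd Omega (fun x => normal_derivative Omega v x * val_at Omega v x) + J3).
    rewrite -E; apply: ointegral_ge0 => x _; set a := normal_derivative _ _ _; set b := val_at _ _ _.
    have -> : h ^+ 2 * (a * a) + (2 * h * (a * b) + b * b) = (h * a + b) ^+ 2 by ring.
    exact: sqr_ge0.
  rewrite -(pmulr_rge0 _ hi); set X := int_bd _ _.
  have -> : h^-1 * (h ^+ 2 * J2 + (2 * h * X + J3)) = h * J2 + (2 * X + h^-1 * J3).
    by field; rewrite gt_eqF.
  lra.
rewrite /nitsche E1 E2 E3.
have J30 : 0 <= J3 by apply: ointegral_ge0 => x _; exact: sqr_ge0.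
have gJ : gamma * h^-1 * J3 <= `|gamma| * h^-1 * J3.
  by rewrite -!mulrA ler_wpM2r ?mulr_ge0 ?(ltW hi)// ler_norm.
have step : J1 + h * J2 + h^-1 * J3 + `|gamma| * h^-1 * J3 <=
    inverse_const * h^-1 ^+ 2 * (h ^+ d * S2 v).
  apply: (@le_trans _ _ ((sigma / h * kap) ^+ 2 * (2 * (sigma * h)) ^+ d * (K ^ d)%:R * S2 v +
    h * ((sigma / h * kap) ^+ 2 * (CG * (sigma * h) ^+ d.-1) * (K ^ d)%:R * S2 v) +
    (h^-1 + `|gamma| * h^-1) * (kap ^+ 2 * (CG * (sigma * h) ^+ d.-1) * (K ^ d)%:R * S2 v))).
    rewrite -[leLHS]addrA -mulrDl lerD//; first by rewrite lerD// ler_pM2l.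
    by rewrite ler_wpM2l// addr_ge0 ?mulr_ge0 ?(ltW hi).
  rewrite le_eqVlt; apply/orP; left; apply/eqP; rewrite /inverse_const.
  have hd : h ^+ d = h * h ^+ d.-1 by rewrite -exprS prednK.
  by rewrite !exprMn hd; field; rewrite gt_eqF.
apply: le_trans step; lra.
Qed.

Lemma inverse_lumped (m k : R) v : 0 < m ->
  (forall i, i \in dofs -> m * h ^+ d <= lumped_mass Omega D i) ->
  0 < k -> k / h <= (1 + `|inverse_const| / m)^-1 -> VhE v ->
  k ^+ 2 * nitsche Omega D gamma h v v <= ip_lumped Omega D v v.
Proof.
move=> m0 lm k0 kh Vv; have ineq := inverse_inequality Vv.
set B := inverse_const in kh ineq; set S := \sum_(_ in _) _ in ineq.
have S0 : 0 <= h ^+ d * S.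
  by rewrite mulr_ge0 ?exprn_ge0 ?(ltW h0)//; apply: sumr_ge0 => i _; exact: sqr_ge0.
apply: (@le_trans _ _ (m * (h ^+ d * S))).
  apply: (@le_trans _ _ ((k / h) ^+ 2 * (`|B| * (h ^+ d * S)))).
    rewrite exprMn -[leRHS]mulrA ler_pM2l ?exprn_gt0//; apply: le_trans ineq _.
    by rewrite [leRHS]mulrA ler_wpM2r// mulrC ler_wpM2l ?sqr_ge0 ?ler_norm.
  rewrite [leLHS]mulrA ler_wpM2r//.
  (* With t = k/h, the bound t (1 + Q) <= 1 gives t <= 1 and t Q <= 1, hence t^2 Q <= 1 without a
     square root in the restriction. *)
  set Q := `|B| / m in kh *; have Q0 : 0 <= Q by rewrite divr_ge0// ltW.
  have B0 : `|B| = Q * m by rewrite divfK ?gt_eqF.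
  have kh0 : 0 <= k / h by rewrite divr_ge0 ?ltW.
  have Q1 : 0 < 1 + Q by rewrite ltr_wpDr.
  have kh1 : k / h * (1 + Q) <= 1 by rewrite -ler_pdivlMr// mul1r.
  rewrite B0 [leLHS]mulrA; apply: ler_piMl; first exact: ltW.
  have tQ := mulr_ge0 kh0 Q0; move: kh0 kh1 tQ; rewrite mulrDr mulr1; set t := k / h => t0 t1 tQ.
  rewrite expr2 -mulrA mulr_ile1//; lra.
rewrite /ip_lumped mulrA /S mulr_sumr; apply: ler_sum => i iD.
by rewrite -[leRHS]mulrA -expr2 ler_wpM2r ?sqr_ge0 ?lm.
Qed.

End InverseInequality.

Theorem lemma3p4 (R : realType) (d : nat) (Omega Omega0 : set 'rV[R]_d)
    (h0 gamma Tend : R) (D : R -> cutmesh R d) :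
  (2 <= d)%N ->
  smooth_domain Omega ->
  polygonal_domain Omega0 ->
  Omega `<=` Omega0 ->
  0 < h0 ->
  (* the triangulations T_{0,h}, h in (0, h0] *)
  (forall h : R, 0 < h <= h0 -> triangulation (D h) Omega0) ->
  quasi_uniform h0 (fun h => bgmesh (D h)) ->
  (* S_h and kappa_{T,x} *)
  (exists C : R, forall h : R, 0 < h <= h0 -> element_map Omega (D h) C h) ->
  (forall h : R, 0 < h <= h0 -> averaging_weights Omega (D h)) ->
  (* { E_h phi_i } is a basis of V_h^E *)
  (forall h : R, 0 < h <= h0 -> ebasis_free Omega (D h)) ->
  (* the lumped mass matrix is positive definite on the scale h^d of the mass
     matrix, uniformly in h *)
  (exists2 m : R, 0 < m & forall h : R, 0 < h <= h0 ->
    forall i, i \in dofs Omega (D h) ->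
      m * h ^+ d <= lumped_mass Omega (D h) i) ->
  (* a_h is coercive on V_h^E, uniformly in h *)
  (exists2 alpha : R, 0 < alpha & forall h : R, 0 < h <= h0 ->
    forall v, VhE Omega (D h) v ->
      alpha * energy_sq Omega (D h) h v <= nitsche Omega (D h) gamma h v v) ->
  0 < Tend ->
  exists2 c : R, 0 < c &
  forall Cr : R, exists C : R,
  forall (h : R) (N : nat), 0 < h <= h0 -> (0 < N)%N ->
  let k := Tend / N%:R in
  k / h <= c ->
  let V := VhE Omega (D h) in
  let ah := nitsche Omega (D h) gamma h in
  let norm_a := norm_nitsche Omega (D h) gamma h in
  let norm_L := norm_lumped Omega (D h) in
  let tnorm_a := tnorm_nitsche (dual_norm Omega (D h) norm_a) k N in
  let tnorm_L := tnorm_lumped (dual_norm Omega (D h) norm_L) k N in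
  forall (v : nat -> pwlin (D h)) (r1 r2 : nat -> pwlin (D h) -> R^o),
  (forall n, (n <= N)%N -> V (v n)) ->
  (forall n, (n <= N)%N -> linear_functional Omega (D h) (r1 n)) ->
  (forall n, (1 <= n < N)%N -> linear_functional Omega (D h) (r2 n)) ->
  (forall n, (1 <= n < N)%N -> forall w, V w ->
    ip_lumped Omega (D h) (dtt k v n) w + ah (v n) w = r1 n w + r2 n w) ->
  `| \sum_(1 <= n < N) 2 * k * (r1 n (deltat k v n) + r2 n (deltat k v n)) |
    <= Cr * (tnorm_a r1 * \big[Num.max/0]_(0 <= n < N.+1) norm_a (v n)
             + tnorm_L r2 * \big[Num.max/0]_(0 <= n < N) norm_L (dt k v n)) ->
  \big[Num.max/0]_(2 <= n < N.+1)
      (norm_L (dt k v n.-1) ^+ 2 + norm_a (v n) ^+ 2 + norm_a (v n.-1) ^+ 2)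
    <= C * (norm_L (dt k v 0%N) ^+ 2 + norm_a (v 1%N) ^+ 2
            + norm_a (v 0%N) ^+ 2 + tnorm_a r1 ^+ 2 + tnorm_L r2 ^+ 2).
Proof.
move=> d2 sO _ OO h00 tri [sigma sigma0 reg] [C em] aw free [m m0 lm] [alpha alpha0 coer] T0.
have d0 : (0 < d)%N by exact: ltnW.
have [CG CG0 hCG] := frontier_hausdorff_le sO.
(* An integer above the packing ratio, chosen before h. *)
pose K := (Num.truncn (2 * (sigma + Num.max C sigma) * sigma * (Num.sqrt d%:R + 1) + 1)).+1.
have hK : 2 * (sigma + Num.max C sigma) * sigma * (Num.sqrt d%:R + 1) + 1 <= K%:R.
  exact/ltW/truncnS_gt.
exists ((1 + `|@inverse_const R d sigma C gamma CG K| / m)^-1).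
  by rewrite invr_gt0 ltr_wpDr ?divr_ge0 ?(ltW m0).
move=> Cr; exists 128 => h N hh N0 k kh V ah norm_a norm_L tnorm_a tnorm_L v r1 r2 Vv lr1 lr2 scheme _.
have {}tri := tri _ hh; have {}em := em _ hh; have {}aw := aw _ hh; have {}free := free _ hh.
have {}reg := reg _ hh; have {}lm := lm _ hh; have {}coer := coer _ hh.
have h0' : 0 < h by case/andP: hh.
have nd := elts_nondegenerate tri; have simplexI := elts_simplexI tri.
have k0 : 0 < k by rewrite divr_gt0// ltr0n.
have subV : subspace V := subspace_VhE _ _.
have lm0 i : i \in dofs Omega (D h) -> 0 < lumped_mass Omega (D h) i.
  by move=> /lm; apply: lt_le_trans; rewrite mulr_gt0// exprn_gt0.
have ipL : inner_product_on V (ip_lumped Omega (D h)) := lumped_inner_product nd simplexI free lm0.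
have ipa : inner_product_on V ah := nitsche_inner_product sO d0 tri OO h0' alpha0 coer.
have [e [eV efree espan]] := ebasis_enum nd simplexI free.
have lin l : linear_functional Omega (D h) l -> linear_on V l.
  by move=> ll a u w Vu Vw; apply: ll; exact: (VhE_Vh nd simplexI).
have inv u : V u -> k ^+ 2 * ah u u <= ip_lumped Omega (D h) u u.
  exact: (inverse_lumped sO d0 tri free sigma0 h0' CG0 reg em aw hCG hK m0 lm k0 kh).
have main n := stability subV ipL ipa k0 N0 inv
  (DL := dual_norm Omega (D h) norm_L) (Da := dual_norm Omega (D h) norm_a)
  (fun l ll => conj (ip_dual_ge0 subV ipL eV efree espan ll) (ip_dual_bound subV ipL eV efree espan ll))
  (fun l ll => conj (ip_dual_ge0 subV ipa eV efree espan ll) (ip_dual_bound subV ipa eV efree espan ll))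
  Vv (fun n nN => lin _ (lr1 n nN)) (fun n nN => lin _ (lr2 n nN)) scheme (m := n).
(* The index n is m + 1 with m < N. The maximum starts from 0, its value for N = 1, so the
   right-hand side must also be shown nonnegative. *)
rewrite big_seq_cond; apply: bigmax_le => [|n]; last first.
  by rewrite andbT mem_index_iota; case: n => // n /andP[_ nN]; exact: main.
by rewrite mulr_ge0// !addr_ge0 ?sqr_ge0.
Qed.
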